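(* Let $\gamma>1$, $(p,q,k)\in(\mathbb{N}^* )^2\times\mathbb{N}$ and let $M_1$ and $M_2$ be two positive real numbers. Let $U$ be an open subset of $\mathbb{R}^p$ and let $\varphi=(\varphi_1,\ldots,\varphi_q):U\to\mathbb{R}^q$ be an almost $\mathrm{Lip}-\gamma$ map of rank at most $k$ (i.e. $\mathrm{d}\varphi(x)$ has rank at most $k$ for every $x\in U$). Let $x_0\in U$ be such that $\mathrm{d}\varphi(x_0)$ is of rank $k$, and let $(i_1,\ldots,i_k)$ and $(j_1,\ldots,j_k)$ be, respectively, strictly ordered subsets of $\{1,\dots,q\}$ and $\{1,\dots,p\}$ such that the matrix $M=\left(\frac{\partial\varphi_{i_r}}{\partial x_{j_l}}(x_0)\right)_{1\leq r,l\leq k}$ is invertible. Assume that $$\|\mathrm{d}\varphi\|_{\mathrm{Lip}-(\gamma-1)}\leq M_1\quad\text{and}\quad\|M^{-1}\|\leq M_2.$$ Then there exist a constant $c$, depending only on $\gamma$, $M_1$ and $M_2$ (the dimensions $p,q,k$ being fixed), and: (i) an almost $\mathrm{Lip}-\gamma$ diffeomorphism $f:U_0\to f(U_0)$ defined on an open subset $U_0$ of $\mathbb{R}^p$ containing $x_0$ (with $U_0\subseteq U$) such that $\max(\|\mathrm{d}f\|_{\mathrm{Lip}-(\gamma-1)},\|\mathrm{d}f^{-1}\|_{\mathrm{Lip}-(\gamma-1)})\leq c$; (ii) an almost $\mathrm{Lip}-\gamma$ diffeomorphism $g:W\to g(W)$ defined on an open subset $W$ of $\mathbb{R}^q$ containing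 $\varphi(x_0)$ (with $\varphi(U_0)\subseteq W$) such that $\max(\|\mathrm{d}g\|_{\mathrm{Lip}-(\gamma-1)},\|\mathrm{d}g^{-1}\|_{\mathrm{Lip}-(\gamma-1)})\leq c$; such that, for all $(x_1,\ldots,x_p)\in f(U_0)$, $$g\circ\varphi\circ f^{-1}(x_1,\ldots,x_p)=(x_1,\ldots,x_k,0,\ldots,0).$$ If $k=p$, then there exists a constant $\delta>0$ depending only on $\gamma$, $M_1$ and $M_2$ (the dimensions being fixed) such that for every $\alpha\in(0,\delta]$ satisfying $\overline{B(x_0,\alpha)}\subseteq U$, setting $U_0=B\left(x_0,\frac{\alpha}{3\max(1,M_1M_2)}\right)$, there exist, with the same constant $c$, an almost $\mathrm{Lip}-\gamma$ diffeomorphism $f:U_0\to f(U_0)$ such that $\max(\|\mathrm{d}f\|_{\mathrm{Lip}-(\gamma-1)},\|\mathrm{d}f^{-1}\|_{\mathrm{Lip}-(\gamma-1)})\leq c$ and an almost $\mathrm{Lip}-\gamma$ diffeomorphism $g:W\to g(W)$ defined on an open subset $W$ of $\mathbb{R}^q$ containing $\varphi(x_0)$ (with $\varphi(U_0)\subseteq W$) such that $\max(\|\mathrm{d}g\|_{\mathrm{Lip}-(\gamma-1)},\|\mathrm{d}g^{-1}\|_{\mathrm{Lip}-(\gamma-1)})\leq c$, satisfying, for all $(x_1,\ldots,x_p)\in f(U_0)$, $g\circ\varphi\circ f^{-1}(x_1,\ldots,x_p)=(x_1,\ldots,x_p,0,\ldots,0)$. Moreover, $\varphi_{|U_0}$ is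 then an injective immersion and admits a local inverse $\hat\varphi$ on $U_0$ that is almost $\mathrm{Lip}-\gamma$ and such that $\|\mathrm{d}\hat\varphi\|_{\mathrm{Lip}-(\gamma-1)}\leq c$.
   Context: Notation. $\mathbb{N}=\{0,1,2,\dots\}$, $\mathbb{N}^*=\mathbb{N}\setminus\{0\}$. $B(x,r)$ is the open ball. $E^{\otimes k}$ is the $k$-fold algebraic tensor power of $E$, with a fixed norm also denoted $\|\cdot\|$. $\mathcal{L}_s(E^{\otimes k},F)$ is the space of symmetric $k$-linear mappings from $E$ to $F$, seen as linear maps on $E^{\otimes k}$. Lipschitz maps. Let $n\in\mathbb{N}$, $0<\varepsilon\leq1$, $U\subseteq E$ any subset, $f^0:U\to F$ and $f^k:U\to\mathcal{L}_s(E^{\otimes k},F)$ for $1\leq k\leq n$. The remainder of order $k$ ($0\leq k\leq n$) of $f=(f^0,\dots,f^n)$ is defined by $$f^k(x)(v)=\sum_{j=k}^n f^j(y)\Big(\frac{v\otimes(x-y)^{\otimes(j-k)}}{(j-k)!}\Big)+R_k(x,y)(v),\quad x,y\in U,\ v\in E^{\otimes k}.$$ $f$ is $\mathrm{Lip}-(n+\varepsilon)$ on $U$ if there is $M$ such that for all $0\leq k\leq n$, $x,y\in U$, $v_1,\dots,v_k\in E$: $\|f^k(x)(v_1\otimes\cdots\otimes v_k)\|\leq M\|v_1\otimes\cdots\otimes v_k\|$ and $\|R_k(x,y)(v_1\otimes\cdots\otimes v_k)\|\leq M\|x-y\|^{n+\varepsilon-k}\|v_1\otimes\cdots\otimes v_k\|$.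 The smallest such $M$ is $\|f\|_{\mathrm{Lip}-(n+\varepsilon)}$. One often says that $f^0$ is Lip, the maps $f^1,\dots,f^n$ being understood; on open sets they are necessarily the successive derivatives of $f^0$. Almost Lipschitz maps. Let $n\in\mathbb{N}^*$, $0<\varepsilon\leq1$, $\delta\in(0,\infty]$. $f=(f^0,\dots,f^n)$ is almost Lipschitz of degree $n+\varepsilon$ on domains of size $\delta$ of $U$ if $(f^1,\dots,f^n)$ is $\mathrm{Lip}-(n+\varepsilon-1)$ (where $f^1$ takes values in $\mathcal{L}(E,F)$ and $f^{k+1}$ is identified with the order-$k$ component $(f^1)^k$ via $(f^1)^k(x)(v_1\otimes\cdots\otimes v_k)(v_{k+1})=f^{k+1}(x)(v_1\otimes\cdots\otimes v_{k+1})$) and there is $\tilde M\geq0$ with $\|R_0(x,y)\|\leq\tilde M\|x-y\|^{n+\varepsilon}$ for all $x,y\in U$ with $\|x-y\|<\delta$. When $\delta$ is infinite or its value is irrelevant (i.e. the property holds for some $\delta$), $f$ is simply called almost $\mathrm{Lip}-(n+\varepsilon)$ on $U$. One writes $\mathrm{d}f=f^1$; on an open set it is the Fréchet derivative of $f$. Diffeomorphisms, immersions, local inverses. A map $f:U\to V$ is an almost $\mathrm{Lip}-\gamma$ diffeomorphism if it is bijective and both $f$ and $f^{-1}$ are almost $\mathrm{Lip}-\gamma$. A differentiable map is an immersion if its derivative is injective at every point. A local inverse on $U_0\subseteq E$ of a map $\varphi:U_0\to F$ is an $E$-valued map $\hat\varphi$ defined on a subset of $F$ containing $\varphi(U_0)$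 such that $\hat\varphi\circ\varphi_{|U_0}=\mathrm{Id}_{U_0}$. Standing assumptions. Finite-dimensional spaces $\mathbb{R}^m$ carry the $l^\infty$ norm; norms of linear maps and matrices are the subordinate (operator) norms. The norms on tensor powers satisfy $\|v\otimes\tilde v\|=\|v\|\|\tilde v\|$ for all $k$, $v\in E^{\otimes k}$, $\tilde v\in E$; the projective property $\|a\otimes b\|\leq\|a\|\|b\|$ for $a\in E^{\otimes p}$, $b\in E^{\otimes q}$; compatibility ($\|u^{\otimes k}\|\leq\|u\|^k$ for bounded linear $u$); and symmetry ($\|\sigma(x)\|=\|x\|$ for permutations $\sigma$ of the tensor factors). *)

(* Defs.v *)
From HB Require Import structures.
From mathcomp Require Import all_boot all_order all_algebra all_fingroup.
From mathcomp Require Import all_classical all_reals all_analysis.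

Set Implicit Arguments.
Unset Strict Implicit.
Unset Printing Implicit Defensive.

Import Order.TTheory GRing.Theory Num.Theory.
Import numFieldNormedType.Exports.

Local Open Scope classical_set_scope.
Local Open Scope ring_scope.

(* R^p is 'cV[R]_p; its library norm is the l^oo norm. *)

(* (R^p)^{(x) k} is realised by coordinates in the basis
   e_{I 0} (x) ... (x) e_{I (k-1)}, I : {0..k-1} -> {0..p-1}. *)
Definition tens (R : realType) (p k : nat) :=
  {ffun {ffun 'I_k -> 'I_p} -> R^o}.

(* v_1 (x) ... (x) v_k *)
Definition pure (R : realType) (p k : nat) (v : 'I_k -> 'cV[R]_p)
    : tens R p k :=
  [ffun I : {ffun 'I_k -> 'I_p} => (\prod_(l < k) v l (I l) 0 : R^o)].

Definition tpow (R : realType) (p : nat) (w : 'cV[R]_p) (k : nat)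
    : tens R p k := pure (fun _ : 'I_k => w).

(* The element 1 of (R^p)^{(x) 0} = R. *)
Definition tunit (R : realType) (p : nat) : tens R p 0 := [ffun=> (1 : R^o)].

Definition tprod (R : realType) (p k l : nat) (a : tens R p k)
    (b : tens R p l) : tens R p (k + l) :=
  [ffun I : {ffun 'I_(k + l) -> 'I_p} =>
     (a [ffun r => I (lshift l r)] * b [ffun r => I (rshift k r)] : R^o)].

Definition tact (R : realType) (p k : nat) (s : {perm 'I_k})
    (t : tens R p k) : tens R p k :=
  [ffun I : {ffun 'I_k -> 'I_p} => t [ffun r => I (s r)]].

(* u^{(x) k}, for u the linear map with matrix A. *)
Definition tmap (R : realType) (m p k : nat) (A : 'M[R]_(m, p))
    (t : tens R p k) : tens R m k :=
  [ffun I : {ffun 'I_k -> 'I_m} =>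
     (\sum_(J : {ffun 'I_k -> 'I_p}) (\prod_(l < k) A (I l) (J l)) * t J
        : R^o)].

(* Operator norm subordinate to the l^oo norms, A acting on columns. *)
Definition opnorm (R : realType) (m n : nat) (A : 'M[R]_(m, n)) : R :=
  sup [set `|A *m v| | v in [set v : 'cV[R]_n | `|v| <= 1]].

Record tensor_norms (R : realType) (N : forall p k, tens R p k -> R) : Prop := {
  tn_definite : forall p k (t : tens R p k), N p k t = 0 -> t = 0 ;
  tn_triangle : forall p k (s t : tens R p k),
    N p k (s + t) <= N p k s + N p k t ;
  tn_homogeneous : forall p k (a : R) (t : tens R p k),
    N p k (a *: t) = `|a| * N p k t ;
  (* E^{(x) 0} = R and E^{(x) 1} = E carry their own norms *)
  tn_unit : forall p, N p 0%N (tunit R p) = 1 ;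
  tn_vector : forall p (w : 'cV[R]_p), N p 1%N (tpow w 1) = `|w| ;
  tn_cross : forall p k (t : tens R p k) (w : 'cV[R]_p),
    N p (k + 1)%N (tprod t (tpow w 1)) = N p k t * `|w| ;
  tn_projective : forall p k l (a : tens R p k) (b : tens R p l),
    N p (k + l)%N (tprod a b) <= N p k a * N p l b ;
  tn_compatible : forall m p k (A : 'M[R]_(m, p)) (t : tens R p k),
    N m k (tmap A t) <= opnorm A ^+ k * N p k t ;
  tn_symmetric : forall p k (s : {perm 'I_k}) (t : tens R p k),
    N p k (tact s t) = N p k t
}.

(* A family (f^0, f^1, ...) with f^k x : (R^p)^{(x) k} -> F; only the orders
   k <= n are ever constrained, and f^0 x is identified with its value at 1. *)
Definition jet (R : realType) (p : nat) (F : Type) :=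
  forall k : nat, 'cV[R]_p -> tens R p k -> F.

Definition symlinear (R : realType) (p k : nat) (F : lmodType R)
    (u : tens R p k -> F) : Prop :=
  linear u /\ forall (s : {perm 'I_k}) (t : tens R p k), u (tact s t) = u t.

(* The sum over k <= j <= n is indexed by m = j - k. *)
Definition lip_rem (R : realType) (p : nat) (F : lmodType R) (n : nat)
    (f : jet R p F) (k : nat) (x y : 'cV[R]_p) (v : tens R p k) : F :=
  f k x v - \sum_(m < n.+1 - k)
    f (k + m)%N y ((m`!%:R : R)^-1 *: tprod v (tpow (x - y) m)).

(* Every gamma > 0 is n + eps for a unique n : nat and a unique eps in ]0, 1];
   this is n. *)
Definition lipdeg (R : realType) (gamma : R) : nat := `|Num.ceil gamma|%N.-1.

Lemma lipdegE (R : realType) (n : nat) (eps : R) :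
  0 < eps <= 1 -> lipdeg (n%:R + eps) = n.
Proof.
move=> /andP[e0 e1]; rewrite /lipdeg.
suff -> : Num.ceil (n%:R + eps) = n.+1%:Z by [].
apply: ceil_def; rewrite -[n.+1]addn1 PoszD addrK intrD -!pmulrn.
by rewrite ltrDl e0 lerD2l.
Qed.

(* nF is the norm considered on F, which for spaces of matrices is opnorm and
   not the library norm. *)
Definition lip_bound (R : realType) (N : forall p k, tens R p k -> R)
    (p : nat) (F : lmodType R) (nF : F -> R) (gamma : R) (U : set 'cV[R]_p)
    (f : jet R p F) (M : R) : Prop :=
  0 <= M /\
  forall k : nat, (k <= lipdeg gamma)%N ->
  forall x y, U x -> U y -> forall v : 'I_k -> 'cV[R]_p,
    nF (f k x (pure v)) <= M * N p k (pure v) /\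
    nF (lip_rem (lipdeg gamma) f x y (pure v))
      <= M * `|x - y| `^ (gamma - k%:R) * N p k (pure v).

Definition is_lip (R : realType) (N : forall p k, tens R p k -> R)
    (p : nat) (F : lmodType R) (nF : F -> R) (gamma : R) (U : set 'cV[R]_p)
    (f : jet R p F) : Prop :=
  (forall k : nat, (k <= lipdeg gamma)%N -> forall x, U x ->
     symlinear (f k x)) /\
  exists M : R, lip_bound N nF gamma U f M.

Definition lip_norm (R : realType) (N : forall p k, tens R p k -> R)
    (p : nat) (F : lmodType R) (nF : F -> R) (gamma : R) (U : set 'cV[R]_p)
    (f : jet R p F) : R :=
  inf [set M | lip_bound N nF gamma U f M].

(* df = (f^1, ..., f^n) as a jet with values in L(R^p, R^q) = 'M_(q, p):
   column j of (f^1)^k x t is f^{k+1} x (t (x) e_j). *)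
Definition djet (R : realType) (p q : nat) (f : jet R p 'cV[R]_q)
    : jet R p 'M[R]_(q, p) :=
  fun k x t =>
    \matrix_(i, j) f (k + 1)%N x (tprod t (tpow (delta_mx j 0) 1)) i 0.

Definition almost_lip_on (R : realType) (N : forall p k, tens R p k -> R)
    (p q : nat) (gamma : R) (delta : \bar R) (U : set 'cV[R]_p)
    (phi : 'cV[R]_p -> 'cV[R]_q) (f : jet R p 'cV[R]_q) : Prop :=
  [/\ forall x, U x -> f 0%N x (tunit R p) = phi x,
      forall k : nat, (k <= lipdeg gamma)%N -> forall x, U x ->
        symlinear (f k x),
      is_lip N (@opnorm R q p) (gamma - 1) U (djet f) &
      exists2 M : R, 0 <= M &
        forall x y, U x -> U y -> (`|x - y|%:E < delta)%E ->
          `|lip_rem (lipdeg gamma) f x y (tunit R p)|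
            <= M * `|x - y| `^ gamma].

Definition almost_lip (R : realType) (N : forall p k, tens R p k -> R)
    (p q : nat) (gamma : R) (U : set 'cV[R]_p)
    (phi : 'cV[R]_p -> 'cV[R]_q) (f : jet R p 'cV[R]_q) : Prop :=
  exists2 delta : \bar R, (0 < delta)%E &
    almost_lip_on N gamma delta U phi f.

(* ||d phi||_{Lip-(gamma - 1)} on U, for the almost Lip-gamma map of jet f. *)
Definition dlip_norm (R : realType) (N : forall p k, tens R p k -> R)
    (p q : nat) (gamma : R) (U : set 'cV[R]_p) (f : jet R p 'cV[R]_q) : R :=
  lip_norm N (@opnorm R q p) (gamma - 1) U (djet f).

(* finv is the inverse of f : U -> V; only its values on V matter. *)
Definition almost_lip_diffeo (R : realType)
    (N : forall p k, tens R p k -> R) (p q : nat) (gamma : R)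
    (U : set 'cV[R]_p) (V : set 'cV[R]_q)
    (f : 'cV[R]_p -> 'cV[R]_q) (finv : 'cV[R]_q -> 'cV[R]_p)
    (jf : jet R p 'cV[R]_q) (jfinv : jet R q 'cV[R]_p) : Prop :=
  [/\ set_bij U V f,
      forall x, U x -> finv (f x) = x,
      almost_lip N gamma U f jf &
      almost_lip N gamma V finv jfinv].

Definition immersion_on (R : realType) (p q : nat) (U : set 'cV[R]_p)
    (phi : 'cV[R]_p -> 'cV[R]_q) : Prop :=
  forall x, U x -> differentiable phi x /\ injective ('d phi x).

Definition local_inverse (R : realType) (p q : nat) (U0 : set 'cV[R]_p)
    (phi : 'cV[R]_p -> 'cV[R]_q)
    (V : set 'cV[R]_q) (psi : 'cV[R]_q -> 'cV[R]_p) : Prop :=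
  phi @` U0 `<=` V /\ forall x, U0 x -> psi (phi x) = x.

(* Matrix of the Frechet derivative, acting on columns. *)
Definition diff_mx (R : realType) (p q : nat) (phi : 'cV[R]_p -> 'cV[R]_q)
    (x : 'cV[R]_p) : 'M[R]_(q, p) :=
  \matrix_(i, j) 'd phi x (delta_mx j 0) i 0.

Definition partial_mx (R : realType) (p q k : nat)
    (phi : 'cV[R]_p -> 'cV[R]_q) (i : 'I_k -> 'I_q) (j : 'I_k -> 'I_p)
    (x : 'cV[R]_p) : 'M[R]_k :=
  \matrix_(r, l) 'D_(delta_mx (j l) 0) (fun y => phi y (i r) 0 : R^o) x.

(* There are charts f : U0 -> f(U0) and g : W -> g(W), with constant c, in
   which phi reads (x_1, ..., x_p) |-> (x_1, ..., x_k, 0, ..., 0), that is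
   x |-> pid_mx k *m x. *)
Definition straightened (R : realType) (N : forall p k, tens R p k -> R)
    (p q : nat) (gamma c : R) (k : nat) (phi : 'cV[R]_p -> 'cV[R]_q)
    (x0 : 'cV[R]_p) (U0 : set 'cV[R]_p) : Prop :=
  exists (f finv : 'cV[R]_p -> 'cV[R]_p) (jf jfinv : jet R p 'cV[R]_p)
         (W : set 'cV[R]_q)
         (g ginv : 'cV[R]_q -> 'cV[R]_q) (jg jginv : jet R q 'cV[R]_q),
    [/\ almost_lip_diffeo N gamma U0 (f @` U0) f finv jf jfinv /\
        Num.max (dlip_norm N gamma U0 jf)
                (dlip_norm N gamma (f @` U0) jfinv) <= c,
        [/\ open W, W (phi x0) & phi @` U0 `<=` W],
        almost_lip_diffeo N gamma W (g @` W) g ginv jg jginv /\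
        Num.max (dlip_norm N gamma W jg)
                (dlip_norm N gamma (g @` W) jginv) <= c &
        forall x, (f @` U0) x ->
          g (phi (finv x)) = (pid_mx k : 'M[R]_(q, p)) *m x].

(* Main.v *)
(* Since the tensor norm of a product of vectors is the product of their norms,
   a Lip-gamma jet amounts to a family of iterated partial derivatives with
   Hoelder control, and on a convex open set the remainder estimates of all
   orders follow from the first-order ones by Taylor's formula along segments.
   The classes of functions so obtained are stable, with uniform constants,
   under sums, products, composition and inversion of matrices, hence under
   local inversion: the gradient of an inverse h of f is (df)^-1 o h.
   Take f(x) = (phi_{i_1}(x), ..., phi_{i_k}(x), remaining coordinates of x).
   It is inverted on a ball by a Newton iteration, and phi o f^-1 depends on the
   first k coordinates only because the rank of d phi is at most k; g subtracts
   this dependence from the last coordinates.  As f^-1 is defined on a ball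
   around f(x_0), convexity is available although f(U_0) need not be convex. *)

Require Import Defs.
From HB Require Import structures.
From mathcomp Require Import all_boot all_order all_algebra all_fingroup.
From mathcomp Require Import all_classical all_reals all_analysis.
From mathcomp Require Import ring lra zify.

Set Implicit Arguments.
Unset Strict Implicit.
Unset Printing Implicit Defensive.

Import Order.TTheory GRing.Theory Num.Theory.
Import numFieldNormedType.Exports.

Local Open Scope classical_set_scope.
Local Open Scope ring_scope.

(** The constants may depend only on [gamma], [M1], [M2] and the dimensions, whereas the order-zero
    remainder of an almost Lipschitz map is controlled by a constant and at a scale of its own. That
    remainder therefore serves only to establish differentiability; the quantitative estimates on
    [phi] come from the bounds on its derivative, through a mean value inequality on balls whose
    conclusion forgets the unknown constants. Elsewhere uniformity comes from the order of
    quantifiers: each closure lemma fixes its constant before the sets and functions. Diameters are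
    kept at most 1, because there t <= t^eps, so that each class contains the next one with a
    controlled constant. The prescribed radius of the full-rank case leaves no room for a crude
    bound on the inverse of the chart matrix. The construction is thus parametrised by such a bound
    [A] and run twice: with [M2 * (1 + M) + 1] for arbitrary rank, and with [M2] itself when
    [k = p]. *)

Lemma coord_le (R : realType) (p : nat) (v : 'cV[R]_p) (i : 'I_p) :
  `|v i 0| <= `|v|.
Proof.
rewrite [leRHS]/Num.norm /= mx_normrE; apply/bigmax_geP; right => /=.
by exists (i, 0).
Qed.

Lemma cV_norm_le (R : realType) (p : nat) (v : 'cV[R]_p) (b : R) :
  0 <= b -> (forall i, `|v i 0| <= b) -> `|v| <= b.
Proof.
move=> b0 vb; rewrite /Num.norm /= mx_normrE; apply/bigmax_leP; split => //=.
by move=> [i j] _ /=; rewrite (ord1 j).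
Qed.

Lemma colB (R : realType) q (u v : 'cV[R]_q) a : (u - v) a 0 = u a 0 - v a 0.
Proof. by rewrite !mxE. Qed.

Lemma ler_norm_sum_const (R : realType) (T : finType) (F : T -> R) (b : R) :
  (forall i, `|F i| <= b) -> `|\sum_i F i| <= #|T|%:R * b.
Proof.
move=> Fb; rewrite (le_trans (ler_norm_sum _ _ _))//.
rewrite (le_trans (ler_sum _ (fun i _ => Fb i)))//.
by rewrite sumr_const mulr_natl.
Qed.

Lemma ler_norm_sum_ord (R : realType) n (F : 'I_n -> R) (b : R) :
  (forall i, `|F i| <= b) -> `|\sum_i F i| <= n%:R * b.
Proof. by move=> /ler_norm_sum_const; rewrite card_ord. Qed.

(** * Functions of class C^{n,eps} with uniform constants *)

Section Modulus.
Variables (R : realType) (eps : R).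
Hypothesis heps : 0 < eps <= 1.

Definition om (t : R) : R := t `^ eps.

Lemma om_ge0 t : 0 <= om t.
Proof. exact: powR_ge0. Qed.

Lemma om_le s t : 0 <= s -> s <= t -> om s <= om t.
Proof.
move=> s0 st; case/andP: heps => e0 _.
by apply: ge0_ler_powR => //; rewrite ?nnegrE ?(ltW e0)// (le_trans s0).
Qed.

Lemma le_om t : 0 <= t -> t <= 1 -> t <= om t.
Proof.
case/andP: heps => e0 e1; rewrite le_eqVlt => /predU1P[<- _|t0 t1].
  exact: om_ge0.
by apply: ger1_powR => //; rewrite t0.
Qed.

Lemma omM a t : 1 <= a -> 0 <= t -> om (a * t) <= a * om t.
Proof.
case/andP: heps => e0 e1 a1 t0; have a0 : 0 <= a by rewrite (le_trans _ a1).
by rewrite /om powRM// ler_wpM2r ?powR_ge0// ler1_powR.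
Qed.

Lemma om_small e : 0 < e -> exists2 d, 0 < d & forall t, 0 <= t -> t < d ->
  om t < e.
Proof.
case/andP: heps => e0 e1 ep; exists (e `^ (eps^-1)); first exact: powR_gt0.
move=> t t0 td; have -> : e = om (e `^ eps^-1).
  by rewrite /om -powRrM mulVf ?gt_eqF// powRr1// ltW.
by apply: gt0_ltr_powR; rewrite ?nnegrE ?powR_ge0.
Qed.

Definition fo_rem (p : nat) (f : 'cV[R]_p -> R) (g : 'I_p -> 'cV[R]_p -> R)
    (x y : 'cV[R]_p) : R :=
  f x - f y - \sum_i g i y * (x - y) i 0.

Definition fo_bound (p : nat) (K : R) (X : set 'cV[R]_p) (f : 'cV[R]_p -> R)
    (g : 'I_p -> 'cV[R]_p -> R) : Prop :=
  forall x y, X x -> X y -> `|fo_rem f g x y| <= K * (`|x - y| * om `|x - y|).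

(* [GC n K X f]: [f] is bounded by [K] and of class [C^{n, eps}] on [X], in
   the sense that iterated gradients exist with first-order remainders
   controlled by [K]; [X] need not be convex. *)
Fixpoint GC (p n : nat) (K : R) (X : set 'cV[R]_p) (f : 'cV[R]_p -> R) : Prop :=
  (forall x, X x -> `|f x| <= K) /\
  match n with
  | 0 => forall x y, X x -> X y -> `|f x - f y| <= K * om `|x - y|
  | n'.+1 => exists2 g : 'I_p -> 'cV[R]_p -> R,
      (forall i, GC n' K X (g i)) & fo_bound K X f g
  end.

(* The components of an almost Lip-(n + 1 + eps) map are of class [DC n]: only
   the gradient is required to be bounded. *)
Definition DC (p n : nat) (K : R) (X : set 'cV[R]_p) (f : 'cV[R]_p ->
  R) : Prop :=
  exists2 g : 'I_p -> 'cV[R]_p -> R,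
    (forall i, GC n K X (g i)) & fo_bound K X f g.

(** Diameter at most 1 gives [t <= om t] for distances, so that Lipschitz bounds and quadratic
    errors are absorbed into Hoelder ones. *)
Definition small (p : nat) (X : set 'cV[R]_p) : Prop :=
  forall x y, X x -> X y -> `|x - y| <= 1.

Lemma GC_bound p n K (X : set 'cV[R]_p) f : GC n K X f ->
  forall x, X x -> `|f x| <= K.
Proof. by case: n => [|n] []. Qed.

Lemma fo_bound_le p K K' (X X' : set 'cV[R]_p) f g :
  K <= K' -> X' `<=` X -> fo_bound K X f g -> fo_bound K' X' f g.
Proof.
move=> KK sX fb x y /sX xX /sX yX; rewrite (le_trans (fb _ _ xX yX))//.
by rewrite ler_wpM2r// mulr_ge0// om_ge0.
Qed.

Lemma GC_le p n K K' (X X' : set 'cV[R]_p) f :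
  K <= K' -> X' `<=` X -> GC n K X f -> GC n K' X' f.
Proof.
move=> KK sX; elim: n f => [|n IH] f /= [fb].
  move=> fh; split=> [x /sX /fb /le_trans|x y /sX xX /sX yX]; first exact.
  by rewrite (le_trans (fh _ _ xX yX))// ler_wpM2r// om_ge0.
case=> g gG gb; split=> [x /sX /fb /le_trans|]; first exact.
exists g => [i|]; [exact: IH (gG i)|exact: fo_bound_le gb].
Qed.

Lemma DC_le p n K K' (X X' : set 'cV[R]_p) f :
  K <= K' -> X' `<=` X -> DC n K X f -> DC n K' X' f.
Proof.
move=> KK sX [g gG gb]; exists g => [i|]; [exact: GC_le (gG i)|].
exact: fo_bound_le gb.
Qed.

Lemma GC_ext p n K (X : set 'cV[R]_p) f f' :
  {in X, f =1 f'} -> GC n K X f -> GC n K X f'.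
Proof.
move=> ff; have ffX x : X x -> f x = f' x by move=> /mem_set /ff.
case: n => [|n] /= [fb].
  by move=> fh; split=> [x xX|x y xX yX]; rewrite -!ffX//;
    [exact: fb|exact: fh].
case=> g gG gb; split=> [x xX|]; first by rewrite -ffX//; exact: fb.
by exists g => // x y xX yX; rewrite /fo_rem -!ffX//; exact: gb.
Qed.

Lemma DC_ext p n K (X : set 'cV[R]_p) f f' :
  {in X, f =1 f'} -> DC n K X f -> DC n K X f'.
Proof.
move=> ff; have ffX x : X x -> f x = f' x by move=> /mem_set /ff.
case=> g gG gb; exists g => // x y xX yX; rewrite /fo_rem -!ffX//; exact: gb.
Qed.

Lemma grad_dot_le p (g : 'I_p -> R) (v : 'cV[R]_p) K :
  (forall i, `|g i| <= K) -> `|\sum_i g i * v i 0| <= p%:R * K * `|v|.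
Proof.
move=> gK; rewrite -[p in p%:R]card_ord -mulrA; apply: ler_norm_sum_const => i.
by rewrite normrM ler_pM// ?coord_le.
Qed.

(** The remainder bound compares any two points of [X] directly, so no path between them is needed
    and [X] may be non-convex. *)
Lemma fo_lip p K (X : set 'cV[R]_p) f g : 0 <= K -> small X ->
  (forall i x, X x -> `|g i x| <= K) -> fo_bound K X f g ->
  forall x y, X x -> X y -> `|f x - f y| <= p.+1%:R * K * `|x - y|.
Proof.
move=> K0 sX gK fb x y xX yX.
have -> : f x - f y = fo_rem f g x y + \sum_i g i y * (x - y) i 0.
  by rewrite /fo_rem subrK.
rewrite (le_trans (ler_normD _ _))//.
have := grad_dot_le (x - y) (fun i => gK i y yX).
have := fb _ _ xX yX.
have : K * (`|x - y| * om `|x - y|) <= K * `|x - y|.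
  rewrite ler_wpM2l// ler_piMr//.
  by rewrite (_ : 1 = om 1) ?om_le ?sX// /om powR1.
rewrite -[p.+1]addn1 natrD; lra.
Qed.

Lemma DC_lip p n K (X : set 'cV[R]_p) f : 0 <= K -> small X -> DC n K X f ->
  forall x y, X x -> X y -> `|f x - f y| <= p.+1%:R * K * `|x - y|.
Proof.
move=> K0 sX [g gG]; apply: fo_lip => // i x.
exact: GC_bound.
Qed.

(** Only the innermost level of the tower of gradients changes: there a first-order remainder is
    weakened to a Lipschitz bound, then to a Hoelder bound since distances are at most 1. *)
Lemma GC_low p n K (X : set 'cV[R]_p) f : 0 <= K -> small X ->
  GC n.+1 K X f -> GC n (p.+1%:R * K) X f.
Proof.
move=> K0 sX; have KK : K <= p.+1%:R * K by rewrite ler_peMl// ler1n.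
elim: n f => [|n IH] f [fb fD].
  split=> [x /fb /le_trans|x y xX yX]; first exact.
  rewrite (le_trans (@DC_lip _ 0%N _ _ _ K0 sX fD _ _ xX yX))//
    ler_wpM2l ?mulr_ge0//.
  by apply: le_om => //; exact: sX.
split=> [x /fb /le_trans|]; first exact.
case: fD => g gG gb; exists g => [i|]; [exact: IH (gG i)|exact: fo_bound_le gb].
Qed.

Lemma DC_low p n K (X : set 'cV[R]_p) f : 0 <= K -> small X ->
  DC n.+1 K X f -> DC n (p.+1%:R * K) X f.
Proof.
move=> K0 sX [g gG gb]; exists g => [i|]; first exact: (GC_low K0 sX (gG i)).
by apply: fo_bound_le gb => //; rewrite ler_peMl// ler1n.
Qed.

Lemma GC_cst p n K (X : set 'cV[R]_p) a : `|a| <= K -> GC n K X (fun=> a).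
Proof.
elim: n a => [|n IH] a aK; have K0 := le_trans (normr_ge0 _) aK.
  by split=> // x y _ _; rewrite subrr normr0 mulr_ge0// om_ge0.
split=> //; exists (fun _ _ => 0) => [i|x y _ _]; first by apply: IH;
  rewrite normr0.
rewrite /fo_rem big1 ?subrr ?subr0 ?normr0 ?mulr_ge0 ?om_ge0// => i _.
by rewrite mul0r.
Qed.

Lemma DC_coord p n K (X : set 'cV[R]_p) (j : 'I_p) a : 1 <= K ->
  DC n K X (fun x => x j 0 + a).
Proof.
move=> K1; have K0 : 0 <= K by rewrite (le_trans _ K1).
exists (fun i _ => (i == j)%:R) => [i|x y _ _].
  by apply: GC_cst; case: (i == j); rewrite ?normr1 ?normr0.
rewrite /fo_rem (bigD1 j)//= big1 ?eqxx => [|i /negPf->]; last by rewrite mul0r.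
rewrite !mxE mul1r addr0 (_ : _ - _ = 0) ?normr0 ?mulr_ge0 ?om_ge0//; lra.
Qed.

Lemma DC_cst p n K (X : set 'cV[R]_p) a : 0 <= K -> DC n K X (fun=> a).
Proof.
move=> K0; exists (fun _ _ => 0) => [i|x y _ _].
  by apply: GC_cst; rewrite normr0.
rewrite /fo_rem big1 ?subrr ?subr0 ?normr0 ?mulr_ge0 ?om_ge0// => i _.
by rewrite mul0r.
Qed.

Lemma fo_bound_sum p (T : finType) K (X : set 'cV[R]_p) f g :
  (forall t : T, fo_bound K X (f t) (g t)) ->
  fo_bound (#|T|%:R * K) X (fun x => \sum_t f t x) (fun i x => \sum_t g t i x).
Proof.
move=> fb x y xX yX.
have -> : fo_rem (fun x => \sum_t f t x) (fun i x => \sum_t g t i x) x y =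
    \sum_t fo_rem (f t) (g t) x y.
  rewrite /fo_rem !sumrB; congr (_ - _ - _).
  rewrite [RHS]exchange_big/=; apply: eq_bigr => i _.
  by rewrite mulr_suml.
by rewrite -mulrA; apply: ler_norm_sum_const => t; exact: fb.
Qed.

Lemma GC_sum p n (T : finType) K (X : set 'cV[R]_p) (f : T -> 'cV[R]_p -> R) :
  (forall t, GC n K X (f t)) -> GC n (#|T|%:R * K) X (fun x => \sum_t f t x).
Proof.
elim: n f => [|n IH] f fG.
  split=> [x xX|x y xX yX]; first by apply: ler_norm_sum_const => t;
    exact: (fG t).1.
  by rewrite -sumrB -mulrA; apply: ler_norm_sum_const => t; exact: (fG t).2.
split=> [x xX|]; first by apply: ler_norm_sum_const => t; exact: (fG t).1.
have [g gP] : {g : T -> 'I_p -> 'cV[R]_p -> R & forall t,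
    (forall i, GC n K X (g t i)) /\ fo_bound K X (f t) (g t)}.
  apply: (@choice _ _ (fun t g => (forall i, GC n K X (g i)) /\
    fo_bound K X (f t) g)) => t.
  by case: (fG t) => _ [g ? ?]; exists g.
exists (fun i x => \sum_t g t i x) => [i|].
  by apply: IH => t; exact: (gP t).1.
by apply: fo_bound_sum => t; exact: (gP t).2.
Qed.

Lemma fo_bound_add p K K' (X : set 'cV[R]_p) f g f' g' :
  fo_bound K X f f' -> fo_bound K' X g g' ->
  fo_bound (K + K') X (fun x => f x + g x) (fun i x => f' i x + g' i x).
Proof.
move=> fD gD x y xX yX.
have -> : fo_rem (fun x => f x + g x) (fun i x => f' i x + g' i x) x y =
    fo_rem f f' x y + fo_rem g g' x y.
  rewrite /fo_rem; under eq_bigr do rewrite mulrDl.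
  by rewrite big_split/=; ring.
by rewrite (le_trans (ler_normD _ _))// mulrDl lerD//; [exact: fD|exact: gD].
Qed.

Lemma fo_bound_opp p K (X : set 'cV[R]_p) f f' : fo_bound K X f f' ->
  fo_bound K X (fun x => - f x) (fun i x => - f' i x).
Proof.
move=> fD x y xX yX.
have -> : fo_rem (fun x => - f x) (fun i x => - f' i x) x y = - fo_rem f f' x y.
  rewrite /fo_rem; under eq_bigr do rewrite mulNr.
  by rewrite sumrN; ring.
by rewrite normrN; exact: fD.
Qed.

Lemma GC_add p n K K' (X : set 'cV[R]_p) f g :
  GC n K X f -> GC n K' X g -> GC n (K + K') X (fun x => f x + g x).
Proof.
elim: n f g => [|n IH] f g [fb fD] [gb gD].
  split=> [x xX|x y xX yX].
    by rewrite (le_trans (ler_normD _ _))// lerD// ?fb ?gb.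
  rewrite opprD addrACA (le_trans (ler_normD _ _))// mulrDl.
  by rewrite lerD// ?fD ?gD.
split=> [x xX|]; first by rewrite (le_trans (ler_normD _ _))// lerD// ?fb ?gb.
case: fD gD => f' fG fD [g' gG gD].
exists (fun i x => f' i x + g' i x) => [i|]; last exact: fo_bound_add.
exact: (IH _ _ (fG i) (gG i)).
Qed.

Lemma DC_add p n K K' (X : set 'cV[R]_p) f g :
  DC n K X f -> DC n K' X g -> DC n (K + K') X (fun x => f x + g x).
Proof.
move=> [f' fG fD] [g' gG gD].
exists (fun i x => f' i x + g' i x) => [i|]; last exact: fo_bound_add.
exact: (GC_add (fG i) (gG i)).
Qed.

Lemma GC_opp p n K (X : set 'cV[R]_p) f :
  GC n K X f -> GC n K X (fun x => - f x).
Proof.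
elim: n f => [|n IH] f [fb fD].
  split=> [x xX|x y xX yX]; first by rewrite normrN fb.
  by rewrite -opprD normrN fD.
split=> [x xX|]; first by rewrite normrN fb.
case: fD => f' fG fD; exists (fun i x => - f' i x) => [i|].
  exact: (IH _ (fG i)).
exact: fo_bound_opp.
Qed.

Lemma DC_opp p n K (X : set 'cV[R]_p) f :
  DC n K X f -> DC n K X (fun x => - f x).
Proof.
case=> f' fG fD; exists (fun i x => - f' i x) => [i|].
  exact: (GC_opp (fG i)).
exact: fo_bound_opp.
Qed.

Lemma GC_mul p n K : 0 <= K -> exists2 K', 0 <= K' &
  forall (X : set 'cV[R]_p) f g, small X ->
  GC n K X f -> GC n K X g -> GC n K' X (fun x => f x * g x).
Proof.
elim: n K => [|n IH] K K0.
  exists (2 * (K * K)); first by rewrite !mulr_ge0.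
  move=> X f g sX [fb fD] [gb gD]; split=> [x xX|x y xX yX].
    rewrite normrM (@le_trans _ _ (K * K)) ?ler_peMl ?mulr_ge0 ?ler1n//.
    by rewrite ler_pM// ?fb ?gb.
  have -> : f x * g x - f y * g y = f x * (g x - g y) + (f x - f y) * g y by
    ring.
  rewrite (le_trans (ler_normD _ _))// !normrM.
  have := ler_pM (normr_ge0 _) (normr_ge0 _) (fb x xX) (gD _ _ xX yX).
  have := ler_pM (normr_ge0 _) (normr_ge0 _) (fD _ _ xX yX) (gb y yX).
  lra.
set L := p.+1%:R * K; have L0 : 0 <= L by rewrite mulr_ge0.
have KL : K <= L by rewrite ler_peMl// ler1n.
have [K1 K10 mulK1] := IH _ L0.
exists (K1 + K1 + (K * K + K * K + L * L)).
  by rewrite !addr_ge0// mulr_ge0.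
move=> X f g sX fG gG; have [[fb fD] [gb gD]] := (fG, gG).
split=> [x xX|].
  rewrite normrM; have := ler_pM (normr_ge0 _) (normr_ge0 _) (fb x xX) (gb x
    xX).
  have := mulr_ge0 K0 K0; have := mulr_ge0 L0 L0; lra.
have lf := DC_lip K0 sX (fG.2 : DC n K X f).
have lg := DC_lip K0 sX (gG.2 : DC n K X g).
case: fD gD => f' f'G fD [g' g'G gD].
exists (fun i x => f' i x * g x + f x * g' i x) => [i|x y xX yX].
  apply: (@GC_le _ _ (K1 + K1) _ X X) => //.
    by rewrite lerDl !addr_ge0// mulr_ge0.
  have lowL h : GC n.+1 K X h -> GC n L X h by move=> ?; exact: GC_low.
  have upL h : GC n K X h -> GC n L X h by exact: GC_le.
  apply: GC_add; apply: mulK1 => //.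
  - exact: upL (f'G i).
  - exact: lowL.
  - exact: lowL.
  - exact: upL (g'G i).
(* Besides the two remainders there is a cross term, quadratic in the distance, hence at most a
   multiple of [|x - y| * om |x - y|] on a small set. *)
have -> : fo_rem (fun x => f x * g x) (fun i x =>
  f' i x * g x + f x * g' i x) x y
   = fo_rem f f' x y * g y + f y * fo_rem g g' x y + (f x - f y) * (g x - g y).
  pose Sf := \sum_i f' i y * (x - y) i 0; pose Sg :=
    \sum_i g' i y * (x - y) i 0.
  rewrite /fo_rem -/Sf -/Sg.
  have -> : \sum_i (f' i y * g y + f y * g' i y) * (x - y) i 0 = Sf * g y + f y
    * Sg.
    rewrite /Sf /Sg mulr_suml mulr_sumr -big_split/=; apply: eq_bigr => i _;
      ring.
  by ring.
have t0 : 0 <= `|x - y| * om `|x - y| by rewrite mulr_ge0// om_ge0.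
rewrite (le_trans (ler_normD _ _))//
  (le_trans (lerD (ler_normD _ _) (lexx _)))//.
rewrite !normrM.
have := ler_pM (normr_ge0 _) (normr_ge0 _) (fD _ _ xX yX) (gb y yX).
have := ler_pM (normr_ge0 _) (normr_ge0 _) (fb y yX) (gD _ _ xX yX).
have := ler_pM (normr_ge0 _) (normr_ge0 _) (lf _ _ xX yX) (lg _ _ xX yX).
rewrite -/L.
have : L * `|x - y| * (L * `|x - y|) <= L * L * (`|x - y| * om `|x - y|).
  rewrite mulrACA ler_wpM2l ?mulr_ge0// ler_wpM2l// le_om//; exact: sX.
have : 0 <= (K1 + K1) * (`|x - y| * om `|x - y|) by rewrite mulr_ge0// addr_ge0.
by rewrite !mulrDl; lra.
Qed.

Lemma GC_sum_mul p n (T : finType) K : 0 <= K -> exists2 K', 0 <= K' &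
  forall (X : set 'cV[R]_p) (f g : T -> 'cV[R]_p -> R), small X ->
  (forall t, GC n K X (f t)) -> (forall t, GC n K X (g t)) ->
  GC n K' X (fun x => \sum_t f t x * g t x).
Proof.
move=> K0; have [K1 K10 h] := GC_mul p n K0.
exists (#|T|%:R * K1); first by rewrite mulr_ge0.
by move=> X f g sX fG gG; apply: GC_sum => t; exact: h.
Qed.

End Modulus.

(** * Composition, inversion of matrices and inverse maps *)

Section Closure.
Variables (R : realType) (eps : R).
Hypothesis heps : 0 < eps <= 1.
Local Notation om := (om eps).
Local Notation GC := (GC eps).
Local Notation DC := (DC eps).

Lemma DC_lip_map p q n K (X : set 'cV[R]_p) (h : 'cV[R]_p -> 'cV[R]_q) :
  0 <= K -> small X -> (forall j, DC n K X (fun x => h x j 0)) ->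
  forall x y, X x -> X y -> `|h x - h y| <= p.+1%:R * K * `|x - y|.
Proof.
move=> K0 sX hD x y xX yX; apply: cV_norm_le => [|j];
  first by rewrite !mulr_ge0.
rewrite !mxE; exact: (DC_lip heps K0 sX (hD j)).
Qed.

(** Chain rule, with stability of class [n] under composition with [h] taken as a hypothesis: this
    one step then serves both the induction of [GC_comp] and the conclusion [DC_comp]. *)
Lemma DC_comp_step p q n K K1 : 0 <= K -> 0 <= K1 -> exists2 K', 0 <= K' &
  forall (X : set 'cV[R]_p) (Y : set 'cV[R]_q) f (h : 'cV[R]_p -> 'cV[R]_q),
  small X -> (forall x, X x -> Y (h x)) -> DC n K Y f ->
  (forall j, DC n K X (fun x => h x j 0)) ->
  (forall f0, GC n K Y f0 -> GC n K1 X (f0 \o h)) ->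
  DC n K' X (f \o h).
Proof.
move=> K0 K10; set K2 := K + K1; have K20 : 0 <= K2 by rewrite addr_ge0.
have [K3 K30 sumK] := GC_sum_mul heps p n 'I_q K20.
pose L := 1 + p.+1%:R * K; have L0 : 0 <= L by rewrite addr_ge0// mulr_ge0.
have L1 : 1 <= L by rewrite lerDl mulr_ge0.
pose K4 := K * (L * L) + q%:R * K * K.
have K40 : 0 <= K4 by rewrite addr_ge0 ?mulr_ge0.
exists (K3 + K4); first by rewrite addr_ge0.
move=> X Y f h sX XY [f' f'G fD] hD fcomp.
have hl x y : X x -> X y -> `|h x - h y| <= L * `|x - y|.
  move=> xX yX; rewrite (le_trans (DC_lip_map K0 sX hD xX yX))// ler_wpM2r//.
  by rewrite lerDr.
have [h' h'P] : {h' : 'I_q -> 'I_p -> 'cV[R]_p -> R & forall j,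
    (forall i, GC n K X (h' j i)) /\ fo_bound eps K X (fun x =>
      h x j 0) (h' j)}.
  apply: (@choice _ _ (fun j g => (forall i, GC n K X (g i)) /\
    fo_bound eps K X (fun x => h x j 0) g)) => j.
  by case: (hD j) => g ? ?; exists g.
exists (fun i x => \sum_j (f' j \o h) x * h' j i x) => [i|x y xX yX].
  apply: (@GC_le _ _ _ _ K3 _ X X) => //; first by rewrite lerDl.
  apply: sumK => // j.
    by apply: (@GC_le _ _ _ _ K1 _ X X) => //; [rewrite lerDr|exact: fcomp].
  by apply: (@GC_le _ _ _ _ K _ X X) => //; [rewrite lerDl|exact: (h'P j).1].
(* The remainder of [f] between [h y] and [h x], plus the gradient of [f] applied to the remainders
   of the components of [h]. *)
have -> : fo_rem (f \o h) (fun i x => \sum_j (f' j \o h) x * h' j i x) x y =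
    fo_rem f f' (h x) (h y)
    + \sum_j f' j (h y) * fo_rem (fun x => h x j 0) (h' j) x y.
  have -> : \sum_j f' j (h y) * fo_rem (fun x => h x j 0) (h' j) x y =
      \sum_j f' j (h y) * (h x - h y) j 0 -
      \sum_i \sum_j f' j (h y) * h' j i y * (x - y) i 0.
    rewrite exchange_big -sumrB; apply: eq_bigr => j _.
    rewrite /fo_rem mulrBr mulr_sumr !mxE; congr (_ - _).
    by apply: eq_bigr => i _; rewrite mulrA.
  rewrite /fo_rem/= addrA subrK; congr (_ - _).
  by apply: eq_bigr => i _; rewrite mulr_suml.
have om0 t : 0 <= om t by exact: om_ge0.
rewrite (le_trans (ler_normD _ _))// mulrDl ler_wpDl//.
  by rewrite !mulr_ge0.
rewrite mulrDl lerD//.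
  rewrite (le_trans (fD _ _ (XY _ xX) (XY _ yX)))// -mulrA ler_wpM2l//.
  rewrite mulrACA ler_pM ?hl// (le_trans _ (omM heps _ _))//.
  by apply: om_le => //; exact: hl.
rewrite -!mulrA -[q in q%:R]card_ord; apply: ler_norm_sum_const => j.
rewrite normrM ler_pM//; last exact: ((h'P j).2 _ _ xX yX).
exact: (GC_bound (f'G j) (XY _ yX)).
Qed.

Lemma GC_comp p q n K : 0 <= K -> exists2 K', 0 <= K' &
  forall (X : set 'cV[R]_p) (Y : set 'cV[R]_q) f (h : 'cV[R]_p -> 'cV[R]_q),
  small X -> (forall x, X x -> Y (h x)) -> GC n K Y f ->
  (forall j, DC n K X (fun x => h x j 0)) -> GC n K' X (f \o h).
Proof.
elim: n K => [|n IH] K K0.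
  pose L := 1 + p.+1%:R * K; have L0 : 0 <= L by rewrite addr_ge0// mulr_ge0.
  have L1 : 1 <= L by rewrite lerDl mulr_ge0.
  exists (K * L) => [|X Y f h sX XY [fb fD] hD]; first by rewrite mulr_ge0.
  split=> [x xX|x y xX yX]; first by rewrite (le_trans (fb _ (XY _ xX)))//
    ler_peMr.
  rewrite (le_trans (fD _ _ (XY _ xX) (XY _ yX)))// -mulrA ler_wpM2l//.
  rewrite (le_trans _ (omM heps _ _))//; apply: om_le => //.
  rewrite (le_trans (DC_lip_map K0 sX hD xX yX))// ler_wpM2r//.
  by rewrite lerDr.
pose L := p.+1%:R * K + K; have L0 : 0 <= L by rewrite addr_ge0// mulr_ge0.
have [K1 K10 compK] := IH L L0.
have [K2 K20 stepK] := DC_comp_step p q n L0 K10.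
exists (K + K2) => [|X Y f h sX XY [fb fD] hD]; first by rewrite addr_ge0.
have KL : K <= L by rewrite lerDr mulr_ge0.
have hL j : DC n L X (fun x => h x j 0).
  apply: (@DC_le _ _ _ _ (p.+1%:R * K) _ X X) => //; first by rewrite lerDl.
  by apply: DC_low.
split=> [x xX|]; first by rewrite (le_trans (fb _ (XY _ xX)))// lerDl.
apply: (@DC_le _ _ _ _ K2 _ X X) => //; first by rewrite lerDr.
apply: (stepK X Y) => //; first exact: DC_le fD.
by move=> f0 f0G; apply: (compK X Y).
Qed.

Lemma DC_comp p q n K : 0 <= K -> exists2 K', 0 <= K' &
  forall (X : set 'cV[R]_p) (Y : set 'cV[R]_q) f (h : 'cV[R]_p -> 'cV[R]_q),
  small X -> (forall x, X x -> Y (h x)) -> DC n K Y f ->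
  (forall j, DC n K X (fun x => h x j 0)) -> DC n K' X (f \o h).
Proof.
move=> K0; have [K1 K10 compK] := GC_comp p q n K0.
have [K2 K20 stepK] := DC_comp_step p q n K0 K10.
exists K2 => // X Y f h sX XY fD hD; apply: (stepK X Y) => // f0 f0G.
exact: (compK X Y).
Qed.

(* Injectivity of the matrix with a quantitative bound is how a bound on the
   operator norm of the inverse is expressed. *)
Definition inj_bound p (A : R) (E : 'M[R]_p) : Prop :=
  forall z : 'cV[R]_p, `|z| <= A * `|E *m z|.

Lemma inj_bound_unit p A (E : 'M[R]_p) : inj_bound A E -> E \in unitmx.
Proof.
move=> EA; rewrite -unitmx_tr -row_free_unit; apply/inj_row_free => v vE.
have := EA v^T; rewrite -[E]trmxK -trmx_mul vE trmx0 normr0 mulr0.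
by rewrite normr_le0 => /eqP /(congr1 trmx); rewrite trmxK trmx0.
Qed.

Lemma inj_bound_inv p A (E : 'M[R]_p) : inj_bound A E ->
  forall w : 'cV[R]_p, `|invmx E *m w| <= A * `|w|.
Proof.
by move=> EA w; rewrite (le_trans (EA _))// mulKVmx ?(inj_bound_unit EA).
Qed.

Lemma norm_delta p (i : 'I_p) : `|delta_mx i 0 : 'cV[R]_p| = 1.
Proof.
apply/eqP; rewrite eq_le; apply/andP; split.
  apply: cV_norm_le => // j; rewrite mxE; case: (_ && _);
    first by rewrite normr1.
  by rewrite normr0.
have := coord_le (delta_mx i 0 : 'cV[R]_p) i; by rewrite mxE !eqxx normr1.
Qed.

Lemma inv_entry_le p A (E : 'M[R]_p) a b : inj_bound A E ->
  `|invmx E a b| <= A.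
Proof.
move=> EA; have := inj_bound_inv EA (delta_mx b 0).
rewrite norm_delta mulr1; apply: le_trans.
by rewrite -colE (le_trans _ (coord_le _ a))// mxE.
Qed.

Lemma mx_sandwich p (G D H : 'M[R]_p) a b :
  (G *m D *m H) a b = \sum_(ij : 'I_p * 'I_p) G a ij.1 * D ij.1 ij.2 * H ij.2 b.
Proof.
rewrite mxE -(pair_bigA _ (fun i j => G a i * D i j * H j b))/= exchange_big/=.
by apply: eq_bigr => j _; rewrite mxE mulr_suml.
Qed.

Lemma sandwich_le p (G D H : 'M[R]_p) a b A d :
  (forall i, `|G a i| <= A) -> (forall j, `|H j b| <= A) ->
  (forall i j, `|D i j| <= d) ->
  `|(G *m D *m H) a b| <= #|{: 'I_p * 'I_p}|%:R * (A * d * A).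
Proof.
move=> GA HA Dd; rewrite mx_sandwich; apply: ler_norm_sum_const => -[i j] /=.
by rewrite !normrM ler_pM// ?mulr_ge0// ler_pM.
Qed.

Lemma invmxB p (E E' : 'M[R]_p) : E \in unitmx -> E' \in unitmx ->
  invmx E - invmx E' = - (invmx E *m (E - E') *m invmx E').
Proof.
move=> uE uE'; rewrite mulmxBr mulmxBl mulVmx// mul1mx -mulmxA mulmxV// mulmx1.
by rewrite opprB.
Qed.

(** The derivative of the inverse is minus the inverse times the derivative of [E] times the
    inverse. Its factors are of class [n], those with an inverse by the induction hypothesis applied
    to [E] lowered by one degree. *)
Lemma GC_invmx p q n K A : 0 <= K -> 0 <= A -> exists2 K', 0 <= K' &
  forall (X : set 'cV[R]_p) (E : 'cV[R]_p -> 'M[R]_q), small X ->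
  (forall a b, GC n K X (fun x => E x a b)) ->
  (forall x, X x -> inj_bound A (E x)) ->
  forall a b, GC n K' X (fun x => invmx (E x) a b).
Proof.
move=> K0 A0; pose d : R := #|{: 'I_q * 'I_q}|%:R; have d0 : 0 <= d by [].
elim: n K K0 => [|n IH] K K0.
  exists (A + d * (A * K * A)); first by rewrite addr_ge0 ?mulr_ge0.
  move=> X E sX EG EA a b; split=> [x xX|x y xX yX].
    rewrite (le_trans (inv_entry_le a b (EA x xX)))// lerDl ?mulr_ge0//.
  have -> : invmx (E x) a b - invmx (E y) a b =
      - (invmx (E x) *m (E x - E y) *m invmx (E y)) a b.
    by move/matrixP: (invmxB (inj_bound_unit (EA x xX)) (inj_bound_unit (EA y
      yX)))
      => /(_ a b); rewrite 3!mxE.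
  rewrite normrN; have om0 : 0 <= om `|x - y| by exact: om_ge0.
  rewrite (le_trans (@sandwich_le _ _ _ _ a b A (K * om `|x - y|) _ _ _))//.
  - by move=> i; apply: inv_entry_le; exact: EA.
  - by move=> i; apply: inv_entry_le; exact: EA.
  - by move=> i j; rewrite !mxE; exact: (EG i j).2.
  - have : 0 <= A * om `|x - y| by rewrite mulr_ge0.
    rewrite -/d; lra.
pose L := p.+1%:R * K; have L0 : 0 <= L by rewrite mulr_ge0.
have KL : K <= L by rewrite ler_peMl// ler1n.
have [K1 K10 invK] := IH L L0.
have [K2 K20 mulK] := GC_mul heps p n (addr_ge0 K10 L0).
have [K3 K30 sumK] := GC_sum_mul heps p n {: 'I_q * 'I_q} (addr_ge0 K20 K10).
(* The two summands bound the two parts of the remainder computed below: the error of linearising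
   [E], and the term quadratic in the increment of [E]. The number [d] counts the terms of an entry
   of a triple product. *)
pose K4 := d * (A * K * A) + d * (d * (A * L * A) * L * A).
have K40 : 0 <= K4 by rewrite addr_ge0 ?mulr_ge0.
exists (A + K3 + K4); first by rewrite addr_ge0// addr_ge0.
move=> X E sX EG EA a b; split=> [x xX|].
  rewrite (le_trans (inv_entry_le a b (EA x xX)))//.
  by rewrite -addrA lerDl addr_ge0.
have EL i j : GC n L X (fun x => E x i j) by apply: GC_low.
have iG i j : GC n K1 X (fun x => invmx (E x) i j) by apply: invK.
have lE i j x y : X x -> X y -> `|E x i j - E y i j| <= L * `|x - y|.
  exact: (DC_lip heps K0 sX (EG i j).2).
have [E' E'P] : {E' : 'I_q * 'I_q -> 'I_p -> 'cV[R]_p -> R & forall ij,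
    (forall i, GC n K X (E' ij i)) /\
    fo_bound eps K X (fun x => E x ij.1 ij.2) (E' ij)}.
  apply: (@choice _ _ (fun ij g => (forall i, GC n K X (g i)) /\
    fo_bound eps K X (fun x => E x ij.1 ij.2) g)) => -[i j] /=.
  by case: (EG i j) => _ [g ? ?]; exists g.
exists (fun l x => - \sum_ij (invmx (E x) a ij.1 * E' ij l x) * invmx (E x)
  ij.2 b).
  move=> l; apply: (@GC_le _ _ _ _ K3 _ X X) => //; first by lra.
  apply: GC_opp; apply: (sumK X) => // -[i j] /=.
    apply: (@GC_le _ _ _ _ K2 _ X X) => //; first by rewrite lerDl.
    apply: mulK => //; first by apply: GC_le (iG a i) => //; rewrite lerDl.
    by apply: GC_le ((E'P _).1 l) => //; lra.
  by apply: GC_le (iG j b) => //; rewrite lerDr.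
move=> x y xX yX; set t := `|x - y|.
have om0 : 0 <= om t by exact: om_ge0.
have t0 : 0 <= t by exact: normr_ge0.
pose DE l : 'M[R]_q := \matrix_(i, j) E' (i, j) l y.
pose Rm := \matrix_(i, j) fo_rem (fun x => E x i j) (E' (i, j)) x y.
have RmE : E x - E y = Rm + \sum_l (x - y) l 0 *: DE l.
  apply/matrixP => i j; rewrite [RHS]mxE summxE.
  have -> : \sum_l ((x - y) l 0 *: DE l) i j = \sum_l E' (i,
    j) l y * (x - y) l 0.
    by apply: eq_bigr => l _; rewrite !mxE mulrC.
  by rewrite !mxE /fo_rem subrK.
set G := invmx (E x); set H := invmx (E y).
have GH : G - H = - (G *m (E x - E y) *m H).
  by apply: invmxB; apply: inj_bound_unit; exact: EA.
(* In [G - H = - G (E x - E y) H], replacing [G] by [H] costs a term with two increments, and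
   replacing [E x - E y] by its linear part costs [Rm]. *)
have -> : fo_rem (fun x => invmx (E x) a b) (fun l x => - \sum_ij
     (invmx (E x) a ij.1 * E' ij l x) * invmx (E x) ij.2 b) x y =
   - (H *m Rm *m H) a b + (- (G - H) *m (E x - E y) *m H) a b.
  rewrite /fo_rem -/G -/H.
  have -> : \sum_l (- \sum_ij H a ij.1 * E' ij l y * H ij.2 b) * (x - y) l 0 =
      - (H *m (\sum_l (x - y) l 0 *: DE l) *m H) a b.
    rewrite mulmx_sumr mulmx_suml summxE -sumrN; apply: eq_bigr => l _.
    have sclE c (M : 'M[R]_q) : (c *: M) a b = c * M a b by rewrite mxE.
    rewrite mulNr -scalemxAr -scalemxAl sclE mulrC mx_sandwich.
    by congr (- (_ * _)); apply: eq_bigr => -[i j] _; rewrite [DE l _ _]mxE.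
  have addE (M N : 'M[R]_q) : (M + N) a b = M a b + N a b by rewrite mxE.
  have oppE (M : 'M[R]_q) : (- M) a b = - M a b by rewrite mxE.
  set S := \sum_l _ in RmE *; rewrite opprK.
  have mat : G - H + H *m S *m H =
      - (H *m Rm *m H) + (- (G - H)) *m (E x - E y) *m H.
    have HDH : H *m (E x - E y) *m H = H *m Rm *m H + H *m S *m H.
      by rewrite RmE mulmxDr mulmxDl.
    rewrite [in LHS]GH 2!mulNmx 2!mulmxBl HDH opprB -addrA addKr addrC.
    by [].
  by have := congr1 (fun M : 'M[R]_q => M a b) mat; rewrite /= !addE !oppE.
rewrite (le_trans (ler_normD _ _))// normrN.
have b1 : `|(H *m Rm *m H) a b| <= d * (A * (K * (t * om t)) * A).
  apply: sandwich_le => [i|i|i j].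
  - by apply: inv_entry_le; exact: EA.
  - by apply: inv_entry_le; exact: EA.
  - by rewrite mxE; exact: ((E'P (i, j)).2 _ _ xX yX).
have b2 : `|(- (G - H) *m (E x - E y) *m H) a b| <=
    d * (d * (A * (L * t) * A) * (L * t) * A).
  rewrite mx_sandwich; apply: ler_norm_sum_const => -[i j] /=.
  rewrite !normrM; apply: ler_pM => //.
    apply: ler_pM => //; last by rewrite !mxE; exact: lE.
    rewrite GH opprK; apply: sandwich_le => [k|k|k l].
    - by apply: inv_entry_le; exact: EA.
    - by apply: inv_entry_le; exact: EA.
    - by rewrite !mxE; exact: lE.
  by apply: inv_entry_le; exact: EA.
have tom : t <= om t by apply: le_om => //; exact: sX.
have b3 : d * (d * (A * (L * t) * A) * (L * t) * A) <=
   d * (d * (A * L * A) * L * A) * (t * om t).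
  have -> : d * (d * (A * (L * t) * A) * (L * t) * A) =
    d * (d * (A * L * A) * L * A) * (t * t) by ring.
  by rewrite ler_wpM2l ?mulr_ge0// ler_wpM2l.
have b4 : d * (A * (K * (t * om t)) * A) = d * (A * K * A) * (t * om t) by ring.
have : 0 <= (A + K3) * (t * om t) by rewrite mulr_ge0 ?addr_ge0// mulr_ge0.
rewrite [in X in _ -> X]mulrDl [in X in _ -> X]/K4 [(_ + _) * _ in X in _ ->
  _ <= _ + X]mulrDl.
lra.
Qed.

(* Bootstrapping: the gradient of [h] is [E (h u)^-1], so a degree of
   regularity of [h] yields the next one. *)
Lemma DC_inverse p n K A : 0 <= K -> 0 <= A -> exists2 K', 0 <= K' &
  forall (B V : set 'cV[R]_p) (f h : 'cV[R]_p -> 'cV[R]_p)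
    (E : 'cV[R]_p -> 'M[R]_p), small B -> small V ->
  (forall u, V u -> B (h u) /\ f (h u) = u) ->
  (forall i j, GC n K B (fun x => E x i j)) ->
  (forall x y, B x -> B y ->
     `|f x - f y - E y *m (x - y)| <= K * (`|x - y| * om `|x - y|)) ->
  (forall x, B x -> inj_bound A (E x)) ->
  (forall u v, V u -> V v -> `|h u - h v| <= A * `|u - v|) ->
  forall j, DC n K' V (fun u => h u j 0).
Proof.
(* [A1] replaces [A] as a Lipschitz constant of [h] because [omM] requires a factor at least 1. *)
move=> K0 A0; pose A1 := 1 + A.
have A11 : 1 <= A1 by rewrite lerDl.
have A10 : 0 <= A1 by rewrite addr_ge0.
pose Kr K := A * (K * (A1 * A1)).
have Kr0 K' : 0 <= K' -> 0 <= Kr K' by move=> ?; rewrite !mulr_ge0.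
have hl1 (V : set 'cV[R]_p) (h : 'cV[R]_p -> 'cV[R]_p) :
    (forall u v, V u -> V v -> `|h u - h v| <= A * `|u - v|) ->
    forall u v, V u -> V v -> `|h u - h v| <= A1 * `|u - v|.
  by move=> hl u v uV vV; rewrite (le_trans (hl _ _ uV vV))// ler_wpM2r// lerDr.
have hom (V : set 'cV[R]_p) (h : 'cV[R]_p -> 'cV[R]_p) :
    (forall u v, V u -> V v -> `|h u - h v| <= A * `|u - v|) ->
    forall u v, V u -> V v -> om `|h u - h v| <= A1 * om `|u - v|.
  move=> hl u v uV vV; rewrite (le_trans _ (omM heps _ _))//.
  by apply: om_le => //; exact: (hl1 V).
(* This estimate does not depend on the degree: since [f (h u) - f (h v) = u - v], the remainder of
   [h] is minus the inverse matrix applied to the remainder of [f]. *)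
have remE K' (B V : set 'cV[R]_p) (f h : 'cV[R]_p -> 'cV[R]_p)
    (E : 'cV[R]_p -> 'M[R]_p) : 0 <= K' ->
  (forall u, V u -> B (h u) /\ f (h u) = u) ->
  (forall x y, B x -> B y ->
     `|f x - f y - E y *m (x - y)| <= K' * (`|x - y| * om `|x - y|)) ->
  (forall x, B x -> inj_bound A (E x)) ->
  (forall u v, V u -> V v -> `|h u - h v| <= A * `|u - v|) ->
  forall j, fo_bound eps (Kr K') V (fun u => h u j 0)
    (fun i u => invmx (E (h u)) j i).
  move=> K'0 VB fE EA hl j u v uV vV.
  have [huB fhu] := VB u uV; have [hvB fhv] := VB v vV.
  set w := f (h u) - f (h v) - E (h v) *m (h u - h v).
  have -> : fo_rem (fun u => h u j 0) (fun i u => invmx (E (h u)) j i) u v =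
      (- (invmx (E (h v)) *m w)) j 0.
    rewrite /w fhu fhv mulmxBr mulKmx ?(inj_bound_unit (EA _ hvB))// opprB.
    by rewrite /fo_rem !mxE; congr (_ - _); apply: eq_bigr => i _; rewrite !mxE.
  rewrite (le_trans (coord_le _ _))// normrN.
  rewrite (le_trans (inj_bound_inv (EA _ hvB) _))// -mulrA ler_wpM2l//.
  apply: (le_trans (fE _ _ huB hvB)); rewrite -mulrA; apply: ler_wpM2l => //.
  by rewrite mulrACA ler_pM ?om_ge0//; [exact: (hl1 V)|exact: (hom V)].
elim: n K K0 => [|n IH] K K0.
  have [K1 K10 invK] := GC_invmx p p 0 (mulr_ge0 K0 A10) A0.
  exists (K1 + Kr K); first by rewrite addr_ge0 ?Kr0.
  move=> B V f h E sB sV VB EG fE EA hl j.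
  exists (fun i u => invmx (E (h u)) j i); last first.
    by apply: fo_bound_le (remE K B V f h E K0 VB fE EA hl j) => //;
      rewrite lerDr.
  move=> i; apply: (@GC_le _ _ _ _ K1 _ V V) => //; first by rewrite lerDl Kr0.
  apply: (invK V (E \o h)) => //= [a b|u uV]; last by apply: EA;
    exact: (VB u uV).1.
  split=> [u uV|u v uV vV].
    by rewrite (le_trans ((EG a b).1 _ (VB u uV).1))// ler_peMr.
  apply: (le_trans ((EG a b).2 _ _ (VB u uV).1 (VB v vV).1)); rewrite -mulrA.
  by apply: ler_wpM2l => //; exact: (hom V).
pose L := p.+1%:R * K; have L0 : 0 <= L by rewrite mulr_ge0.
have KL : K <= L by rewrite ler_peMl// ler1n.
have [K1 K10 dK] := IH L L0.
have [K2 K20 compK] := DC_comp p p n (addr_ge0 L0 K10).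
have [K3 K30 invK] := GC_invmx p p n.+1 (addr_ge0 K0 K20) A0.
exists (K3 + Kr K); first by rewrite addr_ge0 ?Kr0.
move=> B V f h E sB sV VB EG fE EA hl j.
(* With [E] lowered by one degree the induction hypothesis makes [h] of class [DC n]; then the
   entries of [E \o h], and those of its inverse, are of class [GC n.+1]. *)
have hD i : DC n K1 V (fun u => h u i 0).
  apply: (dK B V f h E) => // [a b|x y xB yB]; first by apply: GC_low.
  by rewrite (le_trans (fE _ _ xB yB))// ler_wpM2r// mulr_ge0 ?om_ge0.
exists (fun i u => invmx (E (h u)) j i); last first.
  by apply: fo_bound_le (remE K B V f h E K0 VB fE EA hl j) => //;
    rewrite lerDr.
move=> i; apply: (@GC_le _ _ _ _ K3 _ V V) => //; first by rewrite lerDl Kr0.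
apply: (invK V (E \o h)) => //= [a b|u uV]; last by apply: EA;
  exact: (VB u uV).1.
split=> [u uV|].
  by rewrite (le_trans ((EG a b).1 _ (VB u uV).1))// lerDl.
apply: (@DC_le _ _ _ _ K2 _ V V) => //; first by rewrite lerDr.
apply: (compK V B (fun x => E x a b)) => // [u uV||k].
- exact: (VB u uV).1.
- apply: (@DC_le _ _ _ _ K _ B B) => //; first by rewrite (le_trans KL)// lerDl.
  exact: (EG a b).2.
- by apply: (@DC_le _ _ _ _ K1 _ V V) => //; rewrite lerDr.
Qed.

End Closure.

(** * Taylor expansion and symmetry of iterated partial derivatives *)

Section Taylor.
Variables (R : realType) (eps : R).
Hypothesis heps : 0 < eps <= 1.
Local Notation om := (om eps).
Local Notation GC := (GC eps).
Local Notation DC := (DC eps).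

Lemma le0_of_le_om (a C d : R) : 0 < d -> 0 <= C ->
  (forall s, 0 < s -> s < d -> a <= C * om s) -> a <= 0.
Proof.
move=> d0 C0 aC; rewrite leNgt; apply/negP => a0.
have C1 : 0 < C + 1 by rewrite ltr_wpDl.
have [d1 d10 oms] := om_small heps (divr_gt0 a0 C1).
pose s := Num.min d d1 / 2.
have m0 : 0 < Num.min d d1 by rewrite lt_min d0.
have s0 : 0 < s by rewrite divr_gt0.
have sm : s < Num.min d d1 by rewrite /s; lra.
move: sm; rewrite lt_min => /andP[sd sd1].
have := aC s s0 sd; have := oms s (ltW s0) sd1; rewrite ltr_pdivlMr// => h1 h2.
have := om_ge0 eps s; lra.
Qed.

(** Differentiability on [[0, 1]] with a uniform modulus, so that a subdivision argument suffices
    for the mean value inequality. The scale [dl] accommodates remainders known only between nearby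
    points. *)
Definition der1 (r d : R -> R) : Prop := exists C dl : R, [/\ 0 <= C, 0 < dl &
  forall s t, 0 <= s <= 1 -> 0 <= t <= 1 -> `|t - s| < dl ->
  `|r t - r s - d s * (t - s)| <= C * (`|t - s| * om `|t - s|)].

(** Cut [[0, 1]] into [N] equal steps. Each contributes at most [B / N] plus a remainder at most
    [e / N] once the steps are short enough. The constants hidden in [der1] only affect [N], hence
    disappear from the conclusion. *)
Lemma mean_ineq (r d : R -> R) (B : R) : der1 r d ->
  (forall t, 0 <= t <= 1 -> `|d t| <= B) -> `|r 1 - r 0| <= B.
Proof.
move=> [C [dl [C0 dl0 rd]]] dB; apply/ler_addgt0Pr => e e0.
have C1 : 0 < C + 1 by rewrite ltr_wpDl.
have [d1 d10 oms] := om_small heps (divr_gt0 e0 C1).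
have m0 : 0 < Num.min dl d1 by rewrite lt_min dl0.
pose N := Num.bound ((Num.min dl d1)^-1).
have NM : (Num.min dl d1)^-1 < N%:R.
  by apply: archi_boundP; rewrite invr_ge0 ltW.
have N0 : 0 < N%:R :> R by rewrite (lt_trans _ NM)// invr_gt0.
have N1m : N%:R^-1 < Num.min dl d1.
  by rewrite -[ltRHS]invrK ltf_pV2// posrE invr_gt0.
move: N1m; rewrite lt_min => /andP[Ndl Nd1].
have Ninv0 : 0 <= N%:R^-1 :> R by rewrite invr_ge0 ltW.
pose tau (i : nat) : R := i%:R / N%:R.
have tau1 : tau N = 1 by rewrite /tau divff// gt_eqF.
have tau0 : tau 0%N = 0 by rewrite /tau mul0r.
have tauI i : (i <= N)%N -> 0 <= tau i <= 1.
  by move=> iN; rewrite mulr_ge0//= ler_pdivrMr// mul1r ler_nat.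
have tauS i : tau i.+1 - tau i = N%:R^-1.
  by rewrite /tau -mulrBl -natrB// subSnn mul1r.
rewrite -tau1 -tau0 -(telescope_sumr (fun i => r (tau i)))//.
rewrite big_mkord.
have -> : B + e = #|'I_N|%:R * ((B + e) / N%:R).
  by rewrite card_ord mulrC divfK// gt_eqF.
apply: ler_norm_sum_const => -[i iN] /=.
have iI := tauI i (ltnW iN); have SI := tauI _ iN.
have := rd _ _ iI SI; rewrite tauS ger0_norm// => /(_ Ndl) h.
have := dB _ iI => h2.
have h3 : `|d (tau i) * N%:R^-1| <= B * N%:R^-1.
  by rewrite normrM [X in _ * X]ger0_norm// ler_wpM2r.
have h4 : C * (N%:R^-1 * om N%:R^-1) <= e / N%:R.
  rewrite mulrCA mulrC ler_wpM2r//.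
  have := oms _ Ninv0 Nd1; rewrite ltr_pdivlMr// => h4.
  have := om_ge0 eps (N%:R^-1); lra.
have -> : r (tau i.+1) - r (tau i) =
    r (tau i.+1) - r (tau i) - d (tau i) * N%:R^-1 + d (tau i) * N%:R^-1.
  by rewrite subrK.
rewrite (le_trans (ler_normD _ _))// mulrDl addrC lerD//.
exact: le_trans h h4.
Qed.

Lemma der1D r d r' d' : der1 r d -> der1 r' d' ->
  der1 (fun t => r t + r' t) (fun t => d t + d' t).
Proof.
move=> [C [dl [C0 dl0 rd]]] [C' [dl' [C'0 dl'0 rd']]].
exists (C + C'), (Num.min dl dl'); split; rewrite ?addr_ge0 ?lt_min ?dl0//.
move=> s t sI tI; rewrite lt_min => /andP[h h'].
have -> : r t + r' t - (r s + r' s) - (d s + d' s) * (t - s) =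
  (r t - r s - d s * (t - s)) + (r' t - r' s - d' s * (t - s)) by ring.
by rewrite (le_trans (ler_normD _ _))// mulrDl lerD// ?rd ?rd'.
Qed.

Lemma der1Z a r d : der1 r d -> der1 (fun t => a * r t) (fun t => a * d t).
Proof.
move=> [C [dl [C0 dl0 rd]]]; exists (`|a| * C), dl; split; rewrite ?mulr_ge0//.
move=> s t sI tI h.
have -> : a * r t - a * r s - a * d s * (t - s) =
  a * (r t - r s - d s * (t - s)) by ring.
by rewrite normrM -mulrA ler_wpM2l// rd.
Qed.

Lemma der1_cst a : der1 (fun=> a) (fun=> 0).
Proof.
exists 0, 1; split=> // s t _ _ _.
by rewrite subrr mul0r subr0 normr0 mul0r.
Qed.

Lemma der1_sum (n : nat) (r d : 'I_n -> R -> R) : (forall i,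
  der1 (r i) (d i)) ->
  der1 (fun t => \sum_i r i t) (fun t => \sum_i d i t).
Proof.
elim: n r d => [|n IH] r d rd.
  have -> : (fun t => \sum_(i < 0) r i t) = (fun=> 0).
    by apply/funext => t; rewrite big_ord0.
  have -> : (fun t => \sum_(i < 0) d i t) = (fun=> 0).
    by apply/funext => t; rewrite big_ord0.
  exact: der1_cst.
under [X in der1 X]eq_fun do rewrite big_ord_recl.
under [X in der1 _ X]eq_fun do rewrite big_ord_recl.
by apply: der1D => //; apply: IH.
Qed.

Lemma expr_rem_le (m : nat) : exists2 C : R, 0 <= C & forall s t,
  0 <= s <= 1 -> 0 <= t <= 1 ->
  `|t ^+ m.+1 - s ^+ m.+1 - m.+1%:R * s ^+ m * (t - s)| <= C * `|t - s| ^+ 2.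
Proof.
elim: m => [|m [C C0 IH]].
  by exists 0 => // s t _ _; rewrite !expr1 expr0 !mul1r subrr normr0 mul0r.
exists (C + m.+1%:R); first by rewrite addr_ge0.
move=> s t sI tI; have -> : t ^+ m.+2 - s ^+ m.+2 - m.+2%:R * s ^+ m.+1 * (t -
  s) =
   t * (t ^+ m.+1 - s ^+ m.+1 - m.+1%:R * s ^+ m * (t - s)) +
   m.+1%:R * s ^+ m * (t - s) ^+ 2.
  by rewrite -[m.+2%:R]natr1 !exprS; ring.
have [/andP[t0 t1] /andP[s0 s1]] := (tI, sI).
rewrite (le_trans (ler_normD _ _))// mulrDl lerD//.
  rewrite normrM ger0_norm// (le_trans _ (IH _ _ sI tI))// ler_piMl//.
rewrite !normrM normrX ler_wpM2r ?exprn_ge0// [X in X * _]ger0_norm//.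
by rewrite ler_piMr// ger0_norm ?exprn_ge0// exprn_ile1.
Qed.

Lemma der1_expr (m : nat) :
  der1 (fun t => t ^+ m.+1) (fun t => m.+1%:R * t ^+ m).
Proof.
have [C C0 h] := expr_rem_le m; exists C, 1; split=> // s t sI tI st.
rewrite (le_trans (h _ _ sI tI))// ler_wpM2l// expr2 ler_wpM2l//.
by apply: le_om => //; exact: ltW.
Qed.

(** The remainder is asked only between points of the segment closer than [dl], which is what an
    almost Lipschitz map provides. *)
Lemma der1_seg (p : nat) (f : 'cV[R]_p -> R) (g : 'I_p -> 'cV[R]_p -> R)
    (y e : 'cV[R]_p) (C dl : R) : 0 <= C -> 0 < dl ->
  (forall s t, 0 <= s <= 1 -> 0 <= t <= 1 ->
    let z := y + s *: e in let z' := y + t *: e in `|z' - z| < dl ->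
    `|fo_rem f g z' z| <= C * (`|z' - z| * om `|z' - z|)) ->
  der1 (fun t => f (y + t *: e)) (fun t => \sum_i g i (y + t *: e) * e i 0).
Proof.
move=> C0 dl0 fD; pose a := 1 + `|e|.
have a1 : 1 <= a by rewrite lerDl.
have a0 : 0 < a by rewrite (lt_le_trans _ a1).
exists (C * (a * a)), (dl / a); split; rewrite ?mulr_ge0 ?divr_gt0 ?(ltW a0)//.
move=> s t sI tI; rewrite ltr_pdivlMr// => st.
have zE : y + t *: e - (y + s *: e) = (t - s) *: e.
  by rewrite opprD addrACA subrr add0r -scalerBl.
have zn : `|y + t *: e - (y + s *: e)| <= a * `|t - s|.
  by rewrite zE normrZ mulrC ler_wpM2r// lerDr.
have h := fD s t sI tI; rewrite /= in h.
have -> : f (y + t *: e) - f (y + s *: e) - (\sum_i g i (y + s *: e) * e i 0) *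
  (t - s)
   = fo_rem f g (y + t *: e) (y + s *: e).
  rewrite /fo_rem zE; congr (_ - _); rewrite mulr_suml; apply: eq_bigr => i _.
  by rewrite !mxE -mulrA [e i 0 * _]mulrC.
apply: (le_trans (h _)); first by rewrite (le_lt_trans zn)// mulrC.
rewrite -mulrA ler_wpM2l// mulrACA ler_pM ?om_ge0//.
by rewrite (le_trans _ (omM heps _ _))//; apply: om_le.
Qed.

Definition cvx (p : nat) (X : set 'cV[R]_p) : Prop :=
  forall x y t, X x -> X y -> 0 <= t <= 1 -> X (y + t *: (x - y)).

Lemma der1_fo (p : nat) (X : set 'cV[R]_p) K f g x y : 0 <= K -> cvx X ->
  fo_bound eps K X f g -> X x -> X y ->
  der1 (fun t => f (y + t *: (x - y)))
       (fun t => \sum_i g i (y + t *: (x - y)) * (x - y) i 0).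
Proof.
move=> K0 cX fD xX yX; apply: (der1_seg (C := K) (dl := 1)) => //
  s t sI tI z z' _.
by apply: fD; exact: cX.
Qed.

(* Words index iterated partial derivatives, the last letter being the
   outermost one. *)
Definition word_family (p L : nat) (K : R) (X : set 'cV[R]_p)
    (F : seq 'I_p -> 'cV[R]_p -> R) : Prop :=
  (forall w, (size w < L)%N -> fo_bound eps K X (F w) (fun i =>
    F (rcons w i))) /\
  (forall w, size w = L ->
     forall x y, X x -> X y -> `|F w x - F w y| <= K * om `|x - y|).

(** The [m]-th directional derivative along [e] of the function indexed by [w]: the sum of
    [F (w ++ u)] over words [u] of length [m], weighted by the products of the coordinates of
    [e]. *)
Fixpoint wterm (p m : nat) (F : seq 'I_p ->
  R) (e : 'cV[R]_p) (w : seq 'I_p) : R :=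
  if m is m'.+1 then \sum_i e i 0 * wterm m' F e (rcons w i) else F w.

Lemma wtermZ p m (F : seq 'I_p -> R) e t w :
  wterm m F (t *: e) w = t ^+ m * wterm m F e w.
Proof.
elim: m w => [|m IH] w /=; first by rewrite mul1r.
by rewrite mulr_sumr; apply: eq_bigr => i _; rewrite IH mxE exprS; ring.
Qed.

(** Induction on the order: along a segment, the derivative of a Taylor remainder is a combination
    of remainders of one order less for the words [rcons w i], and [mean_ineq] replaces integration.
    Each order costs a factor [p], the number of letters. *)
Lemma taylor (p L : nat) (K : R) (X : set 'cV[R]_p) F : 0 <= K -> cvx X ->
  word_family L K X F -> forall k w, (size w + k)%N = L ->
  forall x y, X x -> X y ->
  `|F w x - \sum_(m < k.+1) (m`!%:R)^-1 * wterm m (F ^~ y) (x - y) w|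
    <= K * p%:R ^+ k * (`|x - y| ^+ k * om `|x - y|).
Proof.
move=> K0 cX [Fl FL]; elim=> [|k IH] w wk x y xX yX.
  rewrite big_ord_recl big_ord0 fact0 invr1 mul1r addr0 /= !expr0 mulr1 mul1r.
  by apply: FL => //; rewrite -[LHS]addn0.
set e := x - y.
pose r t := F w (y + t *: e) +
   (-1) * (F w y + \sum_(m < k.+1) (m.+1`!%:R)^-1 * wterm m.+1 (F ^~ y) e w * t
     ^+ m.+1).
pose d t := \sum_i F (rcons w i) (y + t *: e) * e i 0 +
   (-1) * (0 + \sum_(m < k.+1) (m.+1`!%:R)^-1 * wterm m.+1 (F ^~ y) e w *
     (m.+1%:R * t ^+ m)).
have rd : der1 r d.
  apply: der1D.
    apply: (@der1_fo _ X K (F w) (fun i => F (rcons w i))) => //.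
    by apply: Fl; rewrite -wk -addSnnS leq_addr.
  apply: der1Z; apply: der1D; first exact: der1_cst.
  by apply: der1_sum => m; apply: der1Z; exact: der1_expr.
have r0 : r 0 = 0.
  rewrite /r scale0r addr0 big1 ?addr0 ?mulN1r ?subrr// => m _.
  by rewrite expr0n /= mulr0.
have -> : F w x - \sum_(m < k.+2) (m`!%:R)^-1 * wterm m (F ^~ y) e w = r 1 - r
  0.
  rewrite r0 subr0 /r scale1r [y + e]addrC /e subrK mulN1r big_ord_recl /=.
  rewrite fact0 invr1 mul1r; congr (_ - (_ + _)); apply: eq_bigr => m _.
  by rewrite expr1n mulr1.
apply: (mean_ineq rd) => t tI.
(* Differentiating [t ^+ m.+1] turns the coefficient [1 / (m+1)!] into [1 / m!], and [t ^+ m] is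
   absorbed by [wtermZ] as the expansion at [y + t *: e]. *)
have dE : d t = \sum_i e i 0 * (F (rcons w i) (y + t *: e) -
    \sum_(m < k.+1) (m`!%:R)^-1 * wterm m (F ^~ y) (y + t *: e - y) (rcons w
      i)).
  rewrite /d add0r mulN1r.
  under [in RHS]eq_bigr do rewrite mulrBr.
  rewrite sumrB; congr (_ - _); first by apply: eq_bigr => i _; rewrite mulrC.
  under [in RHS]eq_bigr do rewrite mulr_sumr.
  rewrite exchange_big; apply: eq_bigr => m _ /=.
  rewrite -mulrA mulr_suml mulr_sumr; apply: eq_bigr => i _.
  rewrite addrC addKr wtermZ factS natrM invfM.
  by field; rewrite nat1r !pnatr_eq0 -lt0n fact_gt0.
have sz i : (size (rcons w i) + k)%N = L by rewrite size_rcons addSnnS.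
have zX : X (y + t *: e) by apply: cX.
have [t0 t1] := andP tI.
have te : `|t *: e| <= `|e|.
  by rewrite normrZ ger0_norm// ler_piMl.
rewrite dE (_ : K * _ * _ =
    #|'I_p|%:R * (`|e| * (K * p%:R ^+ k * (`|e| ^+ k * om `|e|)))); last first.
  by rewrite card_ord !exprS; ring.
apply: ler_norm_sum_const => i; rewrite normrM.
apply: ler_pM => //; first exact: coord_le.
apply: (le_trans (IH _ (sz i) _ _ zX yX)); rewrite [y + _]addrC addrK.
apply: ler_wpM2l; first by rewrite mulr_ge0 ?exprn_ge0.
rewrite ler_pM ?exprn_ge0 ?om_ge0//; first by rewrite lerXn2r ?nnegrE.
exact: om_le.
Qed.

End Taylor.

(** * Symmetry of iterated partial derivatives *)

Section Symmetry.
Variables (R : realType) (eps : R).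
Hypothesis heps : 0 < eps <= 1.
Local Notation om := (om eps).
Local Notation GC := (GC eps).
Local Notation DC := (DC eps).

Lemma open_ballP (p : nat) (X : set 'cV[R]_p) y : open X -> X y ->
  exists2 d, 0 < d & forall v, `|v| < d -> X (y + v).
Proof.
rewrite openE => oX /oX /nbhs_ballP[d /= d0 dX]; exists d => // v vd.
by apply: dX; rewrite -ball_normE /ball_/= opprD addrA subrr sub0r normrN.
Qed.

Lemma sum_delta (p : nat) (g : 'I_p -> R) (s : R) (j : 'I_p) :
  \sum_i g i * (s *: delta_mx j 0 : 'cV[R]_p) i 0 = s * g j.
Proof.
rewrite (bigD1 j)//= big1 => [|i /negPf ij].
  by rewrite !mxE !eqxx mulr1 addr0 mulrC.
by rewrite !mxE ij mulr0 mulr0.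
Qed.

(** Compare the two expansions at [x + s e_i], divide by [s] and let [s] tend to 0; openness keeps
    the test points in [X]. *)
Lemma grad_unique (p : nat) (X : set 'cV[R]_p) K f g f' g' : 0 <= K -> open X ->
  (forall x, X x -> f x = f' x) -> fo_bound eps K X f g ->
    fo_bound eps K X f' g' ->
  forall i x, X x -> g i x = g' i x.
Proof.
move=> K0 oX ff fg fg' i x xX.
have [d d0 dX] := open_ballP oX xX.
apply/eqP; rewrite -subr_eq0 -normr_le0.
apply: (@le0_of_le_om _ _ heps _ (2 * K) d) => //; first by rewrite mulr_ge0.
move=> s s0 sd; pose v : 'cV[R]_p := s *: delta_mx i 0.
have vn : `|v| = s by rewrite normrZ norm_delta mulr1 gtr0_norm.
have xvX : X (x + v) by apply: dX; rewrite vn.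
have xv : x + v - x = v by rewrite addrC addKr.
have := fg _ _ xvX xX; have := fg' _ _ xvX xX.
rewrite /fo_rem xv !sum_delta vn -!ff// => h1 h2.
rewrite -(ler_pM2l s0) -[X in X * `|_|](gtr0_norm s0) -normrM.
have -> : s * (g i x - g' i x) = (f (x + v) - f x - s * g' i x) -
  (f (x + v) - f x - s * g i x) by ring.
rewrite (le_trans (ler_normB _ _))//; lra.
Qed.

(** The second difference of [f] is symmetric in [a] and [b], so this estimate contains Schwarz's
    theorem. It is the mean value inequality for [t |-> f (y + eb + t ea) - f (y + t ea)], whose
    derivative is [s] times an increment of [g a]. *)
Lemma second_difference (p : nat) (X : set 'cV[R]_p) K f g (h : 'I_p ->
  'I_p -> 'cV[R]_p -> R)
    (y : 'cV[R]_p) d a b s : 0 <= K ->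
  fo_bound eps K X f g -> (forall i, fo_bound eps K X (g i) (h i)) ->
  (forall v, `|v| < d -> X (y + v)) -> 0 < s -> 2 * s < d ->
  forall ea eb : 'cV[R]_p, ea = s *: delta_mx a 0 -> eb = s *: delta_mx b 0 ->
  `|f (y + eb + ea) - f (y + ea) - f (y + eb) + f y - s ^+ 2 * h a b y|
    <= 6 * K * (s ^+ 2 * om s).
Proof.
move=> K0 fg gh dX s0 sd ea eb eaE ebE.
have eaN : `|ea| = s by rewrite eaE normrZ norm_delta mulr1 gtr0_norm.
have ebN : `|eb| = s by rewrite ebE normrZ norm_delta mulr1 gtr0_norm.
have tea t : 0 <= t <= 1 -> `|t *: ea| <= s.
  by case/andP => t0 t1; rewrite normrZ eaN ger0_norm// ler_piMl// ltW.
have yX v : `|v| <= 2 * s -> X (y + v) by move=> vs; apply: dX;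
  exact: le_lt_trans sd.
have X2 t : 0 <= t <= 1 -> X (y + t *: ea).
  by move=> tI; apply: yX; have := tea t tI; lra.
have n1 t : 0 <= t <= 1 -> `|eb + t *: ea| <= 2 * s.
  by move=> tI; rewrite (le_trans (ler_normD _ _))// ebN; have := tea t tI; lra.
have X1 t : 0 <= t <= 1 -> X (y + eb + t *: ea).
  by move=> tI; rewrite -addrA; apply: yX; exact: n1.
pose r t := f (y + eb + t *: ea) + (-1) * (f (y + t *: ea) + (s ^+ 2 * h a b y)
  * t ^+ 1).
pose d1 t := \sum_i g i (y + eb + t *: ea) * ea i 0 +
   (-1) * (\sum_i g i (y + t *: ea) * ea i 0 + (s ^+ 2 * h a b y) * (1%:R * t
     ^+ 0)).
have rd : der1 eps r d1.
  have segX z : (forall t, 0 <= t <= 1 -> X (z + t *: ea)) ->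
    der1 eps (fun t => f (z + t *: ea)) (fun t =>
      \sum_i g i (z + t *: ea) * ea i 0).
    move=> zX; apply: (der1_seg heps (C := K) (dl := 1)) => //
      s1 t1 s1I t1I z1 z2 _.
    by apply: fg; exact: zX.
  apply: der1D; first exact: segX.
  apply: der1Z; apply: der1D; first exact: segX.
  by apply: der1Z; exact: der1_expr.
have -> : f (y + eb + ea) - f (y + ea) - f (y + eb) + f y - s ^+ 2 * h a b y =
  r 1 - r 0.
  by rewrite /r !scale1r !scale0r !addr0 expr1n expr0n /=; ring.
apply: (mean_ineq heps rd) => t tI.
have hy := gh a _ _ (X1 t tI) (yX 0 _); have hy2 := gh a _ _ (X2 t tI) (yX 0 _).
rewrite normr0 addr0 in hy hy2.
have {}hy := hy (mulr_ge0 (ler0n _ 2) (ltW s0)).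
have {}hy2 := hy2 (mulr_ge0 (ler0n _ 2) (ltW s0)).
have e1 : y + eb + t *: ea - y = eb + t *: ea by rewrite -(addrA y) [LHS]addrC
  addKr.
have e2 : y + t *: ea - y = t *: ea by rewrite addrC addKr.
have dE : d1 t = s * (fo_rem (g a) (h a) (y + eb + t *: ea) y -
    fo_rem (g a) (h a) (y + t *: ea) y).
  have sdl (G : 'I_p -> R) : \sum_i G i * ea i 0 = s * G a by rewrite eaE
    sum_delta.
  rewrite /d1 (sdl (g ^~ (y + eb + t *: ea))) (sdl (g ^~ (y + t *: ea))).
  rewrite /fo_rem e1 e2.
  have -> : \sum_i h a i y * (eb + t *: ea) i 0 = s * h a b y +
      \sum_i h a i y * (t *: ea) i 0.
    rewrite -(sum_delta (fun i => h a i y)) -ebE -big_split/=;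
      apply: eq_bigr => i _.
    by rewrite -mulrDr mxE.
  by ring.
rewrite e1 in hy; rewrite e2 in hy2.
have om0 := om_ge0 eps s.
have n1t := n1 t tI; have n2t := tea t tI.
have o1 : om `|eb + t *: ea| <= 2 * om s.
  by rewrite (le_trans _ (omM heps _ _)) ?ler1n ?(ltW s0)//; apply: om_le.
have o2 : om `|t *: ea| <= om s by apply: om_le.
have p1 : `|eb + t *: ea| * om `|eb + t *: ea| <= 2 * s * (2 * om s).
  by rewrite ler_pM// om_ge0.
have p2 : `|t *: ea| * om `|t *: ea| <= s * om s by rewrite ler_pM// om_ge0.
have q1 := le_trans hy (ler_wpM2l K0 p1).
have q2 := le_trans hy2 (ler_wpM2l K0 p2).
rewrite dE normrM gtr0_norm//.
rewrite (_ : 6 * K * (s ^+ 2 * om s) = s * (6 * (K * (s * om s))));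
  last by ring.
rewrite ler_pM2l// (le_trans (ler_normB _ _))//.
rewrite (_ : K * _ = 4 * (K * (s * om s))) in q1; last by ring.
have : 0 <= K * (s * om s) by rewrite !mulr_ge0// ltW.
lra.
Qed.

Lemma schwarz (p : nat) (X : set 'cV[R]_p) K f g (h : 'I_p -> 'I_p ->
  'cV[R]_p -> R) :
  0 <= K -> open X ->
  fo_bound eps K X f g -> (forall i, fo_bound eps K X (g i) (h i)) ->
  forall a b y, X y -> h a b y = h b a y.
Proof.
move=> K0 oX fg gh a b y yX; have [d d0 dX] := open_ballP oX yX.
apply/eqP; rewrite -subr_eq0 -normr_le0.
apply: (@le0_of_le_om _ _ heps _ (12 * K) (d / 2)) => //.
- by rewrite divr_gt0.
- by rewrite mulr_ge0.
move=> s s0 sd; have sd2 : 2 * s < d by lra.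
pose ea : 'cV[R]_p := s *: delta_mx a 0; pose eb : 'cV[R]_p :=
  s *: delta_mx b 0.
have h2 := second_difference K0 fg gh dX s0 sd2 (erefl ea) (erefl eb).
have h1 := second_difference K0 fg gh dX s0 sd2 (erefl eb) (erefl ea).
have s20 : 0 < s ^+ 2 by rewrite exprn_gt0.
rewrite -(ler_pM2l s20) -[X in X * `|_|](gtr0_norm s20) -normrM.
rewrite [y + ea + eb]addrAC in h1.
set A := f (y + eb + ea) in h1 h2.
have -> : s ^+ 2 * (h a b y - h b a y) =
  (A - f (y + eb) - f (y + ea) + f y - s ^+ 2 * h b a y) -
  (A - f (y + ea) - f (y + eb) + f y - s ^+ 2 * h a b y) by ring.
rewrite (le_trans (ler_normB _ _))// (le_trans (lerD h1 h2))//.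
by rewrite (_ : 12 * K * om s = 6 * K * om s + 6 * K * om s); [lra|ring].
Qed.

(** Schwarz's theorem swaps the two outermost letters. Further derivatives [u] are then added one at
    a time, equal functions on an open set having equal gradients. *)
Lemma word_swap (p L : nat) (K : R) (X : set 'cV[R]_p) F : 0 <= K -> open X ->
  word_family eps L K X F -> forall w a b u, (size w + 2 + size u <= L)%N ->
  forall x, X x -> F (w ++ a :: b :: u) x = F (w ++ b :: a :: u) x.
Proof.
move=> K0 oX [Fl FL] w a b u; elim/last_ind: u => [|u i IH] sz x xX.
  have wab c d : w ++ [:: c; d] = rcons (rcons w c) d.
    by rewrite -cat1s catA !cats1.
  rewrite !wab; apply: (@schwarz _ X K (F w) (fun i => F (rcons w i))
    (fun i j => F (rcons (rcons w i) j))) => //.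
    by apply: Fl; lia.
  by move=> i; apply: Fl; rewrite size_rcons; lia.
rewrite size_rcons in sz.
have E c d : w ++ c :: d :: rcons u i = rcons (w ++ c :: d :: u) i.
  by rewrite -!rcons_cons -rcons_cat.
rewrite !E; apply: (@grad_unique _ X K (F (w ++ a :: b :: u))
   (fun i => F (rcons (w ++ a :: b :: u) i)) (F (w ++ b :: a :: u))
   (fun i => F (rcons (w ++ b :: a :: u) i))) => //.
- by move=> z zX; apply: IH => //; lia.
- by apply: Fl; rewrite size_cat /=; lia.
- by apply: Fl; rewrite size_cat /=; lia.
Qed.

Lemma word_perm (p L : nat) (K : R) (X : set 'cV[R]_p) F : 0 <= K -> open X ->
  word_family eps L K X F -> forall s t, perm_eq s t -> (size s <= L)%N ->
  forall x, X x -> F s x = F t x.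
Proof.
move=> K0 oX Ff s t st sL x xX.
have move_front pre t1 a t2 : (size (pre ++ t1 ++ a :: t2) <= L)%N ->
    F (pre ++ t1 ++ a :: t2) x = F (pre ++ a :: t1 ++ t2) x.
  elim: t1 pre => [//|b t1 IH] pre /= sz.
  rewrite -cat_rcons IH ?cat_rcons//.
  by apply: (word_swap K0 oX Ff) => //; move: sz;
    rewrite !size_cat /= !size_cat /=; lia.
(* The prefix [pre] holds the letters already matched: the head of [s] is brought to the front of
   [t] by adjacent swaps, then joins [pre]. *)
suff H pre : (size (pre ++ s) <= L)%N -> F (pre ++ s) x = F (pre ++ t) x.
  exact: (H [::]).
elim: s t pre st {sL} => [|a s IH] t pre st sL.
  by have /eqP := perm_size st; rewrite eq_sym size_eq0 => /eqP ->.
have at_ : a \in t by rewrite -(perm_mem st) mem_head.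
case/splitPr: at_ st => t1 t2; rewrite perm_sym perm_catC /= perm_cons
  perm_catC perm_sym.
move=> st; rewrite move_front.
  by rewrite -!cat_rcons; apply: IH => //; rewrite cat_rcons.
by move: sL; rewrite !size_cat /= (perm_size st) !size_cat /=; lia.
Qed.

(** The first letter selects a component of the gradient and the rest a derivative of it. The empty
    word is left out of the bound so that the lemma covers [DC], where [f] itself may be
    unbounded. *)
Lemma word_family_cons (p n : nat) K (X : set 'cV[R]_p) f g :
  fo_bound eps K X f g ->
  (forall i, exists F, [/\ F [::] = g i, word_family eps n K X F &
    forall w, (size w <= n)%N -> forall x, X x -> `|F w x| <= K]) ->
  exists F, [/\ F [::] = f, word_family eps n.+1 K X F &
    forall w, (0 < size w <= n.+1)%N -> forall x, X x -> `|F w x| <= K].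
Proof.
move=> gb /choice[F FP].
exists (fun w => if w is i :: w' then F i w' else f); split=> //; last first.
  by case=> [|i w] //= sw; have [_ _] := FP i; apply.
split=> [[|i w] //= sw|[|i w] //= [sw]].
- by move=> x y xX yX; rewrite (_ : (fun i => _) = g) ?gb//; apply/funext => i;
    case: (FP i).
- by have [_ [h _] _] := FP i; exact: h.
- by have [_ [_ h] _] := FP i; exact: h.
Qed.

Lemma GC_word_family (p n : nat) K (X : set 'cV[R]_p) f : GC n K X f ->
  exists F, [/\ F [::] = f, word_family eps n K X F &
    forall w, (size w <= n)%N -> forall x, X x -> `|F w x| <= K].
Proof.
elim: n f => [|n IH] f [fb fD].
  exists (fun _ => f); split=> //; split=> // w _ x y xX yX; exact: fD.
case: fD => g gG gb.
have [F [F0 Ff Fb]] := word_family_cons gb (fun i => IH _ (gG i)).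
by exists F; split=> // -[|i w] sw; [rewrite F0|exact: Fb].
Qed.

Lemma DC_word_family (p n : nat) K (X : set 'cV[R]_p) f : DC n K X f ->
  exists F, [/\ F [::] = f, word_family eps n.+1 K X F &
    forall w, (0 < size w <= n.+1)%N -> forall x, X x -> `|F w x| <= K].
Proof.
by case=> g gG gb; apply: word_family_cons gb _ => i; exact: GC_word_family.
Qed.

End Symmetry.

(** * Operator norms and tensors *)

Section Opnorm.
Variable R : realType.

Lemma mulmx_norm_le m n (A : 'M[R]_(m, n)) b (v : 'cV[R]_n) : 0 <= b ->
  (forall i j, `|A i j| <= b) -> `|A *m v| <= n%:R * b * `|v|.
Proof.
move=> b0 Ab; apply: cV_norm_le => [|i]; first by rewrite !mulr_ge0.
rewrite mxE; exact: grad_dot_le.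
Qed.

(** A [sup] is informative only for a nonempty set bounded above; every later fact on [opnorm] rests
    on this. *)
Lemma opnorm_has_sup m n (A : 'M[R]_(m, n)) :
  has_sup [set `|A *m v| | v in [set v : 'cV[R]_n | `|v| <= 1]].
Proof.
split; first by exists `|A *m (0 : 'cV[R]_n)|, (0 : 'cV[R]_n) => //=;
  rewrite normr0.
exists (n%:R * `|A| * 1) => _ [v /= v1 <-].
have Aij i j : `|A i j| <= `|A|.
  rewrite [leRHS]/Num.norm /= mx_normrE; apply/bigmax_geP; right => /=.
  by exists (i, j).
rewrite (le_trans (mulmx_norm_le v (normr_ge0 A) Aij))//.
by rewrite ler_wpM2l// mulr_ge0.
Qed.

Lemma opnormP m n (A : 'M[R]_(m,
  n)) (v : 'cV[R]_n) : `|A *m v| <= opnorm A * `|v|.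
Proof.
have [->|v0] := eqVneq v 0; first by rewrite mulmx0 !normr0 mulr0.
have vp : 0 < `|v| by rewrite normr_gt0.
have [_ ub] := @opnorm_has_sup _ _ A.
rewrite -ler_pdivrMr//; apply: (ub_le_sup ub).
exists (`|v|^-1 *: v) => /=; first by rewrite normrZ normfV normr_id mulVf//
  gt_eqF.
by rewrite -scalemxAr normrZ normfV normr_id mulrC.
Qed.

Lemma opnorm_le m n (A : 'M[R]_(m, n)) b : 0 <= b ->
  (forall v : 'cV[R]_n, `|A *m v| <= b * `|v|) -> opnorm A <= b.
Proof.
move=> b0 Ab; have [ne _] := @opnorm_has_sup _ _ A; apply: ge_sup => //.
by move=> _ [v /= v1 <-]; rewrite (le_trans (Ab v))// ler_piMr.
Qed.

Lemma opnorm_entry m n (A : 'M[R]_(m, n)) i j : `|A i j| <= opnorm A.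
Proof.
have := opnormP A (delta_mx j 0); rewrite norm_delta mulr1; apply: le_trans.
by rewrite -colE (le_trans _ (coord_le _ i))// mxE.
Qed.

Lemma opnorm_le_entries m n (A : 'M[R]_(m, n)) b : 0 <= b ->
  (forall i j, `|A i j| <= b) -> opnorm A <= n%:R * b.
Proof.
by move=> b0 Ab; apply: opnorm_le => [|v];
  [rewrite mulr_ge0|exact: mulmx_norm_le].
Qed.

Lemma opnorm_ge0 m n (A : 'M[R]_(m, n)) : 0 <= opnorm A.
Proof.
have [_ ub] := @opnorm_has_sup _ _ A; apply: (ub_le_sup ub);
  exists (0 : 'cV[R]_n); first by rewrite /= normr0.
by rewrite mulmx0 normr0.
Qed.

End Opnorm.

Section Tensors.
Variable R : realType.

Lemma pure_eq p k (v w : 'I_k -> 'cV[R]_p) : v =1 w -> pure v = pure w.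
Proof. by move=> vw; congr pure; apply/funext. Qed.

(* Tensor products of lists of vectors: concatenation of lists replaces casts
   between ['I_(k + m)]-indexed families. *)
Definition tlist p k (vs : seq 'cV[R]_p) : tens R p k := pure (fun l : 'I_k =>
  nth 0 vs l).

Lemma pure_tlist p k (v : 'I_k -> 'cV[R]_p) : pure v = tlist k (codom v).
Proof.
apply: pure_eq => l; rewrite (nth_map l) ?size_enum_ord//.
by rewrite nth_ord_enum.
Qed.

Lemma tprod_tlist p k m vs (e : 'cV[R]_p) : size vs = k ->
  tprod (tlist k vs) (tpow e m) = tlist (k + m) (vs ++ nseq m e).
Proof.
move=> sk; apply/ffunP => I; rewrite !ffunE big_split_ord; congr (_ * _).
  by apply: eq_bigr => l _; rewrite ffunE nth_cat sk /= ltn_ord.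
apply: eq_bigr => l _; rewrite ffunE nth_cat sk /= ltnNge leq_addr /=.
by rewrite addKn nth_nseq ltn_ord.
Qed.

Lemma tunit_tlist p : tunit R p = tlist 0 [::].
Proof. by apply/ffunP => I; rewrite !ffunE big_ord0. Qed.

(** The cross property peels off the last vector. The Lipschitz bounds are tested on pure tensors,
    so they all become bounds by products of vector norms. *)
Lemma norm_pure (N : forall p k, tens R p k -> R) (hN : tensor_norms N) p k
  (v : 'I_k -> 'cV[R]_p) : N p k (pure v) = \prod_l `|v l|.
Proof.
elim: k v => [|k IH] v.
  rewrite big_ord0 -(tn_unit hN p); congr (N _ _ _).
  by apply/ffunP => I; rewrite !ffunE big_ord0.
(* [k.+1] and [k + 1] are not convertible, so the statement is generalised over an order equal to
   the latter. *)
have H k' : k' = (k + 1)%N -> forall v : 'I_k' -> 'cV[R]_p,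
    N p k' (pure v) = \prod_l `|v l|.
  move=> -> {}v; rewrite big_split_ord/= big_ord1 -IH -(tn_cross hN).
  congr (N _ _ _); apply/ffunP => I; rewrite !ffunE big_split_ord/= !big_ord1.
  by rewrite ffunE; congr (_ * _); apply: eq_bigr => l _; rewrite ffunE.
by apply: H; rewrite addn1.
Qed.

Lemma linear_tensE p k (F : lmodType R) (u : tens R p k -> F) : linear u ->
  forall t, u t = \sum_I t I *: u (tlist k [seq delta_mx i 0 | i <- codom I]).
Proof.
move=> ul t.
have u0 : u 0 = 0.
  by have := ul (-1) 0 0; rewrite scaler0 addr0 scaleN1r addNr.
have uS (s : seq {ffun 'I_k -> 'I_p}) (c : {ffun 'I_k -> 'I_p} ->
  R) (e : {ffun 'I_k -> 'I_p} -> tens R p k) :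
    u (\sum_(I <- s) c I *: e I) = \sum_(I <- s) c I *: u (e I).
  elim: s => [|I s IH]; first by rewrite !big_nil.
  by rewrite !big_cons ul IH.
rewrite -uS; congr u; apply/ffunP => J; rewrite sum_ffunE (bigD1 J)//= big1.
  rewrite !ffunE addr0 big1 ?mulr1// => [|l _]; first exact: (esym (mulr1 _)).
  rewrite (nth_map (J l)) ?size_codom ?card_ord// (nth_map l) ?size_enum_ord//.
  by rewrite nth_ord_enum mxE !eqxx.
move=> I IJ; rewrite !ffunE; have [l Il] : exists l, I l != J l.
  apply/existsP; rewrite -negb_forall; apply: contra IJ => /forallP h.
  by apply/eqP/ffunP => l; apply/eqP.
rewrite (bigD1 l)//= (nth_map (J l)) ?size_codom ?card_ord//
  (nth_map l) ?size_enum_ord//.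
by rewrite nth_ord_enum mxE eq_sym (negPf Il) /= mul0r scaler0.
Qed.

(** Multilinear version of [wterm]: the form with coefficients [G (w ++ u)], [u] a word of length
    [size vs], evaluated at the vectors [vs]. *)
Fixpoint mterm p (vs : seq 'cV[R]_p) (G : seq 'I_p -> R) (w : seq 'I_p) : R :=
  if vs is v :: vs' then \sum_i v i 0 * mterm vs' G (rcons w i) else G w.

Lemma mterm_cat p (vs us : seq 'cV[R]_p) G w :
  mterm (vs ++ us) G w = mterm vs (mterm us G) w.
Proof. by elim: vs w => [|v vs IH] w //=; apply: eq_bigr => i _;
  rewrite IH. Qed.

Lemma mterm_nseq p m (e : 'cV[R]_p) G w : mterm (nseq m e) G w = wterm m G e w.
Proof. by elim: m w => [|m IH] w //=; apply: eq_bigr => i _; rewrite IH. Qed.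

Lemma mterm_ext p (vs : seq 'cV[R]_p) G H w :
  (forall w', size w' = (size w + size vs)%N -> G w' = H w') ->
  mterm vs G w = mterm vs H w.
Proof.
elim: vs w => [|v vs IH] w GH /=; first by apply: GH; rewrite addn0.
apply: eq_bigr => i _; rewrite (IH (rcons w i))// => w' sw'; apply: GH.
by rewrite sw' size_rcons addSnnS.
Qed.

Lemma mterm_le p (vs : seq 'cV[R]_p) G w b : 0 <= b ->
  (forall w', size w' = (size w + size vs)%N -> `|G w'| <= b) ->
  `|mterm vs G w| <= p%:R ^+ (size vs) * b * \prod_(v <- vs) `|v|.
Proof.
move=> b0; elim: vs w => [|v vs IH] w Gb /=.
  by rewrite big_nil !mulr1 mul1r; apply: Gb; rewrite addn0.
rewrite (_ : p%:R ^+ (size vs).+1 * b * \prod_(j <- v :: vs) `|j| = #|'I_p|%:R *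
  (`|v| * (p%:R ^+ (size vs) * b * \prod_(v <- vs) `|v|))); last first.
  by rewrite card_ord big_cons exprS; ring.
apply: ler_norm_sum_const => i; rewrite normrM ler_pM ?coord_le//.
by apply: IH => w' sw'; apply: Gb; rewrite sw' size_rcons addSnnS.
Qed.

Lemma mtermB p (vs : seq 'cV[R]_p) G H w :
  mterm vs (fun w => G w - H w) w = mterm vs G w - mterm vs H w.
Proof.
elim: vs w => [|v vs IH] w //=; rewrite -sumrB.
by apply: eq_bigr => i _; rewrite IH mulrBr.
Qed.

Lemma mterm_sum p (vs : seq 'cV[R]_p) n (c : 'I_n -> R) (G : 'I_n ->
  seq 'I_p -> R) w :
  mterm vs (fun w => \sum_m c m * G m w) w = \sum_m c m * mterm vs (G m) w.
Proof.
elim: vs w => [|v vs IH] w //=.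
under eq_bigr do rewrite IH mulr_sumr.
rewrite exchange_big; apply: eq_bigr => m _; rewrite mulr_sumr.
by apply: eq_bigr => i _; rewrite mulrCA.
Qed.

Lemma mterm_delta p (s : seq 'I_p) G w :
  mterm [seq delta_mx i 0 | i <- s] G w = G (w ++ s).
Proof.
elim: s w => [|i s IH] w /=; first by rewrite cats0.
rewrite (bigD1 i)//= big1 => [|j ji]; last by rewrite mxE (negPf ji) mul0r.
by rewrite mxE !eqxx mul1r addr0 IH cat_rcons.
Qed.

Definition fcons p k (i : 'I_p) (I : {ffun 'I_k -> 'I_p}) : {ffun 'I_k.+1 ->
  'I_p} :=
  [ffun l => if unlift ord0 l is Some l' then I l' else i].

Lemma codom_fcons p k (i : 'I_p) (I : {ffun 'I_k -> 'I_p}) :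
  codom (fcons i I) = i :: codom I.
Proof.
rewrite /codom /image_mem enum_ordSl /= ffunE unlift_none -map_comp.
by congr cons; apply: eq_map => l /=; rewrite ffunE liftK.
Qed.

(** Bridge between tensor coordinates, indexed by functions, and the recursive [mterm]: a
    multi-index is split into its first value and the rest through [fcons]. *)
Lemma sum_tlist p k (vs : seq 'cV[R]_p) G w : size vs = k ->
  \sum_I tlist k vs I * G (w ++ codom I) = mterm vs G w.
Proof.
elim: vs k w => [|v vs IH] k w /= <-.
  have I0 : all_equal_to ([ffun i : 'I_0 => match i with Ordinal m h =>
    False_rect 'I_p (notF h) end] : {ffun 'I_0 -> 'I_p}).
    by move=> I; apply/ffunP => -[].
  rewrite (big_pred1 [ffun i : 'I_0 => match i with Ordinal m h =>
    False_rect 'I_p (notF h) end]).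
    rewrite ffunE big_ord0 mul1r; congr G; rewrite -[RHS]cats0; congr cat.
    by apply: size0nil; rewrite size_codom card_ord.
  by move=> I; rewrite /= (I0 I) eqxx.
set K := size vs.
rewrite (reindex (fun iI : 'I_p * {ffun 'I_K -> 'I_p} => fcons iI.1 iI.2)) /=;
  last first.
  exists (fun J : {ffun 'I_K.+1 -> 'I_p} => (J ord0, [ffun l =>
    J (lift ord0 l)])).
    move=> [i I] _ /=; congr pair; first by rewrite ffunE unlift_none.
    by apply/ffunP => l; rewrite !ffunE liftK.
  move=> J _; apply/ffunP => l; rewrite ffunE /=.
  by case: unliftP => [l' ->|->]; rewrite ?ffunE.
rewrite -(pair_bigA _ (fun i I =>
  tlist K.+1 (v :: vs) (fcons i I) * G (w ++ codom (fcons i I)))) /=.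
apply: eq_bigr => i _; rewrite -(IH K)// mulr_sumr; apply: eq_bigr => I _.
rewrite codom_fcons cat_rcons mulrA; congr (_ * _).
rewrite !ffunE big_ord_recl /= ffunE unlift_none; congr (_ * _).
by apply: eq_bigr => l _; rewrite ffunE liftK.
Qed.

Lemma linear_tlist p k (u : tens R p k -> R^o) vs : linear u -> size vs = k ->
  u (tlist k vs) = mterm vs (fun w =>
    u (tlist k [seq delta_mx i 0 | i <- w])) [::].
Proof. by move=> ul sk; rewrite -(sum_tlist _ _ sk) (linear_tensE ul). Qed.

End Tensors.

(** * From classes C^{n,eps} to Lipschitz jets, and back *)

Section JetsOut.
Variables (R : realType).

(** The jet whose value on a basis tensor is the iterated partial derivative along the word of its
    indices. *)
Definition wjet p q (F : 'I_q -> seq 'I_p -> 'cV[R]_p ->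
  R) : jet R p 'cV[R]_q :=
  fun k x t => \col_a \sum_I t I * F a (codom I) x.

Lemma wjet_linear p q (F : 'I_q -> seq 'I_p -> 'cV[R]_p -> R) k x :
  linear (wjet F (k := k) x).
Proof.
move=> c s t; apply/colP => a; rewrite !mxE mulr_sumr -big_split/=.
by apply: eq_bigr => I _; rewrite !ffunE mulrDl mulrA.
Qed.

Lemma wjet_tlist p q (F : 'I_q -> seq 'I_p -> 'cV[R]_p ->
  R) k x vs a : size vs = k ->
  wjet F x (tlist k vs) a 0 = mterm vs (F a ^~ x) [::].
Proof. by move=> sk; rewrite mxE -(sum_tlist _ _ sk). Qed.

Lemma tprodDl p k m (c : R) (s t : tens R p k) (b : tens R p m) :
  tprod (c *: s + t) b = c *: tprod s b + tprod t b.
Proof. by apply/ffunP => I; rewrite !ffunE mulrDl -scalerAl. Qed.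

Lemma djet_linear p q (f : jet R p 'cV[R]_q) k x :
  linear (f (k + 1)%N x) -> linear (djet f (k := k) x).
Proof. by move=> fl c s t; apply/matrixP => a j;
  rewrite !mxE tprodDl fl !mxE. Qed.

Lemma djet_tlist p q (f : jet R p 'cV[R]_q) k x vs a j : size vs = k ->
  djet f x (tlist k vs) a j = f (k + 1)%N x (tlist (k + 1) (rcons vs (delta_mx
    j 0))) a 0.
Proof. by move=> sk; rewrite mxE tprod_tlist//= cats1. Qed.

Lemma djet_wjet_tlist p q (F : 'I_q -> seq 'I_p -> 'cV[R]_p -> R) k x vs a j :
  size vs = k ->
  djet (wjet F) x (tlist k vs) a j = mterm vs (fun w => F a (rcons w j) x) [::].
Proof.
move=> sk; rewrite djet_tlist// wjet_tlist ?size_rcons ?sk ?addn1//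
  -cats1 mterm_cat.
by apply: mterm_ext => w _; rewrite -[[:: _]]/[seq delta_mx i 0 | i <- [:: j]]
  mterm_delta cats1.
Qed.

(** Moving the permutation from the tensor to the index by reindexing leaves [G] at a rearranged
    word, where symmetry of [G] applies. *)
Lemma sum_tact p k (V : lmodType R) (G : seq 'I_p -> V) (s : {perm 'I_k})
    (t : tens R p k) :
  (forall w w', perm_eq w w' -> size w = k -> G w = G w') ->
  \sum_I tact s t I *: G (codom I) = \sum_I t I *: G (codom I).
Proof.
move=> Gp; rewrite (reindex (fun I : {ffun 'I_k -> 'I_p} => [ffun r =>
  I ((s^-1)%g r)])).
  apply: eq_bigr => I _; congr (_ *: _).
    by rewrite ffunE; congr (t _); apply/ffunP => r; rewrite !ffunE permK.
  apply: Gp; last by rewrite size_codom card_ord.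
  rewrite (eq_codom (ffunE _)) /codom /image_mem (map_comp I (s^-1)%g);
    apply: perm_map.
  have sI := @perm_inj _ (s^-1)%g.
  apply: uniq_perm => [||r]; rewrite ?(map_inj_uniq sI) ?enum_uniq//.
  by rewrite [RHS]mem_enum -[r in LHS](permK s) mem_map ?mem_enum.
exists (fun I : {ffun 'I_k -> 'I_p} => [ffun r => I (s r)]) => I _.
  by apply/ffunP => r; rewrite !ffunE permK.
by apply/ffunP => r; rewrite !ffunE permKV.
Qed.

Lemma wjet_symlinear p q (F : 'I_q -> seq 'I_p -> 'cV[R]_p -> R) k x :
  (forall a w w', perm_eq w w' -> size w = k -> F a w x = F a w' x) ->
  symlinear (wjet F (k := k) x).
Proof.
move=> Fp; split; first exact: wjet_linear.
move=> s t; apply/colP => a; rewrite !mxE.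
exact: (@sum_tact _ _ R^o (fun w => F a w x) s t (Fp a)).
Qed.

Lemma djet_wjet_symlinear p q (F : 'I_q -> seq 'I_p -> 'cV[R]_p -> R) k x :
  (forall a w w', perm_eq w w' -> size w = k.+1 -> F a w x = F a w' x) ->
  symlinear (djet (wjet F) (k := k) x).
Proof.
move=> Fp; have dl := djet_linear (wjet_linear F (k := (k + 1)%N) x).
split=> // s t; rewrite !(linear_tensE dl).
pose G (w : seq 'I_p) : 'M[R]_(q, p) := \matrix_(a, j) F a (rcons w j) x.
have dG (I : {ffun 'I_k -> 'I_p}) :
    djet (wjet F) x (tlist k [seq delta_mx i 0 | i <- codom I]) = G (codom I).
  apply/matrixP => a j; rewrite djet_wjet_tlist ?mterm_delta ?mxE//.
  by rewrite size_map size_codom card_ord.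
under eq_bigr do rewrite dG.
under [RHS]eq_bigr do rewrite dG.
apply: sum_tact => w w' ww sw; apply/matrixP => a j; rewrite !mxE.
apply: Fp; last by rewrite size_rcons sw.
by rewrite -!cats1 perm_cat2r.
Qed.

Variables (eps : R) (heps : 0 < eps <= 1).
Variables (N : forall p k, tens R p k -> R) (hN : tensor_norms N).
Variables (gamma : R) (n : nat) (hgamma : gamma = n.+1%:R + eps).
Local Notation om := (om eps).

Lemma lipdeg_gamma : lipdeg gamma = n.+1.
Proof. by rewrite hgamma lipdegE. Qed.

Lemma lipdeg_gamma1 : lipdeg (gamma - 1) = n.
Proof.
rewrite (_ : gamma - 1 = n%:R + eps) ?lipdegE// hgamma -[n.+1%:R]natr1; ring.
Qed.

Lemma powR_om (t : R) (m : nat) : 0 <= t -> t `^ (m%:R + eps) = t ^+ m * om t.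
Proof.
move=> t0; case/andP: heps => e0 _.
rewrite powRD ?powR_mulrn//; apply/implyP; rewrite gt_eqF//.
by rewrite ltr_wpDl.
Qed.

Lemma powR_gamma1 (t : R) k : 0 <= t -> (k <= n)%N ->
  t `^ (gamma - 1 - k%:R) = t ^+ (n - k) * om t.
Proof.
move=> t0 kn; rewrite -powR_om// natrB// hgamma -[n.+1%:R]natr1; congr powR;
  ring.
Qed.

Lemma lip_bound_sub p q (X X' : set 'cV[R]_p) (f : jet R p 'M[R]_(q, p)) g M :
  X' `<=` X -> lip_bound N (@opnorm R q p) g X f M ->
  lip_bound N (@opnorm R q p) g X' f M.
Proof.
by move=> sX [M0 fM]; split=> // k kn x y /sX xX /sX yX v; exact: fM.
Qed.

Lemma almost_lip_sub p q (X X' : set 'cV[R]_p) phi (f : jet R p 'cV[R]_q) g :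
  X' `<=` X -> almost_lip N g X phi f -> almost_lip N g X' phi f.
Proof.
move=> sX [d d0 [h1 h2 [h3 [M h4]] [M' M'0 h5]]]; exists d => //; split.
- by move=> x /sX; exact: h1.
- by move=> k kn x /sX; exact: h2.
- by split=> [k kn x /sX|]; [exact: h3|exists M; exact: lip_bound_sub h4].
- by exists M' => // x y /sX xX /sX yX; exact: h5.
Qed.

Lemma dlip_norm_le p q (X : set 'cV[R]_p) (f : jet R p 'cV[R]_q) M :
  lip_bound N (@opnorm R q p) (gamma - 1) X (djet f) M ->
  dlip_norm N gamma X f <= M.
Proof.
move=> fM; apply: ge_inf => //; exists 0 => M' [].
by [].
Qed.

Lemma jets_out p q K : 0 <= K -> exists2 c, 0 <= c &
  forall (X : set 'cV[R]_p) (f : 'cV[R]_p -> 'cV[R]_q), open X -> cvx X ->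
  (forall a, DC eps n K X (fun x => f x a 0)) ->
  exists2 jf : jet R p 'cV[R]_q, almost_lip N gamma X f jf &
    lip_bound N (@opnorm R q p) (gamma - 1) X (djet jf) c.
Proof.
move=> K0; pose P : R := p.+1%:R ^+ n.
have P0 : 0 <= P by rewrite exprn_ge0.
have P1 : 1 <= P by rewrite exprn_ege1// ler1n.
have pP k : (k <= n)%N -> p%:R ^+ k <= P.
  move=> kn; apply: (@le_trans _ _ (p.+1%:R ^+ k));
    first by rewrite lerXn2r ?nnegrE// ler_nat.
  by rewrite ler_weXn2l// ler1n.
(* The factor [p] passes from entries to the operator norm, one [P] bounds the sum over words in
   [mterm_le], the other the power of [p] in Taylor's formula. *)
pose c := p%:R * (P * (K * P)); have c0 : 0 <= c by rewrite !mulr_ge0.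
exists c => // X f oX cX fD.
have [F FP] : {F : 'I_q -> seq 'I_p -> 'cV[R]_p -> R & forall a,
    [/\ F a [::] = (fun x => f x a 0), word_family eps n.+1 K X (F a) &
    forall w, (0 < size w <= n.+1)%N -> forall x, X x -> `|F a w x| <= K]}.
  by apply: (@choice _ _ (fun a F => [/\ F [::] = (fun x => f x a 0),
    word_family eps n.+1 K X F &
    forall w, (0 < size w <= n.+1)%N -> forall x, X x -> `|F w x| <= K])) => a;
    exact: (DC_word_family (fD a)).
have Fperm a w w' x : perm_eq w w' -> (size w <= n.+1)%N -> X x ->
  F a w x = F a w' x.
  move=> ww sw xX; have [_ Fw _] := FP a; exact: (word_perm heps K0 oX Fw).
have lb : lip_bound N (@opnorm R q p) (gamma - 1) X (djet (wjet F)) c.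
  split=> //; rewrite lipdeg_gamma1 => k kn x y xX yX v;
    rewrite (norm_pure hN) powR_gamma1//.
  rewrite pure_tlist; set vs := codom v.
  have svs : size vs = k by rewrite size_codom card_ord.
  have pn : \prod_l `|v l| = \prod_(u <- vs) `|u|.
    by rewrite /vs /codom /image_mem big_map big_enum.
  have pn0 : 0 <= \prod_l `|v l| by apply: prodr_ge0.
  have t0 : 0 <= `|x - y| ^+ (n - k) * om `|x - y|.
    by rewrite mulr_ge0 ?om_ge0 ?exprn_ge0.
  have PKP b : 0 <= b -> p%:R * (p%:R ^+ k * (K * P * b) * \prod_(u <- vs) `|u|)
      <= c * b * \prod_l `|v l|.
    move=> b0; rewrite -pn mulrA ler_wpM2r// /c -!mulrA ler_wpM2l//.
    by rewrite ler_wpM2r ?pP// !mulr_ge0.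
  split.
    rewrite -[c]mulr1 (le_trans _ (PKP 1 ler01))//;
      apply: opnorm_le_entries => [|a j].
      by rewrite -pn !mulr_ge0 ?exprn_ge0.
    rewrite djet_wjet_tlist// -[in p%:R ^+ k]svs; apply: mterm_le => [|w].
      by rewrite !mulr_ge0.
    rewrite add0n svs mulr1 => sw; have [_ _ Fb] := FP a.
    by rewrite (le_trans (Fb _ _ _ xX)) ?ler_peMr// size_rcons sw.
  rewrite (le_trans _ (PKP _ t0))//; apply: opnorm_le_entries => [|a j].
    by rewrite -pn !mulr_ge0 ?exprn_ge0 ?om_ge0.
  set e := x - y.
  (* In [djet] the column index [j] is the last letter, which would come after the letters added by
     Taylor's formula. Symmetry moves it to the front, where the words starting with [j] form a
     family of order [n]. *)
  pose Fj w z := F a (j :: w) z.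
  have FjE w z : X z -> (size w <= n)%N -> F a (rcons w j) z = Fj w z.
    by move=> zX sw; apply: Fperm; rewrite ?size_rcons// perm_rcons.
  have -> : lip_rem n (djet (wjet F)) x y (tlist k vs) a j =
      mterm vs (fun w => Fj w x -
        \sum_(m < (n - k).+1) (m`!%:R)^-1 * wterm m (Fj ^~ y) e w) [::].
    have subE (M M' : 'M[R]_(q, p)) : (M - M') a j = M a j - M' a j.
      by rewrite !mxE.
    rewrite mtermB mterm_sum /lip_rem subE summxE -subSn//; congr (_ - _).
      rewrite djet_wjet_tlist//; apply: mterm_ext => w; rewrite add0n svs => sw.
      by rewrite FjE ?sw.
    apply: eq_bigr => m _.
    have mn : (k + m <= n)%N by have := ltn_ord m; lia.
    have dl := djet_linear (wjet_linear F (k := (k + m + 1)%N) y).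
    have sclE (cc : R) (M : 'M[R]_(q,
      p)) : (cc *: M) a j = cc * M a j by rewrite mxE.
    have -> : djet (wjet F) y ((m`!%:R)^-1 *: tprod (tlist k vs) (tpow e m)) =
        (m`!%:R)^-1 *: djet (wjet F) y (tprod (tlist k vs) (tpow e m)).
      have d0 : djet (wjet F) y (0 : tens R p (k + m)) = 0.
        by have := dl (-1) 0 0; rewrite scaler0 addr0 scaleN1r addNr.
      by have := dl (m`!%:R)^-1 (tprod (tlist k vs) (tpow e m)) 0;
        rewrite d0 !addr0.
    rewrite sclE; congr (_ * _).
    rewrite tprod_tlist// djet_wjet_tlist ?size_cat ?size_nseq ?svs// mterm_cat.
    apply: mterm_ext => w; rewrite add0n svs => sw; rewrite -mterm_nseq.
    by apply: mterm_ext => w'; rewrite size_nseq sw => sw'; rewrite FjE ?sw'.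
  rewrite -[in p%:R ^+ k]svs; apply: mterm_le => [|w].
    by rewrite mulr_ge0// mulr_ge0.
  rewrite add0n svs => sw; have [_ [Fl FL] _] := FP a.
  have wf : word_family eps n K X Fj.
    split=> [w' sw'|w' sw']; first by apply: (Fl (j :: w')).
    by apply: FL; rewrite /= sw'.
  have wn : (size w + (n - k))%N = n by rewrite sw subnKC.
  rewrite (le_trans (taylor heps K0 cX wf wn xX yX))//.
  by rewrite ler_wpM2r// ler_wpM2l// pP// leq_subr.
(* By convexity Taylor's formula holds between any two points of [X], so the order-zero estimate has
   no scale restriction. *)
exists (wjet F) => //; exists +oo%E => //; split.
- move=> x xX; apply/colP => a; rewrite tunit_tlist wjet_tlist//=.
  by have [-> _ _] := FP a.
- rewrite lipdeg_gamma => k kn x xX; apply: wjet_symlinear => a w w' ww sw.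
  by apply: Fperm; rewrite ?sw.
- split; last by exists c.
  rewrite lipdeg_gamma1 => k kn x xX; apply: djet_wjet_symlinear =>
    a w w' ww sw.
  by apply: Fperm; rewrite ?sw.
exists (K * p%:R ^+ n.+1); first by rewrite mulr_ge0 ?exprn_ge0.
rewrite lipdeg_gamma => x y xX yX _; rewrite hgamma powR_om//.
apply: cV_norm_le => [|a]; first by rewrite !mulr_ge0 ?exprn_ge0 ?om_ge0.
have [_ Fw _] := FP a.
have := taylor heps K0 cX Fw (w := [::]) (erefl _) xX yX.
set e := x - y.
suff -> : lip_rem n.+1 (wjet F) x y (tunit R p) a 0 =
  F a [::] x - \sum_(m < n.+2) (m`!%:R)^-1 * wterm m (F a ^~ y) e [::] by [].
have subE (M M' : 'cV[R]_q) : (M - M') a 0 = M a 0 - M' a 0 by rewrite !mxE.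
rewrite /lip_rem subE summxE tunit_tlist wjet_tlist//=; congr (_ - _).
apply: eq_bigr => m _; rewrite tprod_tlist//= -mterm_nseq.
rewrite -(wjet_tlist F y (k := (0 + m)%N)) ?size_nseq//.
have wl := wjet_linear F (k := (0 + m)%N) y.
have w0 : wjet F y (0 : tens R p (0 + m)) = 0.
  by have := wl (-1) 0 0; rewrite scaler0 addr0 scaleN1r addNr.
by have := wl (m`!%:R)^-1 (tlist (0 + m) (nseq m e)) 0; rewrite w0 !addr0 =>
  ->; rewrite mxE.
Qed.

End JetsOut.

Lemma prod_norm_nseq (R : realType) p m (e : 'cV[R]_p) :
  \prod_(v <- nseq m e) `|v| = `|e| ^+ m.
Proof. by elim: m => [|m IH]; rewrite ?big_nil //= big_cons IH exprS. Qed.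

(** * Uniform estimates on an almost Lipschitz map, drawn from its jet *)

Section JetsIn.
Variables (R : realType) (eps : R) (heps : 0 < eps <= 1).
Variables (N : forall p k, tens R p k -> R) (hN : tensor_norms N).
Variables (gamma : R) (n : nat) (hgamma : gamma = n.+1%:R + eps).
Local Notation om := (om eps).
Local Notation GC := (GC eps).
Local Notation DC := (DC eps).

Lemma jet_tlist_cast p (V : Type) (f : jet R p V) x k k' vs : k = k' ->
  f k x (tlist k vs) = f k' x (tlist k' vs).
Proof. by move=> ->. Qed.

Lemma GC_of_words p m K (X : set 'cV[R]_p) F : word_family eps n K X F ->
  (forall w, (size w <= n)%N -> forall x, X x -> `|F w x| <= K) ->
  forall w, (size w + m)%N = n -> GC m K X (F w).
Proof.
move=> [Fl FL] Fb; elim: m => [|m IH] w wn.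
  split=> [x|x y]; first by apply: Fb; lia.
  by apply: FL; lia.
split=> [x|]; first by apply: Fb; lia.
exists (fun i => F (rcons w i)) => [i|]; last by apply: Fl; lia.
by apply: IH; rewrite size_rcons; lia.
Qed.

Lemma linear_scale_out p k (V : lmodType R) (u : tens R p k -> V) c t :
  linear u -> u (c *: t) = c *: u t.
Proof.
move=> ul; have u0 : u 0 = 0.
  by have := ul (-1) 0 0; rewrite scaler0 addr0 scaleN1r addNr.
by have := ul c t 0; rewrite u0 !addr0.
Qed.

Variables (p q : nat) (U : set 'cV[R]_p) (phi : 'cV[R]_p -> 'cV[R]_q).
Variables (jphi : jet R p 'cV[R]_q) (hphi : almost_lip N gamma U phi jphi).
Variables (M : R) (hM : lip_bound N (@opnorm R q p) (gamma - 1) U (djet jphi)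
  M).

Definition jac x : 'M[R]_(q, p) := djet jphi (k := 0) x (tunit R p).

Let M0 : 0 <= M := hM.1.

Lemma djet_bound k x vs : (k <= n)%N -> U x -> size vs = k ->
  opnorm (djet jphi x (tlist k vs)) <= M * \prod_(v <- vs) `|v|.
Proof.
move=> kn xU sk; have [_] := hM; rewrite (lipdeg_gamma1 heps hgamma) =>
  /(_ k kn x x xU xU).
move=> /(_ (fun l : 'I_k => nth 0 vs l)) [+ _];
  rewrite (norm_pure hN) -/(tlist k vs).
congr (_ <= _ * _); rewrite -[LHS](big_mkord xpredT (fun l => `|nth 0 vs l|)).
by rewrite [RHS](big_nth 0) sk.
Qed.

Lemma jphi_linear k x : (k <= n.+1)%N -> U x -> linear (jphi (k := k) x).
Proof.
move=> kn xU; case: hphi => d _ [_ h _ _].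
by case: (h k _ x xU) => //; rewrite (lipdeg_gamma heps hgamma).
Qed.

Lemma djphi_linear k x : (k <= n)%N -> U x -> linear (djet jphi (k := k) x).
Proof. by move=> kn xU; apply: djet_linear; apply: jphi_linear => //; lia. Qed.

(** Iterated partial derivative, along the letters of [w], of the entry [(a, j)] of the Jacobian, as
    prescribed by the jet. *)
Definition jword (a : 'I_q) (j : 'I_p) (w : seq 'I_p) (x : 'cV[R]_p) : R :=
  djet jphi x (tlist (size w) [seq delta_mx i 0 | i <- w]) a j.

Lemma djet_mterm k x vs a j : (k <= n)%N -> U x -> size vs = k ->
  djet jphi x (tlist k vs) a j = mterm vs (fun w => jword a j w x) [::].
Proof.
move=> kn xU sk; have dl := djphi_linear kn xU.
have ul : linear (fun t : tens R p k => djet jphi x t a j : R^o).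
  by move=> c s t; rewrite dl !mxE.
rewrite (linear_tlist ul sk); apply: mterm_ext => w; rewrite add0n sk => sw.
by rewrite /jword (jet_tlist_cast (djet jphi) x _ sw).
Qed.

Lemma prod_delta (w : seq 'I_p) :
  \prod_(v <- [seq delta_mx i 0 : 'cV[R]_p | i <- w]) `|v| = 1.
Proof. by rewrite big_map big1 // => i _; exact: norm_delta. Qed.

Lemma jword_bound a j w x : (size w <= n)%N -> U x -> `|jword a j w x| <= M.
Proof.
move=> sw xU; rewrite (le_trans (opnorm_entry _ _ _))//.
by rewrite (le_trans (djet_bound sw xU _)) ?size_map// prod_delta mulr1.
Qed.

Lemma mxB_entry a j (A B : 'M[R]_(q, p)) : (A - B) a j = A a j - B a j.
Proof. by rewrite !mxE. Qed.

Lemma mxZ_entry a j c (A : 'M[R]_(q, p)) : (c *: A) a j = c * A a j.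
Proof. by rewrite !mxE. Qed.

Lemma jword_rem a j w x y : (size w <= n)%N -> U x -> U y ->
  `|jword a j w x - \sum_(m < (n - size w).+1) (m`!%:R)^-1 *
     mterm (nseq m (x - y)) (fun w => jword a j w y) w|
  <= M * (`|x - y| ^+ (n - size w) * om `|x - y|).
Proof.
move=> sw xU yU; have [_] := hM; rewrite (lipdeg_gamma1 heps hgamma).
move=> /(_ _ sw x y xU yU) /(_ (fun l =>
  nth 0 [seq delta_mx i 0 | i <- w] l)) [_].
rewrite (norm_pure hN) -/(tlist (size w) _) (powR_gamma1 heps hgamma)// => h.
have pr1 : \prod_(l < size w) `|[seq delta_mx i 0 : 'cV[R]_p | i <- w]`_l| = 1.
  by have := prod_delta w; rewrite (big_nth 0) size_map big_mkord.
rewrite pr1 mulr1 in h; apply: le_trans h; apply: le_trans (opnorm_entry _ a j).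
rewrite le_eqVlt; apply/orP; left; apply/eqP; congr `|_|.
rewrite /lip_rem mxB_entry summxE -subSn//; congr (_ - _).
apply: eq_bigr => m _; have mn : (size w + m <= n)%N by have := ltn_ord m; lia.
rewrite linear_scale_out; last exact: djphi_linear.
rewrite mxZ_entry tprod_tlist ?size_map//
  djet_mterm ?size_cat ?size_map ?size_nseq//.
by rewrite mterm_cat mterm_delta.
Qed.

(** The first-order remainder is the full Lipschitz remainder plus the Taylor terms of order at
    least 2. Each of these is [O(|e|^2)], hence at most [M * (|e| * om |e|)]; there are at most [n]
    of them, whence the factor [n.+1]. *)
Lemma jac_GC (B : set 'cV[R]_p) : B `<=` U -> small B ->
  forall a j, GC n (n.+1%:R * M) B (fun x => jac x a j).
Proof.
move=> BU sB a j.
have MM : M <= n.+1%:R * M by rewrite ler_peMl// ler1n.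
have jE : (fun x => jac x a j) = jword a j [::].
  by apply/funext => x; rewrite /jac tunit_tlist.
rewrite jE; apply: (@GC_of_words _ _ _ _ (jword a j)) => //; last first.
  by move=> w sw x /BU xU; rewrite (le_trans (jword_bound _ _ sw xU)).
split=> [w sw x y xB yB|w sw x y xB yB]; have [xU yU] := (BU x xB, BU y yB).
  set e := x - y; have e1 : `|e| <= 1 by exact: sB.
  have ele : `|e| <= om `|e| by apply: le_om.
  have om0 : 0 <= om `|e| by exact: om_ge0.
  have := jword_rem a j (ltnW sw) xU yU; rewrite -/e -subnSK//.
  pose S := \sum_(m < n - (size w).+1) (m.+2`!%:R)^-1 *
    mterm (nseq m.+2 e) (jword a j ^~ y) w.
  rewrite (_ : \sum_(m < _) _ =
    jword a j w y + (\sum_i e i 0 * jword a j (rcons w i) y + S)); last first.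
    by rewrite big_ord_recl big_ord_recl !fact0 invr1 !mul1r.
  move=> h.
  have Sb : `|S| <= (n - (size w).+1)%:R * (M * (`|e| * om `|e|)).
    rewrite /S; apply: ler_norm_sum_ord => m.
    have mn : (size w + m.+2 <= n)%N by have := ltn_ord m; lia.
    rewrite normrM -[leRHS]mul1r; apply: ler_pM => //.
      rewrite ger0_norm ?invr_ge0// invf_le1 ?ltr0n ?fact_gt0//
        ler1n fact_gt0//.
    have -> : mterm (nseq m.+2 e) (jword a j ^~ y) w =
        djet jphi y (tlist (size w + m.+2) ([seq delta_mx i 0 | i <- w] ++ nseq
          m.+2 e)) a j.
      by rewrite djet_mterm ?size_cat ?size_map ?size_nseq//
        mterm_cat mterm_delta.
    rewrite (le_trans (opnorm_entry _ _ _))//.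
    rewrite (le_trans (djet_bound mn yU _)) ?size_cat ?size_map ?size_nseq//.
    rewrite big_cat prod_delta prod_norm_nseq /= mul1r ler_wpM2l// exprS.
    rewrite ler_wpM2l// (le_trans _ ele)// exprS ler_piMr// exprn_ile1//.
  have fE : fo_rem (jword a j w) (fun i => jword a j (rcons w i)) x y =
      jword a j w x - (jword a j w y + (\sum_i e i 0 * jword a j (rcons w i) y
        + S)) + S.
    rewrite /fo_rem -/e; under eq_bigr do rewrite mulrC.
    by ring.
  rewrite fE (le_trans (ler_normD _ _))//.
  have h' := le_trans h (_ : _ <= M * (`|e| * om `|e|)).
  have hp : `|e| ^+ (n - (size w).+1).+1 * om `|e| <= `|e| * om `|e|.
    by rewrite ler_wpM2r// exprS ler_piMr// exprn_ile1.
  have {}h' := h' (ler_wpM2l M0 hp).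
  have t0 : 0 <= M * (`|e| * om `|e|) by rewrite !mulr_ge0.
  have nb : (n - (size w).+1)%:R * (M * (`|e| * om `|e|)) <= n%:R * (M * (`|e|
    * om `|e|)).
    by rewrite ler_wpM2r// ler_nat leq_subr.
  rewrite -mulrA -[n.+1%:R]natr1 mulrDl mul1r; lra.
have := jword_rem a j (eq_leq sw) xU yU; rewrite sw subnn big_ord_recl big_ord0.
rewrite fact0 invr1 mul1r addr0 expr0 mul1r /= => /le_trans; apply.
by rewrite ler_wpM2r// om_ge0.
Qed.

Lemma jac_opnorm x : U x -> opnorm (jac x) <= M.
Proof.
move=> xU; have := @djet_bound 0 x [::] (leq0n _) xU (erefl _).
by rewrite big_nil mulr1 /jac tunit_tlist.
Qed.

(** [C] and [d] depend on [phi] itself. They never reach the final constants: this only gives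
    differentiability and feeds [mean_ineq]. *)
Lemma phi_local_rem : exists C d : R, [/\ 0 <= C, 0 < d & forall x y, U x ->
  U y ->
  `|x - y| < d ->
  `|phi x - phi y - jac y *m (x - y)| <= C * (`|x - y| * om `|x - y|)].
Proof.
case: hphi => dl dl0 [h0 _ _ [C C0 hC]].
have [d d0 ddl] : exists2 d : R, 0 < d & (d%:E <= dl)%E.
  move: dl dl0 {hC} => [r|//|//] r0; first by exists r; rewrite ?lee_fin.
  by exists 1; rewrite ?leey.
exists (C + n.+1%:R * (p%:R * M)), (Num.min d 1); split.
- by rewrite addr_ge0 ?mulr_ge0.
- by rewrite lt_min d0 ltr01.
move=> x y xU yU; rewrite lt_min => /andP[xyd xy1]; set e := x - y in xyd xy1 *.
have e1 := ltW xy1.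
have ele : `|e| <= om `|e| by apply: le_om.
have om0 : 0 <= om `|e| by exact: om_ge0.
apply: cV_norm_le => [|a]; first by rewrite !mulr_ge0 ?addr_ge0 ?mulr_ge0.
have := hC x y xU yU; rewrite -/e (lipdeg_gamma heps hgamma) => h.
have {}h : `|lip_rem n.+1 jphi x y (tunit R p) a 0| <= C * (`|e| * om `|e|).
  rewrite (le_trans (coord_le _ _))// (le_trans (h _))//.
    by rewrite (lt_le_trans _ ddl)// lte_fin.
  rewrite hgamma (powR_om heps)// ler_wpM2l// ler_wpM2r// exprS ler_piMr//.
  by rewrite exprn_ile1.
(* The Taylor terms of [phi] of positive order are expressed through [djet] by splitting off one
   factor [e], so that the bound [M] applies to them. *)
have term m : (m <= n)%N ->
    jphi (k := (0 + m.+1)%N) y ((m.+1`!%:R)^-1 *: tprod (tunit R p) (tpow e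
      m.+1)) a 0 =
    (m.+1`!%:R)^-1 * \sum_j e j 0 * djet jphi y (tlist m (nseq m e)) a j.
  move=> mn; rewrite linear_scale_out; last by apply: jphi_linear.
  rewrite mxE; congr (_ * _); rewrite tunit_tlist tprod_tlist//=.
  have jl : linear (fun t : tens R p (m + 1) => jphi y t a 0 : R^o).
    have m1 : (m + 1 <= n.+1)%N by rewrite addn1.
    have jpl := jphi_linear m1 yU.
    by move=> c s t; rewrite jpl !mxE.
  have -> : jphi y (tlist (0 + m.+1) (e :: nseq m e)) =
      jphi y (tlist (m + 1) (nseq m e ++ [:: e])).
    by rewrite -[nseq m e ++ [:: e]]/(nseq m e ++ nseq 1 e) -nseqD addn1.
  have ms : size (nseq m e ++ [:: e]) = (m + 1)%N by rewrite size_cat size_nseq.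
  have dE j : djet jphi y (tlist m (nseq m e)) a j =
     mterm (nseq m e ++ [:: delta_mx j 0]) (fun w => jphi y
       (tlist (m + 1) [seq delta_mx i 0 | i <- w]) a 0) [::].
    by rewrite djet_tlist ?size_nseq// -cats1 (linear_tlist jl)//
      size_cat size_nseq.
  rewrite (linear_tlist jl ms); under [RHS]eq_bigr do rewrite dE.
  have gen (u : 'cV[R]_p) G vs w : mterm (vs ++ [:: u]) G w =
      \sum_j u j 0 * mterm (vs ++ [:: delta_mx j 0]) G w.
    elim: vs w => [|v vs IH] w /=.
      apply: eq_bigr => j _; rewrite (bigD1 j)//= big1; last first.
        by move=> i /negPf ij; rewrite mxE ij mul0r.
      by rewrite mxE !eqxx mul1r addr0.
    under eq_bigr do rewrite IH mulr_sumr.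
    rewrite exchange_big; apply: eq_bigr => j _; rewrite mulr_sumr.
    by apply: eq_bigr => i _; rewrite mulrCA.
  exact: gen.
rewrite /lip_rem mxE [X in _ + X]mxE summxE big_ord_recl big_ord_recl in h.
pose S := \sum_(i < n) jphi (k := (0 + i.+2)%N) y ((i.+2`!%:R)^-1 *:
  tprod (tunit R p) (tpow e i.+2)) a 0.
have Sb : `|S| <= n%:R * (p%:R * M * (`|e| * om `|e|)).
  rewrite /S; apply: ler_norm_sum_ord => m.
  rewrite term ?ltn_ord// normrM -[leRHS]mul1r ler_pM//.
    by rewrite ger0_norm ?invr_ge0// invf_le1 ?ltr0n ?fact_gt0// ler1n fact_gt0.
  rewrite -!mulrA; apply: ler_norm_sum_ord => j.
  rewrite normrM mulrCA ler_pM ?coord_le//.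
  rewrite (le_trans (opnorm_entry _ _ _))//.
  rewrite (le_trans (djet_bound _ yU _)) ?size_nseq ?ltn_ord// ler_wpM2l//.
  rewrite prod_norm_nseq.
  by rewrite (le_trans _ ele)// exprS ler_piMr// exprn_ile1.
have t1 := term 0%N (leq0n _).
have t0 : jphi (k := (0 + 0)%N) y ((0`!%:R)^-1 *: tprod (tunit R p) (tpow e 0))
  a 0
    = phi y a 0.
  rewrite fact0 invr1 scale1r tunit_tlist tprod_tlist//= -(h0 y yU) tunit_tlist.
  by congr (_ a 0).
rewrite -/e -/S t0 t1 (h0 x xU) factS fact0 muln1 invr1 mul1r /= -tunit_tlist
  in h.
have jE : (jac y *m e) a 0 = \sum_j e j 0 * djet jphi y (tunit R p) a j.
  by rewrite mxE; apply: eq_bigr => j _; rewrite mulrC.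
have -> : (phi x - phi y - jac y *m e) a 0 =
   phi x a 0 - (phi y a 0 + ((jac y *m e) a 0 + S)) + S.
  by rewrite !colB; ring.
rewrite jE (le_trans (ler_normD _ _))// mulrDl lerD//.
rewrite (le_trans Sb)// mulrA ler_wpM2r ?mulr_ge0//.
by rewrite ler_wpM2r ?mulr_ge0// ler_nat.
Qed.

Lemma GC_holder m K (X : set 'cV[R]_p) f : 0 <= K -> small X -> GC m K X f ->
  forall x y, X x -> X y -> `|f x - f y| <= p.+1%:R * K * om `|x - y|.
Proof.
move=> K0 sX; case: m => [|m] [_ fD] x y xX yX.
  rewrite (le_trans (fD _ _ xX yX))// ler_wpM2r ?om_ge0// ler_peMl// ler1n//.
rewrite (le_trans (DC_lip heps K0 sX (fD : DC m K X f) xX yX))//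
  ler_wpM2l ?mulr_ge0//.
by apply: le_om => //; exact: sX.
Qed.

(** Mean value inequality for [phi] minus a linear map. Restricting to [z] no farther from [y] than
    [x] makes a Hoelder bound on the Jacobian usable with [L = jac y]. *)
Lemma phi_mean (B : set 'cV[R]_p) (L : 'M[R]_(q, p)) b x y : B `<=` U ->
  cvx B ->
  B x -> B y -> 0 <= b ->
  (forall z, B z -> `|z - y| <= `|x - y| -> opnorm (jac z - L) <= b) ->
  `|phi x - phi y - L *m (x - y)| <= b * `|x - y|.
Proof.
move=> BU cB xB yB b0 Lb; have [C [d [C0 d0 Cd]]] := phi_local_rem.
apply: cV_norm_le => [|a]; first by rewrite mulr_ge0.
set e := x - y.
pose r t := phi (y + t *: e) a 0 + (-1) * ((L *m e) a 0 * t ^+ 1).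
pose dr t := \sum_j jac (y + t *: e) a j * e j 0 + (-1) * ((L *m e) a 0 * (1%:R
  * t ^+ 0)).
have rd : der1 eps r dr.
  apply: der1D; last by apply: der1Z; apply: der1Z; exact: der1_expr.
  apply: (der1_seg heps (f := fun z => phi z a 0) (g := fun j z => jac z a j)
    (C := C) (dl := d)) => // s t sI tI z z' zz.
  have := Cd z' z (BU _ (cB _ _ _ xB yB tI)) (BU _ (cB _ _ _ xB yB sI)) zz.
  apply: le_trans; apply: le_trans (coord_le _ a).
  by rewrite /fo_rem !colB [(jac z *m _) a 0]mxE.
have -> : (phi x - phi y - L *m e) a 0 = r 1 - r 0.
  rewrite /r scale1r [y + e]addrC /e subrK scale0r addr0 expr1n expr0n /=
    !mulr1 mulr0.
  by rewrite !colB; ring.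
apply: (mean_ineq heps rd) => t tI.
have -> : dr t = ((jac (y + t *: e) - L) *m e) a 0.
  by rewrite /dr mulmxBl colB [in RHS]mxE !mulr1 mulN1r.
rewrite (le_trans (coord_le _ _))// (le_trans (opnormP _ _))// ler_wpM2r//.
apply: Lb; first exact: cB.
rewrite [X in `|X|](_ : _ = t *: e); last by rewrite addrC addKr.
by case/andP: tI => t0 t1; rewrite normrZ ger0_norm// ler_piMl.
Qed.

(** Read from the right: class constant of the Jacobian entries ([jac_GC]), passage to a Hoelder
    bound ([GC_holder]), passage from entries to the operator norm. *)
Definition remK : R := p%:R * (p.+1%:R * (n.+1%:R * M)).

Lemma jac_holder (B : set 'cV[R]_p) : B `<=` U -> small B ->
  forall x y, B x -> B y -> opnorm (jac x - jac y) <= remK * om `|x - y|.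
Proof.
move=> BU sB x y xB yB; rewrite /remK -mulrA; apply: opnorm_le_entries =>
  [|a j].
  by rewrite !mulr_ge0 ?om_ge0.
rewrite mxB_entry; apply: (GC_holder _ sB (jac_GC BU sB a j)) => //.
by rewrite mulr_ge0.
Qed.

Lemma phi_rem (B : set 'cV[R]_p) : B `<=` U -> cvx B -> small B ->
  forall x y, B x -> B y ->
  `|phi x - phi y - jac y *m (x - y)| <= remK * (`|x - y| * om `|x - y|).
Proof.
move=> BU cB sB x y xB yB; rewrite mulrCA mulrC.
apply: (phi_mean BU cB) => //; first by rewrite !mulr_ge0 ?om_ge0.
move=> z zB zy; apply: (le_trans (jac_holder BU sB zB yB)).
by apply: ler_wpM2l; [rewrite !mulr_ge0|exact: om_le].
Qed.

Lemma remK_ge0 : 0 <= remK. Proof. by rewrite !mulr_ge0. Qed.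

Lemma phi_DC (B : set 'cV[R]_p) : B `<=` U -> cvx B -> small B ->
  forall a, DC n (n.+1%:R * M + remK) B (fun x => phi x a 0).
Proof.
move=> BU cB sB a; exists (fun j x => jac x a j) => [j|x y xB yB].
  apply: GC_le (jac_GC BU sB a j) => //; by rewrite lerDl remK_ge0.
apply: (@le_trans _ _ (remK * (`|x - y| * om `|x - y|))); last first.
  by rewrite ler_wpM2r ?mulr_ge0 ?om_ge0// lerDr mulr_ge0.
apply: le_trans (phi_rem BU cB sB xB yB); apply: le_trans (coord_le _ a).
by rewrite /fo_rem !colB [(jac y *m _) a 0]mxE.
Qed.

(** Stated for general spaces because it serves both for [phi] and for its scalar components, whose
    directional derivatives form [partial_mx]. *)
Lemma diff_of_rem (V W : normedModType R) (f : V -> W) (df : {linear V ->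
  W}) (A : R) x :
  (forall v, `|df v| <= A * `|v|) ->
  (forall e, 0 < e -> exists2 d, 0 < d & forall h, `|h| < d ->
    `|f (x + h) - f x - df h| <= e * `|h|) ->
  differentiable f x /\ 'd f x = df :> (V -> W).
Proof.
move=> dfA hf.
have dfc : continuous df.
  apply: bounded_linear_continuous; apply/bounded_funP => r.
  exists (`|A| * r) => v vr; rewrite (le_trans (dfA v))//.
  rewrite (@le_trans _ _ (`|A| * `|v|)) ?ler_wpM2r ?ler_norm//.
  by rewrite ler_wpM2l.
have fo : f \o shift x = cst (f x) + df +o_ 0 id.
  apply/eqaddoP => e e0; have [d d0 hd] := hf e e0.
  apply/nbhs_ballP; exists d => // h;
    rewrite -ball_normE /ball_/= sub0r normrN => hdd.
  by have := hd h hdd; rewrite [x + h]addrC opprD addrA.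
have dE := diff_unique dfc fo.
split=> //; apply/diff_locallyP; rewrite dE; split=> //.
Qed.

Lemma phi_near_rem x : U x -> open U -> forall e, 0 < e -> exists2 d, 0 < d &
  forall h, `|h| < d -> `|phi (x + h) - phi x - jac x *m h| <= e * `|h|.
Proof.
move=> xU oU e e0; have [C [d [C0 d0 Cd]]] := phi_local_rem.
have [d1 d10 d1U] := open_ballP oU xU.
have C1 : 0 < C + 1 by rewrite ltr_wpDl.
have [d2 d20 oms] := om_small heps (divr_gt0 e0 C1).
exists (Num.min d (Num.min d1 d2)); first by rewrite !lt_min d0 d10.
move=> h; rewrite !lt_min => /andP[hd /andP[hd1 hd2]].
have xh : x + h - x = h by rewrite addrC addKr.
have := Cd (x + h) x (d1U h hd1) xU; rewrite xh => /(_ hd) /le_trans; apply.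
rewrite mulrCA mulrC ler_wpM2r//.
have := oms _ (normr_ge0 h) hd2; rewrite ltr_pdivlMr// => h2.
have := om_ge0 eps `|h|; lra.
Qed.

Lemma phi_diff x : U x -> open U ->
  differentiable phi x /\ 'd phi x = mulmx (jac x) :> ('cV[R]_p -> 'cV[R]_q).
Proof.
move=> xU oU; apply: (diff_of_rem (df := mulmx (jac x)) (A := opnorm (jac x))).
  by move=> v; exact: opnormP.
exact: phi_near_rem.
Qed.

Lemma diff_mxE x : U x -> open U -> diff_mx phi x = jac x.
Proof.
move=> xU oU; have [_ dE] := phi_diff xU oU.
by apply/matrixP => a j; rewrite mxE dE -colE mxE.
Qed.

Lemma partial_mxE k (i : 'I_k -> 'I_q) (j : 'I_k -> 'I_p) x : U x -> open U ->
  partial_mx phi i j x = \matrix_(r, l) jac x (i r) (j l).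
Proof.
move=> xU oU; apply/matrixP => r l; rewrite [LHS]mxE [RHS]mxE.
pose u (v : 'cV[R]_p) : R^o := (jac x *m v) (i r) 0.
have ul : linear u by move=> c v w; rewrite /u mulmxDr -scalemxAr !mxE.
pose U' : {linear 'cV[R]_p -> R^o} :=
  HB.pack u (GRing.isLinear.Build _ _ _ _ u ul).
have [|e e0|df dE] := @diff_of_rem _ _ (fun y =>
  phi y (i r) 0 : R^o) U' (opnorm (jac x)) x.
- by move=> v; rewrite (le_trans (coord_le _ _))// opnormP.
- have [d d0 hd] := phi_near_rem xU oU e0; exists d => // h /hd;
  apply: le_trans.
  apply: le_trans (coord_le _ (i r)).
  by rewrite !colB.
by rewrite deriveE// dE /U'/= /u -colE [LHS]mxE.
Qed.

End JetsIn.

(** * Straightening charts *)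

Section Geometry.
Variable R : realType.

Lemma ball_normP p (x : 'cV[R]_p) r y : ball x r y <-> `|x - y| < r.
Proof. by rewrite -ball_normE. Qed.

Lemma open_criterion p (X : set 'cV[R]_p) :
  (forall y, X y -> exists2 d, 0 < d & forall v, `|v| < d -> X (y + v)) ->
    open X.
Proof.
move=> h; rewrite openE => y /h[d d0 dX]; apply/nbhs_ballP; exists d => // z.
by move=> /ball_normP yz; rewrite -(subrK y z) addrC; apply: dX; rewrite distrC.
Qed.

Lemma cvx_ball p (x : 'cV[R]_p) r : cvx (ball x r).
Proof.
move=> y z t /ball_normP yr /ball_normP zr /andP[t0 t1]; apply/ball_normP.
have -> : x - (z + t *: (y - z)) = (1 - t) *: (x - z) + t *: (x - y).
  by apply/colP => i; rewrite !mxE; ring.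
rewrite (le_lt_trans (ler_normD _ _))// !normrZ !ger0_norm ?subr_ge0//.
have [->|tn] := eqVneq t 0; first by rewrite subr0 mul1r mul0r addr0.
have tp : 0 < t by rewrite lt_def tn.
have : t * `|x - y| < t * r by rewrite ltr_pM2l.
have : (1 - t) * `|x - z| <= (1 - t) * r by rewrite ler_wpM2l ?subr_ge0// ltW.
lra.
Qed.

Lemma small_ball p (x : 'cV[R]_p) r : 2 * r <= 1 -> small (ball x r).
Proof.
move=> r1 y z /ball_normP yr /ball_normP zr.
have -> : y - z = (x - z) - (x - y) by apply/colP => i; rewrite !mxE; ring.
by rewrite (le_trans (ler_normB _ _))//; lra.
Qed.

(* Newton iteration with the frozen derivative [L]. *)
Lemma surj_ball p (f : 'cV[R]_p -> 'cV[R]_p) (L : 'M[R]_p) A x0 r u :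
  0 < A -> 0 < r -> inj_bound A L ->
  (forall x y, `|x - x0| <= r -> `|y - x0| <= r ->
     `|f x - f y - L *m (x - y)| <= (4 * A)^-1 * `|x - y|) ->
  `|u - f x0| <= 3 / 4 * r / A -> exists2 x, `|x - x0| <= r & f x = u.
Proof.
move=> A0 r0 LA fL ur; have uL := inj_bound_unit LA.
(* [T] contracts by [A * (4 * A)^-1 = 1/4] and moves the centre by at most [3/4 * r], so it
   preserves the closed ball of radius [r]. *)
pose T x := x - invmx L *m (f x - u).
pose X : set 'cV[R]_p := [set x | `|x - x0| <= r].
have Tlip x y : X x -> X y -> `|T x - T y| <= 4^-1 * `|x - y|.
  move=> xX yX; have -> : T x - T y = - (invmx L *m (f x - f y - L *m (x - y))).
    rewrite mulmxBr mulKmx// /T !mulmxBr.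
    by apply/colP => i; rewrite !colB [in RHS]mxE !colB; ring.
  rewrite normrN (le_trans (inj_bound_inv LA _))//.
  rewrite (le_trans (ler_wpM2l (ltW A0) (fL _ _ xX yX)))// mulrA invfM mulrCA.
  by rewrite divff ?gt_eqF// mulr1.
have x0X : X x0 by rewrite /X /= subrr normr0 ltW.
have Tx0 : `|T x0 - x0| <= 3 / 4 * r.
  rewrite /T addrAC subrr sub0r normrN (le_trans (inj_bound_inv LA _))//.
  by rewrite distrC -ler_pdivlMl// mulrC.
have TX : set_fun X X T.
  move=> x xX; rewrite /X /=; have -> : T x - x0 = (T x - T x0) + (T x0 - x0).
    by rewrite addrA subrK.
  rewrite (le_trans (ler_normD _ _))//; have := Tlip x x0 xX x0X; move: xX Tx0.
  by rewrite /X /=; lra.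
have cX : closed X.
  rewrite (_ : X = closed_ball_ Num.norm x0 r);
    first exact: closed_closed_ball_.
  by apply/seteqP; split=> x; rewrite /X /closed_ball_/= distrC.
pose TF : {fun X >-> X} := HB.pack T (isFun.Build _ _ _ _ T TX).
pose CX : completeNormedModType R := HB.pack 'cV[R]_p
  (NormedModule.class 'cV[R]_p) (Complete.class 'cV[R]_p).
have [|||x xX xT] := @banach_fixed_point R CX X TF; last 1 first.
- exists x => //; have : invmx L *m (f x - u) = 0.
    by move: xT; rewrite /TF /= /T => /eqP;
      rewrite -subr_eq0 opprB addrCA subrr addr0 => /eqP.
  move=> /(congr1 (mulmx L)); rewrite mulKVmx// mulmx0 => /eqP.
  by rewrite subr_eq0 => /eqP.
- have q4 : 0 <= (4^-1 : R) by [].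
  exists (NngNum q4); split; first by rewrite /=; lra.
  by move=> [x y] [/= xX yX]; exact: Tlip.
- exact: cX.
- by exists x0.
Qed.

(** The selected indices followed by all the others enumerate ['I_m.+1]; the permutation reads off
    this list. *)
Lemma extend_perm k m (i : 'I_k -> 'I_m.+1) : injective i ->
  exists s : {perm 'I_m.+1}, forall r : 'I_k, s (inord r) = i r.
Proof.
move=> ii; pose t := codom i ++ [seq x <- enum 'I_m.+1 | x \notin codom i].
have ut : uniq t.
  rewrite cat_uniq filter_uniq ?enum_uniq ?andbT// map_inj_uniq ?enum_uniq//=.
  by apply/hasPn => x; rewrite mem_filter => /andP[].
have mt x : x \in t.
  rewrite mem_cat mem_filter mem_enum andbT; exact: orbN.
have st : size t = m.+1.
  rewrite -[RHS](size_enum_ord m.+1); apply: perm_size; apply: uniq_perm => //.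
    exact: enum_uniq.
  by move=> x; rewrite mt mem_enum.
pose f (l : 'I_m.+1) := nth ord0 t l.
have fi : injective f.
  by move=> a b /eqP; rewrite /f nth_uniq ?st// => /eqP /val_inj.
exists (perm fi) => r; rewrite permE /f.
have km : (k <= m.+1)%N by have := max_card (mem (codom i));
  rewrite card_codom// !card_ord.
rewrite inordK; last by rewrite (leq_trans (ltn_ord r)).
rewrite nth_cat size_codom card_ord ltn_ord (nth_map r) ?size_enum_ord//.
by rewrite nth_ord_enum.
Qed.

(** The first [k] rows of [E] have rank [k] and lie in the row space of [D], of dimension at most
    [k]. They span it, so [D] factors through them. *)
Lemma row_space_kill p q k (D : 'M[R]_(q, p)) (E : 'M[R]_p) (w : 'cV[R]_p) :
  (k <= p)%N -> (\rank D <= k)%N -> E \in unitmx ->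
  ((pid_mx k : 'M[R]_(k, p)) *m E <= D)%MS ->
  (pid_mx k : 'M[R]_(k, p)) *m (E *m w) = 0 -> D *m w = 0.
Proof.
move=> kp rD uE sub Ew.
have rk : \rank ((pid_mx k : 'M[R]_(k, p)) *m E) = k.
  by rewrite mxrankMfree ?row_free_unit// rank_pid_mx.
have /submxP[C ->] : (D <= (pid_mx k : 'M[R]_(k, p)) *m E)%MS.
  have /mxrank_leqif_sup[_ <-] := sub.
  by rewrite rk eqn_leq rD andbT -{1}rk mxrankS.
by rewrite -mulmxA -(mulmxA _ E) Ew mulmx0.
Qed.

End Geometry.

(** * The two charts around a point *)

Section Straight.
Variables (R : realType) (eps : R) (heps : 0 < eps <= 1).
Local Notation om := (om eps).
Local Notation GC := (GC eps).
Local Notation DC := (DC eps).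
Variables (p q k n : nat) (K M A : R).
Hypotheses (K0 : 0 <= K) (M0 : 0 < M) (A0 : 0 < A).
Hypotheses (kp : (k <= p.+1)%N) (kq : (k <= q.+1)%N).
Variables (phi : 'cV[R]_p.+1 -> 'cV[R]_q.+1) (D : 'cV[R]_p.+1 -> 'M[R]_(q.+1,
  p.+1)).
Variables (x0 : 'cV[R]_p.+1) (al r0 : R).
Variables (sg : {perm 'I_q.+1}) (ta : {perm 'I_p.+1}).
Let B : set 'cV[R]_p.+1 := ball x0 al.
(** The Newton iteration on the closed ball of radius [3/4 * al] reaches every target within
    [9/16 * al / A] of the image of the centre, which covers [rho]. *)
Let rho := al / (2 * A).
Hypotheses (al0 : 0 < al) (al1 : 2 * al <= 1) (rho1 : 2 * rho <= 1).
(** [1 + 2 * A * M] bounds the growth of [gmap] away from [phi x0]; the image of the ball of radius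
    [rho] then stays within 1/2 of its centre, hence in a set of diameter at most 1. *)
Hypothesis (rho2 : (1 + 2 * A * M) * rho < 2^-1).
Hypothesis phi_DC : forall a, DC n K B (fun x => phi x a 0).
Hypothesis D_GC : forall a j, GC n K B (fun x => D x a j).
Hypothesis phi_rem : forall x y, B x -> B y ->
  `|phi x - phi y - D y *m (x - y)| <= K * (`|x - y| * om `|x - y|).
Hypothesis D_bound : forall x, B x -> opnorm (D x) <= M.
Hypothesis D_close : forall x, B x -> opnorm (D x - D x0) <= (4 * A)^-1.
Hypothesis phi_close : forall x y, B x -> B y ->
  `|phi x - phi y - D x0 *m (x - y)| <= (4 * A)^-1 * `|x - y|.
Hypothesis phi_lip : forall x y, B x -> B y -> `|phi x - phi y| <= M * `|x - y|.
Hypothesis D_rank : forall x, B x -> (\rank (D x) <= k)%N.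

(* [sg] and [ta] move the selected rows and columns to the first [k] positions;
   [inord l] stands for [l] itself, and is only used when [l < k <= q.+1]. *)
Definition chart (x : 'cV[R]_p.+1) : 'cV[R]_p.+1 :=
  \col_l if (l < k)%N then phi x (sg (inord l)) 0 else x (ta l) 0.

Definition chart_mx (x : 'cV[R]_p.+1) : 'M[R]_p.+1 :=
  \matrix_(l, m) if (l < k)%N then D x (sg (inord l)) m else (m == ta l)%:R.

Hypothesis chart0 : inj_bound A (chart_mx x0).
Hypotheses (r0al : r0 <= al) (Mr0 : M * r0 <= rho).
(** The coordinates of [x] kept by the chart must move by less than [rho]. For [k = p.+1] there are
    none, and only [M * r0 <= rho] constrains the image; this leaves room for the prescribed radius
    of the full-rank case. *)
Hypothesis kr0 : k = p.+1 \/ r0 <= rho.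

Lemma Bx0 : B x0. Proof. exact: ballxx. Qed.

Lemma rho0 : 0 < rho. Proof. by rewrite divr_gt0// mulr_gt0. Qed.

Lemma chart_mx_mul x (z : 'cV[R]_p.+1) l : (chart_mx x *m z) l 0 =
  if (l < k)%N then (D x *m z) (sg (inord l)) 0 else z (ta l) 0.
Proof.
rewrite [LHS]mxE; case: ifP => lk.
  by rewrite mxE; apply: eq_bigr => m _; rewrite mxE lk.
rewrite (bigD1 (ta l))//= big1 => [|m /negPf ml];
  first by rewrite mxE lk eqxx mul1r addr0.
by rewrite mxE lk ml mul0r.
Qed.

Lemma chart_rem L x y b : 0 <= b -> `|phi x - phi y - D L *m (x - y)| <= b ->
  `|chart x - chart y - chart_mx L *m (x - y)| <= b.
Proof.
move=> b0 h; apply: cV_norm_le => // l;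
  rewrite 2!colB chart_mx_mul [chart x _ _]mxE [chart y _ _]mxE.
case: ifP => lk; last by rewrite colB subrr normr0.
by apply: le_trans h; apply: le_trans (coord_le _ (sg (inord l)));
  rewrite !colB.
Qed.

Lemma inv4A : A * (4 * A)^-1 = 4^-1.
Proof. by rewrite invfM mulrCA divff ?gt_eqF// mulr1. Qed.

Lemma chart_mx_close x (z : 'cV[R]_p.+1) : B x ->
  `|chart_mx x *m z - chart_mx x0 *m z| <= (4 * A)^-1 * `|z|.
Proof.
move=> xB; have A40 : 0 <= (4 * A)^-1 by rewrite invr_ge0 mulr_ge0// ltW.
apply: cV_norm_le => [|l]; first by rewrite mulr_ge0.
rewrite colB !chart_mx_mul; case: ifP => lk;
  last by rewrite subrr normr0 mulr_ge0.
rewrite -colB -mulmxBl (le_trans (coord_le _ _))// (le_trans (opnormP _ _))//.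
by rewrite ler_wpM2r// D_close.
Qed.

(** A perturbation of size [(4 * A)^-1] degrades the bound from [A] to [4/3 * A], rounded up to
    [2 * A]. *)
Lemma chart_mx_inj x : B x -> inj_bound (2 * A) (chart_mx x).
Proof.
move=> xB z; have := chart0 z; have := chart_mx_close z xB => h1 h2.
have : `|chart_mx x0 *m z| <= `|chart_mx x *m z| + (4 * A)^-1 * `|z|.
  rewrite -[X in `|X| <= _](subrK (chart_mx x *m z)) addrC.
  by rewrite (le_trans (ler_normD _ _))// lerD2l distrC.
move/(ler_wpM2l (ltW A0)); rewrite mulrDr mulrA inv4A.
have : 0 <= `|z| by []; lra.
Qed.

Lemma chart_inj x y : B x -> B y -> `|x - y| <= 2 * A * `|chart x - chart y|.
Proof.
move=> xB yB; have A40 : 0 <= (4 * A)^-1 by rewrite invr_ge0 mulr_ge0// ltW.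
have h1 := chart_rem (mulr_ge0 A40 (normr_ge0 _)) (phi_close xB yB).
have := chart0 (x - y); set d := `|x - y| in h1 *.
have : `|chart_mx x0 *m (x - y)| <= `|chart x - chart y| + (4 * A)^-1 * d.
  rewrite -[X in `|X| <= _](subrK (chart x - chart y)) addrC.
  by rewrite (le_trans (ler_normD _ _))// lerD2l distrC.
move/(ler_wpM2l (ltW A0)); rewrite mulrDr mulrA inv4A.
have : 0 <= d by exact: normr_ge0.
lra.
Qed.

Lemma chart_set_inj x y : B x -> B y -> chart x = chart y -> x = y.
Proof.
move=> xB yB xy; apply/eqP; rewrite -subr_eq0 -normr_le0.
by rewrite (le_trans (chart_inj xB yB))// xy subrr normr0 mulr0.
Qed.

Let c := chart x0.
Let V : set 'cV[R]_p.+1 := ball c rho.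

Lemma chart_surj u : V u -> exists x, B x /\ chart x = u.
Proof.
move=> /ball_normP uV; pose r := 3 / 4 * al.
have r_gt0 : 0 < r by rewrite mulr_gt0// divr_gt0.
have rB x : `|x - x0| <= r -> B x.
  move=> xr; apply/ball_normP; rewrite distrC (le_lt_trans xr)// /r;
    move: al0; lra.
have [||x xr xu] := @surj_ball _ _ chart (chart_mx x0) A x0 r u A0 r_gt0 chart0.
- move=> x y /rB xB /rB yB; apply: chart_rem; last exact: phi_close.
  by rewrite mulr_ge0// invr_ge0 mulr_ge0// ltW.
- rewrite distrC (le_trans (ltW uV))//
  /rho invfM mulrA ler_wpM2r ?invr_ge0 ?(ltW A0)//.
  by rewrite /r; move: al0; lra.
by exists x; split => //; exact: rB.
Qed.

(** On [V] the preimage exists and is unique in [B]; values of [get] elsewhere are immaterial. *)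
Definition hinv (u : 'cV[R]_p.+1) : 'cV[R]_p.+1 :=
  get [set x | B x /\ chart x = u].

Lemma hinvP u : V u -> B (hinv u) /\ chart (hinv u) = u.
Proof. by move=> /chart_surj[x xP];
  exact: (@getI _ [set x | B x /\ chart x = u] x). Qed.

Lemma hinvK x : B x -> V (chart x) -> hinv (chart x) = x.
Proof. by move=> xB /hinvP[hB hx]; exact: chart_set_inj. Qed.

Lemma hinv_lip u v : V u -> V v -> `|hinv u - hinv v| <= 2 * A * `|u - v|.
Proof.
move=> /hinvP[uB uE] /hinvP[vB vE].
by rewrite (le_trans (chart_inj uB vB))// uE vE.
Qed.

Let U0 : set 'cV[R]_p.+1 := ball x0 r0.

Lemma U0B : U0 `<=` B. Proof. exact: le_ball. Qed.

Lemma chart_U0 x : U0 x -> V (chart x).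
Proof.
move=> xU; have xB := U0B xU; move: xU => /ball_normP xr.
have d0 : 0 <= `|x0 - x| by exact: normr_ge0.
(* The first entry of the maximum controls the components taken from [phi], the second the retained
   coordinates, absent when [k = p.+1]. *)
apply/ball_normP; pose b := Num.max (M * `|x0 - x|) (if k == p.+1 then 0 else
  `|x0 - x|).
have Mx : M * `|x0 - x| < rho by rewrite (lt_le_trans _ Mr0)// ltr_pM2l.
have b0 : b < rho.
  rewrite gt_max Mx /=; case: eqP => [_|kn]; first exact: rho0.
  by case: kr0 => // h; rewrite (lt_le_trans xr).
apply: le_lt_trans b0; apply: cV_norm_le => [|l].
  by rewrite le_max mulr_ge0// ltW.
rewrite colB !mxE le_max; case: ifP => lk.
  apply/orP; left; rewrite (le_trans _ (phi_lip Bx0 xB))//.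
  by apply: le_trans (coord_le _ (sg (inord l))); rewrite colB.
apply/orP; right; case: eqP => [kE|_]; first by rewrite kE ltn_ord in lk.
by apply: le_trans (coord_le _ (ta l)); rewrite colB.
Qed.

Let W : set 'cV[R]_q.+1 := ball (phi x0) rho.

Lemma phi_U0 x : U0 x -> W (phi x).
Proof.
move=> xU; have xB := U0B xU; move: xU => /ball_normP xr; apply/ball_normP.
by rewrite (le_lt_trans (phi_lip Bx0 xB))// (lt_le_trans _ Mr0)// ltr_pM2l.
Qed.

(** The missing coordinates are filled with those of [c], so that points near the image of [phi x0]
    land in the ball [V] where [hinv] is controlled. *)
Definition iota_c (z : 'cV[R]_q.+1) : 'cV[R]_p.+1 :=
  \col_l if (l < k)%N then z (inord l) 0 else c l 0.
Definition perm_c (y : 'cV[R]_q.+1) : 'cV[R]_q.+1 := \col_r y (sg r) 0.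
(** The last components of [phi] as functions of the first [k] chart coordinates. Its first [k]
    entries vanish, so subtracting it is a triangular change of variables, undone by adding it back
    as in [gmapV]. *)
Definition corr (u : 'cV[R]_p.+1) : 'cV[R]_q.+1 :=
  \col_r if (r < k)%N then 0 else phi (hinv u) (sg r) 0.
Definition gmap y := perm_c y - corr (iota_c (perm_c y)).
Definition gmapV z : 'cV[R]_q.+1 :=
  \col_s (z + corr (iota_c z)) ((sg^-1)%g s) 0.
Definition trunc (x : 'cV[R]_p.+1) : 'cV[R]_p.+1 :=
  \col_l if (l < k)%N then x l 0 else c l 0.

Lemma iota_cE z l : iota_c z l 0 = if (l < k)%N then z (inord l) 0 else c l 0.
Proof. by rewrite mxE. Qed.

Lemma truncE x l : trunc x l 0 = if (l < k)%N then x l 0 else c l 0.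
Proof. by rewrite mxE. Qed.

Lemma iota_perm0 : iota_c (perm_c (phi x0)) = c.
Proof. by apply/colP => l; rewrite !mxE; case: ifP => lk; rewrite ?mxE ?lk. Qed.

Lemma iota_lip z z' : `|iota_c z - iota_c z'| <= `|z - z'|.
Proof.
apply: cV_norm_le => // l; rewrite colB !iota_cE.
case: ifP => lk; last by rewrite subrr normr0.
by apply: le_trans (coord_le _ (inord l)); rewrite colB.
Qed.

Lemma perm_c_lip y y' : `|perm_c y - perm_c y'| <= `|y - y'|.
Proof.
apply: cV_norm_le => // l; rewrite colB !mxE.
by apply: le_trans (coord_le _ (sg l)); rewrite colB.
Qed.

Lemma iota_W y : W y -> V (iota_c (perm_c y)).
Proof.
move=> /ball_normP yW; apply/ball_normP; rewrite -iota_perm0.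
by rewrite (le_lt_trans (iota_lip _ _))// (le_lt_trans (perm_c_lip _ _)).
Qed.

Lemma iota_gmap y : iota_c (gmap y) = iota_c (perm_c y).
Proof.
apply/colP => l; rewrite [LHS]mxE [RHS]mxE; case: ifP => // lk.
have lq : (l < q.+1)%N by rewrite (leq_trans lk).
by rewrite /gmap colB [corr _ _ _]mxE inordK// lk subr0.
Qed.

Lemma gmapK y : gmapV (gmap y) = y.
Proof.
apply/colP => s; rewrite mxE iota_gmap /gmap subrK mxE permKV.
by [].
Qed.

Lemma trunc_V x : V x -> V (trunc x).
Proof.
move=> /ball_normP xV; apply/ball_normP; apply: le_lt_trans xV.
apply: cV_norm_le => // l; rewrite colB truncE; case: ifP => lk;
  last by rewrite subrr normr0.
by apply: le_trans (coord_le _ l); rewrite colB.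
Qed.

Lemma iota_phi x : V x -> iota_c (perm_c (phi (hinv x))) = trunc x.
Proof.
move=> xV; have [_ hx] := hinvP xV; apply/colP => l; rewrite iota_cE truncE mxE.
by case: ifP => lk //; rewrite -[in RHS]hx mxE lk.
Qed.

(* Constancy of the rank: the first [k] rows of [chart_mx] span the row space of
   [D], so [D] kills the preimages of vectors whose first [k] entries vanish. *)
Lemma phi_hinv_step u v : V u -> V v -> (forall l : 'I_p.+1, (l < k)%N ->
  (u - v) l 0 = 0) ->
  `|phi (hinv u) - phi (hinv v)| <=
     (K + M * (2 * A * K)) * ((1 + 2 * A) * (1 + 2 * A)) * (`|u - v| * om `|u -
       v|).
Proof.
move=> uV vV uvk; have [uB uE] := hinvP uV; have [vB vE] := hinvP vV.
have hl := hinv_lip uV vV.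
set d := hinv u - hinv v in hl *; set E := chart_mx (hinv v).
have uE' : E \in unitmx by apply: inj_bound_unit; exact: chart_mx_inj.
have DE0 : D (hinv v) *m (invmx E *m (u - v)) = 0.
  apply: (@row_space_kill _ _ _ k (D (hinv v)) E) => //; first exact: D_rank.
    apply/row_subP => r; rewrite (_ : row r _ = row (sg (inord r)) (D (hinv
      v))).
      exact: row_sub.
    apply/rowP => j; rewrite !mxE (bigD1 (inord r))//= big1.
      have rp : (r < p.+1)%N by rewrite (leq_trans (ltn_ord r)).
      by rewrite !mxE inordK// eqxx ltn_ord mul1r addr0.
    move=> m /eqP mr; rewrite !mxE; case: eqP => [rm|]; last by rewrite mul0r.
    by exfalso; apply: mr; rewrite rm inord_val.
  rewrite mulKVmx//; apply/colP => r; rewrite !mxE big1// => m _; rewrite mxE.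
  case: eqP => [rm|]; last by rewrite mul0r.
  by rewrite uvk ?mulr0// -rm.
(* Up to the second-order vector [invmx E *m w], the displacement [d] equals [invmx E *m (u - v)],
   which [D] kills. *)
set w := chart (hinv u) - chart (hinv v) - E *m d.
have dE : d = invmx E *m (u - v) - invmx E *m w.
  by rewrite /w uE vE -[RHS]mulmxBr opprB addrCA subrr addr0 mulKmx.
have wb : `|w| <= K * (`|d| * om `|d|).
  by apply: chart_rem; [rewrite !mulr_ge0 ?om_ge0|exact: phi_rem].
have dom : `|d| * om `|d| <= (1 + 2 * A) * (1 + 2 * A) * (`|u - v| * om `|u -
  v|).
  have a1 : 1 <= 1 + 2 * A by rewrite lerDl mulr_ge0// ltW.
  have hl1 : `|d| <= (1 + 2 * A) * `|u - v|.
    by rewrite (le_trans hl)// ler_wpM2r// lerDr.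
  rewrite mulrACA ler_pM ?om_ge0// (le_trans _ (omM heps a1 _))//.
  exact: om_le.
have -> : phi (hinv u) - phi (hinv v) = (phi (hinv u) - phi (hinv v) - D (hinv
  v) *m d)
    - D (hinv v) *m (invmx E *m w).
  rewrite -addrA -opprD -mulmxDr [in X in _ = _ - X]dE subrK DE0 subr0.
  by [].
set T := (1 + 2 * A) * (1 + 2 * A) * (`|u - v| * om `|u - v|) in dom.
have b1 : `|phi (hinv u) - phi (hinv v) - D (hinv v) *m d| <= K * T.
  by apply: (le_trans (phi_rem uB vB)); exact: ler_wpM2l.
have b2 : `|D (hinv v) *m (invmx E *m w)| <= M * (2 * A * (K * T)).
  apply: (le_trans (opnormP _ _)); apply: ler_pM => //; first exact: opnorm_ge0.
    exact: D_bound.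
  apply: (le_trans (inj_bound_inv (chart_mx_inj vB) _)).
  apply: ler_wpM2l; first by rewrite mulr_ge0// ltW.
  by apply: (le_trans wb); exact: ler_wpM2l.
rewrite -[leRHS]mulrA -/T mulrDl -(mulrA M) -(mulrA (2 * A)).
exact: le_trans (ler_normB _ _) (lerD b1 b2).
Qed.

(** Along the segment from [trunc x] to [x], inside the ball [V], increments are [o] of the
    displacement by [phi_hinv_step]. The derivative is thus zero and [mean_ineq] applies with bound
    0. *)
Lemma phi_hinv_trunc x : V x -> phi (hinv x) = phi (hinv (trunc x)).
Proof.
move=> xV; have tV := trunc_V xV; apply/colP => s; apply/eqP.
rewrite -subr_eq0 -normr_le0; set e := x - trunc x.
pose C := (K + M * (2 * A * K)) * ((1 + 2 * A) * (1 + 2 * A)).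
have C0 : 0 <= C.
  have A00 := ltW A0; have M00 := ltW M0.
  by rewrite mulr_ge0 ?addr_ge0 ?mulr_ge0 ?addr_ge0 ?mulr_ge0.
have zV t : 0 <= t <= 1 -> V (trunc x + t *: e) by move=> tI; exact: cvx_ball.
have rd : der1 eps (fun t => phi (hinv (trunc x + t *: e)) s 0)
    (fun t => \sum_j 0 * e j 0).
  apply: (der1_seg heps (f := fun z => phi (hinv z) s 0) (g := fun _ _ => 0)
    (C := C) (dl := 1)) => // t t' tI tI' z z' _.
  have -> : fo_rem (fun z => phi (hinv z) s 0) (fun _ _ => 0) z' z =
      (phi (hinv z') - phi (hinv z)) s 0.
    by rewrite /fo_rem big1 ?subr0 ?colB// => j _; rewrite mul0r.
  rewrite (le_trans (coord_le _ _))// phi_hinv_step//; [exact: zV|exact: zV|].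
  have el0 (j : 'I_p.+1) : (j < k)%N -> e j 0 = 0 by move=> lk;
    rewrite /e colB truncE lk subrr.
  move=> l lk; rewrite (_ : z' - z = (t' - t) *: e);
    first by rewrite [LHS]mxE (el0 _ lk) mulr0.
  by rewrite /z /z' opprD addrACA subrr add0r -scalerBl.
have := mean_ineq heps rd (B := 0); rewrite scale1r scale0r addr0.
rewrite [trunc x + e]addrC subrK; apply => t _.
by rewrite big1 ?normr0// => j _; rewrite mul0r.
Qed.

Lemma gmap_phi x : V x -> gmap (phi (hinv x)) = (pid_mx k : 'M[R]_(q.+1,
  p.+1)) *m x.
Proof.
move=> xV; have [_ hx] := hinvP xV.
apply/colP => r; rewrite /gmap colB iota_phi// !mxE.
case: ifP => rk.
  have rp : (r < p.+1)%N by rewrite (leq_trans rk).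
  rewrite subr0 (bigD1 (inord r))//= big1 ?addr0.
    by rewrite mxE inordK// eqxx rk mul1r -[in RHS]hx mxE inordK// rk inord_val.
  move=> m /eqP mr; rewrite mxE; case: eqP => [rm|]; last by rewrite mul0r.
  by exfalso; apply: mr; rewrite rm inord_val.
rewrite -phi_hinv_trunc// subrr big1// => m _; rewrite mxE rk andbF.
by rewrite mul0r.
Qed.

Let z0 := gmap (phi x0).
(* An open convex set containing the image of [gmap]. *)
Definition Zset : set 'cV[R]_q.+1 :=
  [set z | `|z - z0| < 2^-1 /\ `|iota_c z - c| < rho].

Lemma Zset_small : small Zset.
Proof.
move=> z z' [h _] [h' _]; have -> : z - z' = (z - z0) - (z' - z0).
  by apply/colP => i; rewrite !mxE; ring.
rewrite (le_trans (ler_normB _ _))//; lra.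
Qed.

Lemma Zset_open : open Zset.
Proof.
apply: open_criterion => z [h1 h2].
pose d := Num.min (2^-1 - `|z - z0|) (rho - `|iota_c z - c|).
exists d; first by rewrite lt_min !subr_gt0 h1.
move=> v; rewrite lt_min !ltrBrDl => /andP[v1 v2]; split.
  by rewrite addrAC (le_lt_trans (ler_normD _ _)).
have -> : iota_c (z + v) - c = (iota_c z - c) + (iota_c (z + v) - iota_c z).
  by rewrite [RHS]addrC addrA subrK.
rewrite (le_lt_trans (ler_normD _ _))// (le_lt_trans _ v2)// lerD2l.
by rewrite (le_trans (iota_lip _ _))// addrC addKr.
Qed.

Lemma Zset_cvx : cvx Zset.
Proof.
have cb m (x : 'cV[R]_m) r y z t : `|y - x| < r -> `|z - x| < r ->
  0 <= t <= 1 ->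
    `|z + t *: (y - z) - x| < r.
  by rewrite ![`|_ - x|]distrC => h h' tI; apply/ball_normP;
    apply: cvx_ball => //; apply/ball_normP.
move=> y z t [y1 y2] [z1 z2] tI; split; first exact: cb.
rewrite (_ : iota_c _ = iota_c z + t *: (iota_c y - iota_c z)); first exact: cb.
have segE m (u v : 'cV[R]_m) j : (u + t *: (v - u)) j 0 = u j 0 + t * (v j 0 -
  u j 0).
  by rewrite !mxE.
apply/colP => l; rewrite segE !iota_cE segE; case: ifP => lk //.
by rewrite subrr mulr0 addr0.
Qed.

Lemma gmap_Zset y : W y -> Zset (gmap y).
Proof.
move=> yW; have Vy := iota_W yW; split; last first.
  by rewrite iota_gmap distrC; apply/ball_normP.
move: (yW) => /ball_normP yr.
have Vc : V c by apply: ballxx; exact: rho0.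
have -> : gmap y - z0 = (perm_c y - perm_c (phi x0)) -
    (corr (iota_c (perm_c y)) - corr c).
  by rewrite /z0 /gmap iota_perm0; apply/colP => i; rewrite !colB; ring.
rewrite (le_lt_trans (ler_normB _ _))//.
have h1 : `|perm_c y - perm_c (phi x0)| <= `|phi x0 - y|.
  by rewrite (le_trans (perm_c_lip _ _))// distrC.
have h2 : `|iota_c (perm_c y) - c| <= `|phi x0 - y|.
  by rewrite -iota_perm0 (le_trans (iota_lip _ _)).
have h3 : `|corr (iota_c (perm_c y)) - corr c| <=
    `|phi (hinv (iota_c (perm_c y))) - phi (hinv c)|.
  apply: cV_norm_le => // r; rewrite colB !mxE; case: ifP => rk;
    first by rewrite subrr normr0.
  by apply: le_trans (coord_le _ (sg r)); rewrite colB.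
have h4 := phi_lip (hinvP Vy).1 (hinvP Vc).1.
have h5 := ler_wpM2l (ltW M0) (hinv_lip Vy Vc).
have h6 : M * (2 * A * `|iota_c (perm_c y) - c|) <= M * (2 * A * `|phi x0 - y|).
  by rewrite ler_wpM2l ?(ltW M0)// ler_wpM2l// mulr_ge0// ltW.
have h7 : (1 + 2 * A * M) * `|phi x0 - y| <= (1 + 2 * A * M) * rho.
  by rewrite ler_wpM2l ?(ltW yr)// addr_ge0// !mulr_ge0// ltW.
have : M * (2 * A * `|phi x0 - y|) = 2 * A * M * `|phi x0 - y| by ring.
by move: rho2 h7; rewrite !mulrDl !mul1r; lra.
Qed.

Lemma chart_DC l : DC n (K + 1) B (fun x => chart x l 0).
Proof.
have [lk|lk] := boolP (l < k)%N.
  apply: (@DC_ext _ _ _ _ _ _ (fun x => phi x (sg (inord l)) 0)).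
    by move=> x _; rewrite mxE lk.
  by apply: DC_le (phi_DC _) => //; rewrite lerDl.
apply: (@DC_ext _ _ _ _ _ _ (fun x => x (ta l) 0 + 0)).
  by move=> x _; rewrite mxE (negPf lk) addr0.
by apply: DC_coord; rewrite lerDr.
Qed.

Lemma chart_mx_GC l m : GC n (K + 1) B (fun x => chart_mx x l m).
Proof.
have [lk|lk] := boolP (l < k)%N.
  apply: (@GC_ext _ _ _ _ _ _ (fun x => D x (sg (inord l)) m)).
    by move=> x _; rewrite mxE lk.
  by apply: GC_le (D_GC _ _) => //; rewrite lerDl.
apply: (@GC_ext _ _ _ _ _ _ (fun x => (m == ta l)%:R)).
  by move=> x _; rewrite mxE (negPf lk).
apply: GC_cst; case: (m == _); rewrite ?normr1 ?normr0 ?addr_ge0//.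
by rewrite lerDr.
Qed.

Lemma iota_DC X l : DC n 1 X (fun z => iota_c z l 0).
Proof.
have [lk|lk] := boolP (l < k)%N.
  apply: (@DC_ext _ _ _ _ _ _ (fun z => z (inord l) 0 + 0)).
    by move=> x _; rewrite mxE lk addr0.
  exact: DC_coord.
apply: (@DC_ext _ _ _ _ _ _ (fun x => c l 0)).
  by move=> x _; rewrite iota_cE (negPf lk).
exact: DC_cst.
Qed.

Lemma iota_perm_DC X l : DC n 1 X (fun z => iota_c (perm_c z) l 0).
Proof.
have [lk|lk] := boolP (l < k)%N.
  apply: (@DC_ext _ _ _ _ _ _ (fun z => z (sg (inord l)) 0 + 0)).
    by move=> x _; rewrite mxE lk mxE addr0.
  exact: DC_coord.
apply: (@DC_ext _ _ _ _ _ _ (fun x => c l 0)).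
  by move=> x _; rewrite iota_cE (negPf lk).
exact: DC_cst.
Qed.

Variables (N : forall p k, tens R p k -> R) (gamma : R).

(** This predicate and the next two name the conclusions of [DC_inverse], [DC_comp] and [jets_out],
    so that constants can be fixed before [phi] and passed to this section. *)
Definition inverse_const (K' A' Kh : R) : Prop :=
  forall (B' V' : set 'cV[R]_p.+1) (f h : 'cV[R]_p.+1 -> 'cV[R]_p.+1)
    (E : 'cV[R]_p.+1 -> 'M[R]_p.+1), small B' -> small V' ->
  (forall u, V' u -> B' (h u) /\ f (h u) = u) ->
  (forall i j, GC n K' B' (fun x => E x i j)) ->
  (forall x y, B' x -> B' y ->
     `|f x - f y - E y *m (x - y)| <= K' * (`|x - y| * om `|x - y|)) ->
  (forall x, B' x -> inj_bound A' (E x)) ->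
  (forall u v, V' u -> V' v -> `|h u - h v| <= A' * `|u - v|) ->
  forall j, DC n Kh V' (fun u => h u j 0).

Definition comp_const (p' q' : nat) (K' Kc : R) : Prop :=
  forall (X : set 'cV[R]_p') (Y : set 'cV[R]_q') f (h : 'cV[R]_p' -> 'cV[R]_q'),
  small X -> (forall x, X x -> Y (h x)) -> DC n K' Y f ->
  (forall j, DC n K' X (fun x => h x j 0)) -> DC n Kc X (f \o h).

Definition jets_const (p' q' : nat) (K' cj : R) : Prop :=
  forall (X : set 'cV[R]_p') (f : 'cV[R]_p' -> 'cV[R]_q'), open X -> cvx X ->
  (forall a, DC n K' X (fun x => f x a 0)) ->
  exists2 jf : jet R p' 'cV[R]_q', almost_lip N gamma X f jf &
    lip_bound N (@opnorm R q' p') (gamma - 1) X (djet jf) cj.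

(** Class constants of [hinv], of [phi \o hinv], of the correction and of the local inverse; then
    the jet constants of [chart], of [hinv], of [gmap] and its inverse, and of the local inverse,
    all dominated by [cc]. *)
Variables (Kh Kc Kd Ke cF ch cg ce cc : R).
Hypotheses (Kh0 : 0 <= Kh) (Kc0 : 0 <= Kc) (Kd0 : 0 <= Kd).
Hypothesis inv_h : inverse_const (K + 1) (2 * A) Kh.
Hypothesis comp_c : comp_const p.+1 p.+1 (K + Kh) Kc.
Hypothesis comp_d : comp_const q.+1 p.+1 (Kc + 1) Kd.
Hypothesis comp_e : comp_const q.+1 p.+1 (Kh + 1) Ke.
Hypothesis jets_F : jets_const p.+1 p.+1 (K + 1) cF.
Hypothesis jets_h : jets_const p.+1 p.+1 Kh ch.
Hypothesis jets_g : jets_const q.+1 q.+1 (1 + Kd) cg.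
Hypothesis jets_e : jets_const q.+1 p.+1 Ke ce.
Hypotheses (cF_le : cF <= cc) (ch_le : ch <= cc) (cg_le : cg <= cc) (ce_le : ce
  <= cc).

Lemma B_small : small B. Proof. exact: small_ball. Qed.
Lemma V_small : small V. Proof. exact: small_ball. Qed.
Lemma W_small : small W. Proof. exact: small_ball. Qed.

Lemma hinv_DC j : DC n Kh V (fun u => hinv u j 0).
Proof.
apply: (inv_h (B' := B) (f := chart) (E := chart_mx)) => //.
- exact: B_small.
- exact: V_small.
- exact: hinvP.
- exact: chart_mx_GC.
- move=> x y xB yB; apply: chart_rem;
  first by rewrite !mulr_ge0 ?addr_ge0 ?om_ge0.
  rewrite (le_trans (phi_rem xB yB))// ler_wpM2r ?mulr_ge0 ?om_ge0//.
  by rewrite lerDl.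
- exact: chart_mx_inj.
- exact: hinv_lip.
Qed.

Lemma phi_hinv_DC a : DC n Kc V (fun u => phi (hinv u) a 0).
Proof.
apply: (comp_c (Y := B) (f := fun x => phi x a 0) (h := hinv)) => //.
- exact: V_small.
- by move=> u /hinvP[].
- by apply: DC_le (phi_DC a) => //; rewrite lerDl.
- by move=> j; apply: DC_le (hinv_DC j) => //; rewrite lerDr.
Qed.

Lemma corr_DC (X : set 'cV[R]_q.+1) (h : 'cV[R]_q.+1 ->
  'cV[R]_p.+1) r : small X ->
  (forall z, X z -> V (h z)) -> (forall l, DC n 1 X (fun z => h z l 0)) ->
  DC n Kd X (fun z => corr (h z) r 0).
Proof.
move=> sX XV hD; have [rk|rk] := boolP (r < k)%N.
  apply: (@DC_ext _ _ _ _ _ _ (fun=> 0)); first by move=> z _; rewrite mxE rk.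
  exact: DC_cst.
apply: (@DC_ext _ _ _ _ _ _ ((fun u => phi (hinv u) (sg r) 0) \o h)).
  by move=> z _; rewrite mxE (negPf rk).
apply: (comp_d (Y := V)) => //.
  by apply: DC_le (phi_hinv_DC _) => //; rewrite lerDl.
by move=> j; apply: DC_le (hD j) => //; rewrite lerDr.
Qed.

Lemma gmap_DC r : DC n (1 + Kd) W (fun y => gmap y r 0).
Proof.
apply: (@DC_ext _ _ _ _ _ _ (fun y => (y (sg r) 0 + 0) +
    - corr (iota_c (perm_c y)) r 0)).
  by move=> y _; rewrite /gmap colB [perm_c _ _ _]mxE addr0.
apply: DC_add; first exact: DC_coord.
apply: DC_opp; apply: corr_DC; [exact: W_small|exact: iota_W|].
by move=> l; exact: iota_perm_DC.
Qed.

Lemma gmapV_DC s : DC n (1 + Kd) Zset (fun z => gmapV z s 0).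
Proof.
apply: (@DC_ext _ _ _ _ _ _ (fun z => (z ((sg^-1)%g s) 0 + 0) +
    corr (iota_c z) ((sg^-1)%g s) 0)).
  by move=> y _; rewrite [RHS]mxE [RHS]mxE addr0.
apply: DC_add; first exact: DC_coord.
apply: corr_DC; [exact: Zset_small| |by move=> l; exact: iota_DC].
by move=> z [_ zc]; apply/ball_normP; rewrite distrC.
Qed.

Lemma hinv_iota_DC j : DC n Ke W (fun y => hinv (iota_c (perm_c y)) j 0).
Proof.
apply: (comp_e (Y := V) (f := fun u => hinv u j 0)
  (h := fun y => iota_c (perm_c y))) => //.
- exact: W_small.
- exact: iota_W.
- by apply: DC_le (hinv_DC j) => //; rewrite lerDl.
- by move=> l; apply: DC_le (iota_perm_DC W l) => //; rewrite lerDr.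
Qed.

(** Jets are built on the convex open [X] and restricted to [X'], which may be a non-convex
    image. *)
Lemma jets_on p' q' K' cj (X X' : set 'cV[R]_p') (f : 'cV[R]_p' -> 'cV[R]_q') :
  jets_const p' q' K' cj -> cj <= cc -> open X -> cvx X -> X' `<=` X ->
  (forall a, DC n K' X (fun x => f x a 0)) ->
  exists2 jf, almost_lip N gamma X' f jf & dlip_norm N gamma X' jf <= cc.
Proof.
move=> jc cjc oX cX sX fD; have [jf j1 j2] := jc X f oX cX fD.
exists jf; first exact: almost_lip_sub j1.
by apply: le_trans cjc; apply: dlip_norm_le; exact: lip_bound_sub j2.
Qed.

Lemma chart_U0_image : chart @` U0 `<=` V.
Proof. by move=> _ [x xU <-]; exact: chart_U0. Qed.

Lemma hinv_chart x : U0 x -> hinv (chart x) = x.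
Proof. by move=> xU; apply: hinvK; [exact: U0B|exact: chart_U0]. Qed.

Lemma straightened_core : straightened N gamma cc k phi x0 U0.
Proof.
have [jF jF1 jF2] := jets_on jets_F cF_le (ball_open x0 al) (@cvx_ball _ _ x0
  al)
  U0B chart_DC.
have [jh jh1 jh2] := jets_on jets_h ch_le (ball_open c rho) (@cvx_ball _ _ c
  rho)
  chart_U0_image hinv_DC.
have [jg jg1 jg2] := jets_on jets_g cg_le (ball_open (phi x0) rho)
  (@cvx_ball _ _ (phi x0) rho) (fun _ h => h) gmap_DC.
have gW : gmap @` W `<=` Zset by move=> _ [y yW <-]; exact: gmap_Zset.
have [jgV jgV1 jgV2] := jets_on jets_g cg_le Zset_open Zset_cvx gW gmapV_DC.
exists chart, hinv, jF, jh, W, gmap, gmapV, jg, jgV; split.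
- split; last by rewrite ge_max jF2.
  split=> //; last by move=> x; exact: hinv_chart.
  by apply: inj_bij => x y /set_mem xU /set_mem yU; apply: chart_set_inj;
    exact: U0B.
- split; [exact: ball_open|exact: (ballxx _ rho0)|].
  by move=> _ [x xU <-]; exact: phi_U0.
- split; last by rewrite ge_max jg2.
  split=> //; last by move=> y _; exact: gmapK.
  by apply: inj_bij => x y _ _ /(congr1 gmapV); rewrite !gmapK.
- by move=> x [u uU <-]; apply: gmap_phi; exact: chart_U0.
Qed.

(** In full rank [trunc] is the identity and [iota_c \o perm_c \o phi] is the chart itself, so
    [hinv \o iota_c \o perm_c] inverts [phi] on the left. *)
Lemma local_inverse_core : k = p.+1 ->
  set_inj U0 phi /\ exists (V' : set 'cV[R]_q.+1) (psi : 'cV[R]_q.+1 ->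
    'cV[R]_p.+1)
     (jpsi : jet R q.+1 'cV[R]_p.+1),
     [/\ local_inverse U0 phi V' psi, almost_lip N gamma V' psi jpsi &
         dlip_norm N gamma V' jpsi <= cc].
Proof.
move=> kE; have psiK x : U0 x -> hinv (iota_c (perm_c (phi x))) = x.
  move=> xU; have xV := chart_U0 xU.
  have := iota_phi xV; rewrite hinv_chart// => ->.
  rewrite (_ : trunc _ = chart x) ?hinv_chart//.
  by apply/colP => l; rewrite truncE kE ltn_ord.
split.
  by move=> x y /set_mem xU /set_mem yU xy; rewrite -(psiK x xU) xy psiK.
have [je je1 je2] := jets_on jets_e ce_le (ball_open (phi x0) rho)
  (@cvx_ball _ _ (phi x0) rho) (fun _ h => h) hinv_iota_DC.
exists W, (fun y => hinv (iota_c (perm_c y))), je; split=> //.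
by split=> // _ [x xU <-]; exact: phi_U0.
Qed.

End Straight.

(** * Reduction to the core construction and choice of constants *)

Lemma gamma_decomp (R : realType) (gamma : R) : 1 < gamma ->
  exists n : nat, exists2 eps : R, 0 < eps <= 1 & gamma = n.+1%:R + eps.
Proof.
move=> g1; have c1 : 1 < Num.ceil gamma by rewrite real_ceil_gt_int ?num_real.
have [/andP[h1 h2]] := (real_ceil_itv (num_real gamma), tt).
case: (Num.ceil gamma) c1 h1 h2 => [[|[|m]]|m] //= _ h1 h2.
exists m, (gamma - m.+1%:R); last by rewrite addrC subrK.
move: h1 h2; rewrite (_ : Posz m.+2 - 1 = Posz m.+1) -?pmulrn => [h1 h2|].
  by rewrite subr_gt0 h1/= lerBlDr nat1r.
by rewrite -[m.+2]addn1 PoszD addrK.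
Qed.

Lemma straightened_le (R : realType) (N : forall p k, tens R p k -> R)
    (p q : nat) (gamma c c' : R) k (phi : 'cV[R]_p ->
      'cV[R]_q) x0 U0 : c <= c' ->
  straightened N gamma c k phi x0 U0 -> straightened N gamma c' k phi x0 U0.
Proof.
move=> cc [f [finv [jf [jfinv [W [g [ginv [jg [jginv [[h1 h2] h3 [h4 h5]
  h6]]]]]]]]]].
exists f, finv, jf, jfinv, W, g, ginv, jg, jginv; split=> //; split=> //.
  exact: le_trans cc.
exact: le_trans cc.
Qed.

Lemma lip_bound_le (R : realType) (N : forall p k, tens R p k -> R)
    (hN : tensor_norms N) p q g (X : set 'cV[R]_p) (f : jet R p 'M[R]_(q,
      p)) M M' :
  M <= M' -> lip_bound N (@opnorm R q p) g X f M ->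
    lip_bound N (@opnorm R q p) g X f M'.
Proof.
move=> MM [M0 fM]; split; first exact: le_trans MM.
move=> k kn x y xX yX v; have [h1 h2] := fM k kn x y xX yX v.
have n0 : 0 <= N p k (pure v) by rewrite (norm_pure hN) prodr_ge0.
split; first by rewrite (le_trans h1)// ler_wpM2r.
by rewrite (le_trans h2)// ler_wpM2r// ler_wpM2r// powR_ge0.
Qed.

(** The norm is an infimum; taking a strictly larger number avoids proving that it is attained. The
    almost Lipschitz hypothesis makes the set of bounds nonempty, hence its [inf] meaningful. *)
Lemma dlip_norm_lt (R : realType) (N : forall p k, tens R p k -> R)
    (hN : tensor_norms N) p q gamma (U : set 'cV[R]_p) phi (f : jet R p
      'cV[R]_q) M M' :
  almost_lip N gamma U phi f -> dlip_norm N gamma U f <= M -> M < M' ->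
  lip_bound N (@opnorm R q p) (gamma - 1) U (djet f) M'.
Proof.
move=> [d _ [_ _ [_ [M0 fM0]] _]] fM MM.
have hi : has_inf [set M | lip_bound N (@opnorm R q p) (gamma - 1) U (djet f)
  M].
  by split; [exists M0|exists 0 => m []].
have MM0 : 0 < M' - M by rewrite subr_gt0.
have [m mP mM] := inf_adherent MM0 hi.
apply: (lip_bound_le hN _ mP); apply: ltW; apply: lt_le_trans mM _.
by rewrite -[leRHS](subrK M) addrC lerD2l.
Qed.

(** After permutation the chart matrix is block triangular, with diagonal blocks [P] and the
    identity. The unselected coordinates [z2] are read off directly, the others solved with
    [invmx P], at the cost [M * |z2|] of the off-diagonal block. For [k = p.+1] there is no [z2],
    whence the sharper bound [M2]. *)
Lemma chart_mx_inj_bound (R : realType) p q k (J : 'cV[R]_p.+1 -> 'M[R]_(q.+1,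
  p.+1))
    (x0 : 'cV[R]_p.+1) (i : 'I_k -> 'I_q.+1) (j : 'I_k -> 'I_p.+1)
    (sg : {perm 'I_q.+1}) (ta : {perm 'I_p.+1}) (M M2 : R) :
  (k <= p.+1)%N -> 0 <= M -> 0 <= M2 ->
  (forall r : 'I_k, sg (inord r) = i r) -> (forall r : 'I_k,
    ta (inord r) = j r) ->
  let P := \matrix_(r < k, l < k) J x0 (i r) (j l) in
  P \in unitmx -> opnorm (invmx P) <= M2 -> opnorm (J x0) <= M ->
  inj_bound (M2 * (1 + M) + 1) (chart_mx k J sg ta x0) /\
  (k = p.+1 -> inj_bound M2 (chart_mx k J sg ta x0)).
Proof.
move=> kp M0 M20 sgi taj P uP PM JM.
set E := chart_mx k J sg ta x0.
have Emul (z : 'cV[R]_p.+1) l : (E *m z) l 0 = if (l < k)%N then (J x0 *m z)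
  (sg (inord l)) 0 else z (ta l) 0.
  exact: chart_mx_mul.
suff main (z : 'cV[R]_p.+1) : exists2 b2, 0 <= b2 <= `|E *m z| &
    (k = p.+1 -> b2 = 0) /\ `|z| <= Num.max (M2 * (`|E *m z| + M * b2)) b2.
  have b0 (z : 'cV[R]_p.+1) : 0 <= `|E *m z| by exact: normr_ge0.
  split=> [z|kE z]; have [b2 /andP[b20 b2E] [kb zb]] := main z.
    rewrite (le_trans zb)// ge_max mulrDl mul1r; apply/andP; split.
      rewrite (@le_trans _ _ (M2 * (1 + M) * `|E *m z|)) ?lerDl//.
      rewrite -mulrA ler_wpM2l// mulrDl mul1r lerD2l ler_wpM2l//.
    by rewrite (le_trans b2E)// lerDr !mulr_ge0 ?addr_ge0.
  by move: zb; rewrite (kb kE) mulr0 addr0 (max_idPl _)// mulr_ge0.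
pose z2 : 'cV[R]_p.+1 := \col_m if ((ta^-1)%g m < k)%N then 0 else z m 0.
pose ze : 'cV[R]_k := \col_l z (j l) 0.
exists `|z2|.
  rewrite normr_ge0/=; apply: cV_norm_le => // m; rewrite mxE.
  case: ifP => mk; first by rewrite normr0.
  have := Emul z ((ta^-1)%g m); rewrite mk permKV => <-.
  exact: coord_le.
split.
  move=> kE; apply/eqP; rewrite normr_eq0; apply/eqP/colP => m.
  by rewrite !mxE kE ltn_ord.
have Pze (r : 'I_k) : (P *m ze) r 0 = (E *m z) (inord r) 0 - (J x0 *m z2) (i r)
  0.
  have rp : (r < p.+1)%N by rewrite (leq_trans (ltn_ord r)).
  rewrite Emul inordK// ltn_ord sgi -colB -mulmxBr [RHS]mxE.
  rewrite (reindex_inj (@perm_inj _ ta)) /= (bigID (fun l : 'I_p.+1 =>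
    (l < k)%N))/=.
  rewrite [X in _ = _ + X]big1 ?addr0; last first.
    by move=> l /negPf lk; rewrite colB [z2 _ _]mxE permK lk subrr mulr0.
  rewrite mxE (big_ord_narrow kp) /=; apply: eq_bigr => l _.
  rewrite colB [z2 _ _]mxE permK /= ltn_ord subr0 !mxE -taj.
  by congr (J x0 (i r) (ta _) * z (ta _) 0); apply: val_inj;
    rewrite /= inordK// (leq_trans (ltn_ord l)).
have zeb : `|ze| <= M2 * (`|E *m z| + M * `|z2|).
  rewrite -[ze](mulKmx uP) (le_trans (opnormP _ _))// ler_pM ?opnorm_ge0//.
  apply: cV_norm_le => [|r]; first by rewrite addr_ge0 ?mulr_ge0.
  rewrite Pze (le_trans (ler_normB _ _))// lerD ?coord_le//.
  rewrite (le_trans (coord_le _ _))// (le_trans (opnormP _ _))//.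
  by rewrite ler_wpM2r.
apply: cV_norm_le => [|m]; first by rewrite le_max normr_ge0 orbT.
rewrite le_max; have [mk|mk] := boolP ((ta^-1)%g m < k)%N.
  apply/orP; left; apply: le_trans zeb.
  have := coord_le ze (Ordinal mk); rewrite mxE -taj /=.
  by rewrite inord_val permKV.
apply/orP; right; have := coord_le z2 m.
by rewrite mxE (negPf mk).
Qed.

Section Constants.
Variables (R : realType) (eps : R) (heps : 0 < eps <= 1).
Variables (N : forall p k, tens R p k -> R) (hN : tensor_norms N).
Variables (gamma : R) (n : nat) (hgamma : gamma = n.+1%:R + eps).
Variables (p q : nat) (M A : R) (M0 : 0 < M) (A0 : 0 < A).

Lemma core_constants : exists c dl : R, 0 < dl /\
  forall k (U : set 'cV[R]_p.+1) (phi : 'cV[R]_p.+1 -> 'cV[R]_q.+1)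
    (jphi : jet R p.+1 'cV[R]_q.+1) (x0 : 'cV[R]_p.+1)
    (sg : {perm 'I_q.+1}) (ta : {perm 'I_p.+1}) (al r0 : R),
  (k <= p.+1)%N -> (k <= q.+1)%N -> almost_lip N gamma U phi jphi ->
  lip_bound N (@opnorm R q.+1 p.+1) (gamma - 1) U (djet jphi) M ->
  (forall x, U x -> (\rank (jac jphi x) <= k)%N) ->
  inj_bound A (chart_mx k (jac jphi) sg ta x0) ->
  0 < al -> al <= dl -> ball x0 al `<=` U ->
  r0 <= al -> M * r0 <= al / (2 * A) ->
  k = p.+1 \/ r0 <= al / (2 * A) ->
  [/\ straightened N gamma c k phi x0 (ball x0 r0),
      forall x, ball x0 r0 x -> inj_bound (2 * A) (chart_mx k (jac jphi) sg ta
        x) &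
      k = p.+1 -> set_inj (ball x0 r0) phi /\
        exists (V : set 'cV[R]_q.+1) (psi : 'cV[R]_q.+1 -> 'cV[R]_p.+1)
          (jpsi : jet R q.+1 'cV[R]_p.+1),
        [/\ local_inverse (ball x0 r0) phi V psi,
          almost_lip N gamma V psi jpsi &
         dlip_norm N gamma V jpsi <= c]].
Proof.
have A00 := ltW A0; have M00 := ltW M0.
pose rK := remK n p.+1 M; have rK0 : 0 <= rK by rewrite !mulr_ge0.
pose K := n.+1%:R * M + rK; have K0 : 0 <= K by rewrite addr_ge0 ?mulr_ge0.
have [Kh Kh0 hinv_c] := DC_inverse heps p.+1 n (addr_ge0 K0 ler01) (mulr_ge0
  (ler0n R 2) A00).
have [Kc Kc0 comp_c] := DC_comp heps p.+1 p.+1 n (addr_ge0 K0 Kh0).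
have [Kd Kd0 comp_d] := DC_comp heps q.+1 p.+1 n (addr_ge0 Kc0 ler01).
have [Ke Ke0 comp_e] := DC_comp heps q.+1 p.+1 n (addr_ge0 Kh0 ler01).
have [cF cF0 jets_F] := jets_out heps hN hgamma p.+1 p.+1 (addr_ge0 K0 ler01).
have [ch ch0 jets_h] := jets_out heps hN hgamma p.+1 p.+1 Kh0.
have [cg cg0 jets_g] := jets_out heps hN hgamma q.+1 q.+1 (addr_ge0 ler01 Kd0).
have [ce ce0 jets_e] := jets_out heps hN hgamma q.+1 p.+1 Ke0.
have A4 : 0 < (4 * A)^-1 by rewrite invr_gt0 mulr_gt0.
have rK1 : 0 < rK + 1 by rewrite ltr_wpDl.
have [d1 d10 oms] := om_small heps (divr_gt0 A4 rK1).
have AM : 0 < 1 + 2 * A * M by rewrite addr_gt0 ?mulr_gt0.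
(* In order: the Jacobian varies by at most [(4 * A)^-1] on the ball, the ball is small,
   [2 * rho <= 1], and the growth of [gmap] stays below 1/2. *)
pose dl := Num.min (Num.min d1 2^-1) (Num.min A (A / (2 * (1 + 2 * A * M)))).
exists (cF + ch + (cg + ce)), dl; split.
  by rewrite !lt_min d10 A0 invr_gt0 ltr0n /= divr_gt0// mulr_gt0.
move=> k U phi jphi x0 sg ta al r0 kp kq hphi hM rk E0 al0.
rewrite !le_min => /andP[/andP[ald1 al2] /andP[alA alAM]] BU r0al Mr0 kr0.
set B := ball x0 al in BU.
have x0B : B x0 by exact: ballxx.
have cB : cvx B by exact: cvx_ball.
have al21 : 2 * al <= 1 by lra.
have sB : small B by exact: small_ball.
have jc x : B x -> opnorm (jac jphi x - jac jphi x0) <= (4 * A)^-1.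
  move=> xB; rewrite (le_trans (jac_holder heps hN hgamma hphi hM BU sB xB
    x0B))// -/rK.
  have : om eps `|x - x0| < (4 * A)^-1 / (rK + 1).
    by apply: oms => //; rewrite distrC (lt_le_trans _ ald1)//;
      apply/ball_normP.
  rewrite ltr_pdivlMr// => h; have := om_ge0 eps `|x - x0|; move: h; lra.
have rho1 : 2 * (al / (2 * A)) <= 1.
  by rewrite invfM mulrCA [2 * _]mulrA divff// mul1r ler_pdivrMr// mul1r.
have rho2 : (1 + 2 * A * M) * (al / (2 * A)) < 2^-1.
  rewrite mulrA ltr_pdivrMr ?mulr_gt0// mulrA mulVf// mul1r.
  move: alAM; rewrite ler_pdivlMr ?mulr_gt0// => h.
  have h0 : 0 < al * (1 + 2 * A * M) by rewrite mulr_gt0.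
  rewrite mulrC; move: h h0 A0; rewrite mulrCA; lra.
have phiDC a : DC eps n K B (fun x => phi x a 0).
  exact: (phi_DC heps hN hgamma hphi hM BU cB sB).
have jGC a j : GC eps n K B (fun x => jac jphi x a j).
  by apply: GC_le (jac_GC heps hN hgamma hphi hM BU sB a j) => //;
    rewrite lerDl.
have phirem x y : B x -> B y ->
  `|phi x - phi y - jac jphi y *m (x - y)| <= K * (`|x - y| * om eps `|x - y|).
  move=> xB yB; rewrite (le_trans (phi_rem heps hN hgamma hphi hM BU cB sB xB
    yB))//.
  by rewrite ler_wpM2r ?mulr_ge0 ?om_ge0// lerDr mulr_ge0.
have jb x : B x -> opnorm (jac jphi x) <= M.
  by move=> /BU xU; apply: (jac_opnorm heps hN hgamma hM).
have phiclose x y : B x -> B y ->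
  `|phi x - phi y - jac jphi x0 *m (x - y)| <= (4 * A)^-1 * `|x - y|.
  move=> xB yB; apply: (phi_mean heps hN hgamma hphi hM BU cB) => //;
    first exact: ltW.
  by move=> z zB _; exact: jc.
have philip x y : B x -> B y -> `|phi x - phi y| <= M * `|x - y|.
  (* The Lipschitz bound is the mean value inequality with [L = 0]. *)
  move=> xB yB; have := @phi_mean _ _ heps _ hN _ _ hgamma _ _ _ _ _ hphi _ hM
    B 0 M x y BU cB xB yB M00.
  by rewrite mul0mx subr0; apply => z zB _; rewrite subr0 jb.
have jrk x : B x -> (\rank (jac jphi x) <= k)%N by move=> /BU; exact: rk.
split.
- apply: (straightened_core heps K0 M0 A0 kp kq al0 al21 rho1 rho2 phiDC jGC
  phirem
    jb jc phiclose philip jrk E0 r0al Mr0 kr0 Kh0 Kc0 Kd0 hinv_c comp_c comp_d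
    jets_F jets_h jets_g); lra.
- move=> x xU; apply: (chart_mx_inj A0 jc E0).
  exact: (le_ball r0al).
- move=> kE; apply: (local_inverse_core K0 M0 A0 al0 al21 rho1 jGC phirem
    jc phiclose philip E0 r0al Mr0 kr0 Kh0 hinv_c comp_e jets_e);
      [lra|exact: kE].
Qed.

End Constants.

Lemma homo_ltn_inj k m (f : 'I_k -> 'I_m) : {homo f : a b / (a < b)%N} ->
  injective f.
Proof.
move=> fh a b fab; apply/val_inj; case: (ltngtP a b) => // h.
  by have := fh _ _ h; rewrite fab ltnn.
by have := fh _ _ h; rewrite fab ltnn.
Qed.

Theorem theorem3p11 (R : realType) (N : forall p k, tens R p k -> R)
    (hN : tensor_norms N) (gamma : R) (p q k : nat) (M1 M2 : R)
    (hgamma : 1 < gamma) (hp : (0 < p)%N) (hq : (0 < q)%N)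
    (hM1 : 0 < M1) (hM2 : 0 < M2) :
  exists c delta : R, 0 < delta /\
  forall (U : set 'cV[R]_p) (phi : 'cV[R]_p -> 'cV[R]_q)
         (jphi : jet R p 'cV[R]_q) (x0 : 'cV[R]_p)
         (i : 'I_k -> 'I_q) (j : 'I_k -> 'I_p),
    open U ->
    almost_lip N gamma U phi jphi ->
    (forall x, U x -> (\rank (diff_mx phi x) <= k)%N) ->
    U x0 ->
    \rank (diff_mx phi x0) = k ->
    {homo i : a b / (a < b)%N} ->
    {homo j : a b / (a < b)%N} ->
    partial_mx phi i j x0 \in unitmx ->
    dlip_norm N gamma U jphi <= M1 ->
    opnorm (invmx (partial_mx phi i j x0)) <= M2 ->
    (exists U0 : set 'cV[R]_p,
       [/\ open U0, U0 x0, U0 `<=` U &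
           straightened N gamma c k phi x0 U0]) /\
    (k = p ->
     forall alpha : R, 0 < alpha <= delta ->
       closed_ball x0 alpha `<=` U ->
       let U0 : set 'cV[R]_p := ball x0 (alpha / (3 * Num.max 1 (M1 * M2))) in
       [/\ straightened N gamma c p phi x0 U0,
           set_inj U0 phi,
           immersion_on U0 phi &
           exists (V : set 'cV[R]_q) (psi : 'cV[R]_q -> 'cV[R]_p)
                  (jpsi : jet R q 'cV[R]_p),
             [/\ local_inverse U0 phi V psi,
                 almost_lip N gamma V psi jpsi &
                 dlip_norm N gamma V jpsi <= c]]).
Proof.
case: p hp => [//|p _]; case: q hq => [//|q _].
have [n [eps heps hg]] := gamma_decomp hgamma.
(* The factor must exceed 1 for [dlip_norm_lt], and be at most 3/2 so that the radius
   [alpha / (3 * max(1, M1 * M2))] still satisfies [M * r0 <= alpha / (2 * M2)]. *)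
pose M : R := 5 / 4 * M1; have M0 : 0 < M by rewrite mulr_gt0// divr_gt0.
have M1M : M1 < M by rewrite /M; lra.
pose A := M2 * (1 + M) + 1.
have A0 : 0 < A by rewrite addr_gt0// mulr_gt0// addr_gt0.
have [c1 [d1 [d10 core1]]] := core_constants heps hN hg p q M0 A0.
have [c2 [d2 [d20 core2]]] := core_constants heps hN hg p q M0 hM2.
exists (Num.max c1 c2), d2; split=> //
  U phi jphi x0 i j oU hphi rk xU rk0 hi hj uP dM PM2.
have hM := dlip_norm_lt hN hphi dM M1M.
have jE x : U x -> diff_mx phi x = jac jphi x.
  by move=> ?; apply: (diff_mxE heps hN hg hphi hM).
have kp : (k <= p.+1)%N by rewrite -rk0 rank_leq_col.
have kq : (k <= q.+1)%N by rewrite -rk0 rank_leq_row.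
have jrk x : U x -> (\rank (jac jphi x) <= k)%N.
  by move=> yU; rewrite -jE//; exact: rk.
have [sg sgE] := extend_perm (homo_ltn_inj hi).
have [ta taE] := extend_perm (homo_ltn_inj hj).
rewrite (partial_mxE heps hN hg hphi hM i j xU oU) in uP PM2.
have [EA EM2] := chart_mx_inj_bound kp (ltW M0) (ltW hM2) sgE taE uP PM2
  (jac_opnorm heps hN hg hM xU).
split.
  have [d d0 dU] := open_ballP oU xU.
  pose al := Num.min d1 d; have al0 : 0 < al by rewrite lt_min d10.
  have alU : ball x0 al `<=` U.
    move=> y /ball_normP xy; rewrite -(subrK x0 y) addrC; apply: dU.
    by rewrite distrC (lt_le_trans xy)// ge_min lexx orbT.
  pose rho := al / (2 * A); have rho0 : 0 < rho by rewrite divr_gt0// mulr_gt0.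
  (* The radius may be as small as convenient here, so all three conditions of the core construction
     are imposed at once. *)
  pose r0 := Num.min al (Num.min rho (rho / M)).
  have r00 : 0 < r0 by rewrite lt_min al0 lt_min rho0 divr_gt0.
  have [r0al r0rho r0M] : [/\ r0 <= al, r0 <= rho & M * r0 <= rho].
    split; [by rewrite ge_min lexx|by rewrite /r0 !ge_min lexx !orbT|].
    by rewrite mulrC -ler_pdivlMr// /r0 !ge_min lexx !orbT.
  have ald1 : al <= d1 by rewrite /al ge_min lexx.
  have [st _ _] := core1 k U phi jphi x0 sg ta al r0 kp kq hphi hM jrk EA al0
    ald1
    alU r0al r0M (or_intror r0rho).
  exists (ball x0 r0); split; [exact: ball_open|exact: ballxx| |].
    by move=> y /(le_ball r0al)/alU.
  by apply: straightened_le st; rewrite le_max lexx.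
move=> kE al /andP[al0 ald2] cbU; set mx := Num.max 1 (M1 * M2).
have mx1 : 1 <= mx by rewrite le_max lexx.
have mxM : M1 * M2 <= mx by rewrite le_max lexx orbT.
have mx0 : 0 < mx by rewrite (lt_le_trans _ mx1).
pose r0 := al / (3 * mx); rewrite -/r0.
have alU : ball x0 al `<=` U by move=> y /subset_closed_ball /cbU.
have r0al : r0 <= al.
  rewrite ler_pdivrMr ?mulr_gt0// ler_peMr ?(ltW al0)//; lra.
have r0M : M * r0 <= al / (2 * M2).
  rewrite /r0 ler_pdivlMr ?mulr_gt0// /M.
  have -> : 5 / 4 * M1 * (al / (3 * mx)) * (2 * M2) = al * (5 / 6 * (M1 * M2) /
    mx).
    by field; rewrite gt_eqF.
  rewrite ler_piMr ?(ltW al0)// ler_pdivrMr// mul1r.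
  have : 0 < M1 * M2 by rewrite mulr_gt0.
  lra.
have [st Einj linv] := core2 k U phi jphi x0 sg ta al r0 kp kq hphi hM jrk (EM2
  kE) al0 ald2
  alU r0al r0M (or_introl kE).
have [si [V [psi [jpsi [h1 h2 h3]]]]] := linv kE.
split.
- by rewrite kE in st; apply: straightened_le st; rewrite le_max lexx orbT.
- exact: si.
- move=> x xB; have xU' : U x by apply: alU; exact: (le_ball r0al).
  have [df dE] := phi_diff heps hN hg hphi hM xU' oU; split=> // v w.
  (* For [k = p] every row of the chart matrix is a row of the Jacobian, so injectivity of the
     former passes to the latter. *)
  rewrite dE => vw; apply/eqP; rewrite -subr_eq0 -normr_le0.
  rewrite (le_trans (Einj x xB _))// (_ : _ *m _ = 0) ?normr0 ?mulr0//.
  apply/colP => l; rewrite chart_mx_mul kE ltn_ord mulmxBr vw subrr.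
  by rewrite !mxE.
- by exists V, psi, jpsi; split=> //; rewrite (le_trans h3)// le_max lexx orbT.
Qed.
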